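(* Let $n\in\mathbb{N}\setminus\{1,2\}$. Then: (a) There is a set $U\in\mathcal{U}^{n}_{4,\mathbb{Q}}$ with $\operatorname{card}(U)=4$ such that, for all cyclotomic model sets $\Lambda_n(t,W)\in\mathcal{M}(\mathcal{O}_n)$, the set $\mathcal{C}(\Lambda_n(t,W))$ is determined by the $X$-rays in the directions of $U$. Furthermore, any set $U\in\mathcal{U}^{n}_{4,\mathbb{Q}}$ with $\operatorname{card}(U)=4$ having the property that the cross ratio of slopes of the directions of $U$, arranged in order of increasing angle with the positive real axis, is not an element of the set $N_1=\{\frac43,\frac32,2,3,4\}$ is suitable for this purpose. (b) Let $U\subset\mathbb{S}^1$ be any set of three or less pairwise non-parallel $\mathcal{O}_n$-directions. Then, for all cyclotomic model sets $\Lambda_n(t,W)\in\mathcal{M}(\mathcal{O}_n)$, the set $\mathcal{C}(\Lambda_n(t,W))$ is not determined by the $X$-rays in the directions of $U$. (c) Let $U\in\mathcal{U}^{n}_{4,\mathbb{Q}}$ with $\operatorname{card}(U)=7$. Then, for all cyclotomic model sets $\Lambda_n(t,W)\in\mathcal{M}(\mathcal{O}_n)$, the set $\mathcal{C}(\Lambda_n(t,W))$ is determined by the $X$-rays in the directions of $U$. (d) There is a set $U\in\mathcal{U}^{n}_{4,\mathbb{Q}}$ with $\operatorname{card}(U)=6$ such that, for all cyclotomic model sets $\Lambda_n(t,W)\in\mathcal{M}(\mathcal{O}_n)$, the set $\mathcal{C}(\Lambda_n(t,W))$ is not determined by the $X$-rays in the directions of $U$.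
   Context: Identify $\mathbb{C}$ with $\mathbb{R}^2$. Let $\zeta_n=e^{2\pi i/n}$, $\mathbb{K}_n=\mathbb{Q}(\zeta_n)$, $\mathcal{O}_n=\mathbb{Z}[\zeta_n]$, and let $\phi$ be Euler's totient function. Cyclotomic model sets. For $n\in\mathbb{N}\setminus\{1,2\}$, choose exactly one automorphism from each pair of complex conjugate automorphisms in $\mathrm{Gal}(\mathbb{K}_n/\mathbb{Q})$, obtaining $\sigma_1=\mathrm{id},\sigma_2,\dots,\sigma_{\phi(n)/2}$. The associated star map $\star:\mathcal{O}_n\to(\mathbb{R}^2)^{\phi(n)/2-1}$ is $z\mapsto(\sigma_2(z),\dots,\sigma_{\phi(n)/2}(z))$; if $n\in\{3,4,6\}$, $(\mathbb{R}^2)^{0}$ is the trivial group $\{0\}$ and the star map is $0$. A window is a set $W\subset(\mathbb{R}^2)^{\phi(n)/2-1}$ with $\varnothing\neq W^\circ\subset W\subset\overline{W^\circ}$ and $\overline{W^\circ}$ compact. For a window $W$ and $t\in\mathbb{R}^2$ set $\Lambda_n(t,W)=t+\{z\in\mathcal{O}_n : z^\star\in W\}$. $\mathcal{M}(\mathcal{O}_n)$ is the collection of all sets $\Lambda_n(t,W)$ (all $t$, all windows $W$, all choices of star map); its elements are called cyclotomic model sets. Directions and X-rays. A direction is an element of the unit circle $\mathbb{S}^1$; an $\mathcal{O}_n$-direction is a direction parallel to a non-zero element of $\mathcal{O}_n$. For a finite $F\subset\mathbb{R}^2$ and a direction $u$, the $X$-ray $X_uF$ is the function assigning to each line $\ell$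 parallel to $u$ the number $\operatorname{card}(F\cap\ell)$. A collection $\mathcal{E}$ of finite subsets of $\mathbb{R}^2$ is determined by the $X$-rays in the directions of a finite set $U$ of directions if for all $F,F'\in\mathcal{E}$: $(X_uF=X_uF'\ \forall u\in U)\Rightarrow F=F'$. Convex sets. For $S\subset\mathbb{R}^2$, $\mathcal{C}(S)$ is the set of all finite $C\subset S$ with $C=\operatorname{conv}(C)\cap S$. Cross ratios. The slope of $u=(x,y)$ is $y/x\in\mathbb{R}\cup\{\infty\}$. The cross ratio of an ordered tuple of four distinct elements of $\mathbb{R}\cup\{\infty\}$ is $(t_1,t_2;t_3,t_4)=\frac{(t_3-t_1)(t_4-t_2)}{(t_3-t_2)(t_4-t_1)}$, with the usual conventions if some $t_i=\infty$. The angle between a direction $u$ and the positive real axis is the unique $\theta\in[0,\pi)$ such that $e^{i\theta}$ is parallel to $u$. $\mathcal{U}^{n}_{4,\mathbb{Q}}$ is the collection of all sets $U\subset\mathbb{S}^1$ of four or more pairwise non-parallel $\mathcal{O}_n$-directions such that the cross ratio of slopes of any four directions of $U$ (arranged in arbitrary order) is in $\mathbb{Q}$. *)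

(* Defs.v *)
From HB Require Import structures.
From mathcomp Require Import all_boot all_order all_algebra.
From mathcomp Require Import finmap complex.
From mathcomp Require Import all_classical all_reals all_analysis.

Set Implicit Arguments.
Unset Strict Implicit.
Unset Printing Implicit Defensive.

Import Order.TTheory GRing.Theory Num.Theory.
Import numFieldNormedType.Exports.

Local Open Scope classical_set_scope.
Local Open Scope ring_scope.
Local Open Scope complex_scope.

(* The Euclidean plane is R[i], with R : realType. *)

Section CyclotomicField.
Variables (R : realType) (n : nat).

Definition zeta : R[i] := cos (2 * pi / n%:R) +i* sin (2 * pi / n%:R).

(* Q(zeta) *)
Definition cyc_field_pred : {pred R[i]} :=
  fun z => `[< exists p q : {poly rat},
    (map_poly ratr q).[zeta] != 0 /\
    z = (map_poly ratr p).[zeta] / (map_poly ratr q).[zeta] >].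

Record cyc_field := CycField {
  cyc_val :> R[i];
  _ : cyc_val \in cyc_field_pred
}.

Fact cyc_field_divring : divring_closed cyc_field_pred.
Proof.
pose ev (p : {poly rat}) : R[i] := (map_poly ratr p).[zeta].
have evM p q : ev (p * q) = ev p * ev q by rewrite /ev rmorphM hornerM.
have evB p q : ev (p - q) = ev p - ev q by rewrite /ev rmorphB hornerD hornerN.
have ev1 : ev 1 = 1 by rewrite /ev rmorph1 hornerC.
have ev0 : ev 0 = 0 by rewrite /ev rmorph0 horner0.
have K p q : ev q != 0 -> ev p / ev q \in cyc_field_pred.
  by move=> q0; apply/asboolP; exists p, q.
split.
- by have := K 1 1; rewrite ev1 divr1 oner_eq0; apply.
- move=> _ _ /asboolP[p [q [q0 ->]]] /asboolP[p' [q' [q0' ->]]].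
  have := K (p * q' - p' * q) (q * q').
  rewrite evB !evM mulf_neq0 // => /(_ isT).
  by rewrite -mulNr -addf_div // mulNr.
- move=> _ _ /asboolP[p [q [q0 ->]]] /asboolP[p' [q' [q0' ->]]].
  have [p0'|p0'] := eqVneq (ev p') 0.
    have := K 0 1; rewrite ev0 ev1 mul0r oner_eq0 => /(_ isT).
    by rewrite -/(ev p') p0' mul0r invr0 mulr0.
  have := K (p * q') (q * p').
  by rewrite !evM mulf_neq0 // => /(_ isT); rewrite -mulf_div invf_div.
Qed.

HB.instance Definition _ :=
  GRing.isDivringClosed.Build R[i] cyc_field_pred cyc_field_divring.
HB.instance Definition _ := [isSub for cyc_val].
HB.instance Definition _ := [Choice of cyc_field by <:].
HB.instance Definition _ := [SubChoice_isSubIntegralDomain of cyc_field by <:].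
HB.instance Definition _ := [SubIntegralDomain_isSubField of cyc_field by <:].

(* Z[zeta] *)
Definition cyc_int : {pred R[i]} :=
  fun z => `[< exists p : {poly int}, z = (map_poly intr p).[zeta] >].

Definition galQ (s : {rmorphism cyc_field -> cyc_field}) : Prop :=
  bijective s /\ forall q : rat, s (ratr q) = ratr q.

End CyclotomicField.

Section ModelSets.
Variables (R : realType) (n : nat).

(* The star map takes values in (R^2)^(phi(n)/2 - 1). *)
Definition star_dim : nat := ((totient n)./2).-1.

(* R[i]^o carries the topology of the complex norm, and row vectors the product
   topology; the space is a single point when star_dim = 0. *)
Definition star_space := 'rV[(R[i])^o]_star_dim.

(* One automorphism from each pair {tau, conj tau} of complex conjugate ones;
   for 2 < n there are star_dim.+1 = phi(n)/2 pairs. *)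
Definition star_choice
    (sigma : 'I_star_dim.+1 -> {rmorphism cyc_field R n -> cyc_field R n}) :=
  [/\ forall i, galQ (sigma i),
      sigma ord0 =1 id &
      forall tau : {rmorphism cyc_field R n -> cyc_field R n}, galQ tau ->
        exists! i, sigma i =1 tau \/
                   forall x, cyc_val (sigma i x) = (cyc_val (tau x))^*].

Definition star
    (sigma : 'I_star_dim.+1 -> {rmorphism cyc_field R n -> cyc_field R n})
    (z : cyc_field R n) : star_space :=
  \row_i cyc_val (sigma (lift ord0 i) z).

Definition window (W : set star_space) : Prop :=
  [/\ W° !=set0, W° `<=` W, W `<=` closure W° & compact (closure W°)].

Definition model_set
    (sigma : 'I_star_dim.+1 -> {rmorphism cyc_field R n -> cyc_field R n})
    (t : R[i]) (W : set star_space) : set R[i] :=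
  [set t + cyc_val z | z in
    [set z | cyc_val z \in @cyc_int R n /\ W (star sigma z)]].

Definition cyclotomic_model_sets : set (set R[i]) :=
  [set L | exists sigma t W,
    [/\ star_choice sigma, window W & L = model_set sigma t W]].

End ModelSets.

Section Tomography.
Variable R : realType.
Implicit Types (u v x : R[i]) (F : {fset R[i]}) (S : set R[i]).

Definition parallel u v : Prop := exists2 c : R, c != 0 & v = c%:C * u.

Definition direction u : Prop := `|u| = 1.

Definition cyc_direction (n : nat) u : Prop :=
  direction u /\ exists z, [/\ z \in @cyc_int R n, z != 0 & parallel z u].

Definition pairwise_nonparallel (U : {fset R[i]}) : Prop :=
  {in U &, forall u v, u != v -> ~ parallel u v}.

Definition lines u : set (set R[i]) :=
  [set l | exists x, l = [set x + c%:C * u | c in [set: R]]].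

Definition Xray u F (l : lines u) : nat :=
  #|` [fset x in F | x \in val l]%fset|.

Definition determined (E : set {fset R[i]}) (U : {fset R[i]}) : Prop :=
  forall F F', E F -> E F' -> {in U, forall u, Xray (u := u) F = Xray F'} ->
  F = F'.

(* Rcomplex R is R[i] as a vector space over R. *)
Definition convex_hull S : set R[i] :=
  smallest (@convex_set R (Rcomplex R)) S.

Definition convex_subsets S : set {fset R[i]} :=
  [set F : {fset R[i]} | [set` F] = convex_hull [set` F] `&` S].

(* None stands for the slope oo. *)
Definition slope u : option R :=
  if complex.Re u == 0 then None else Some (complex.Im u / complex.Re u).

(* Meant for four distinct slopes. When one of them is oo, the two factors
   containing it cancel. *)
Definition cross_ratio (t1 t2 t3 t4 : option R) : R :=
  match t1, t2, t3, t4 with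
  | Some a, Some b, Some c, Some d =>
      ((c - a) * (d - b)) / ((c - b) * (d - a))
  | None, Some b, Some c, Some d => (d - b) / (c - b)
  | Some a, None, Some c, Some d => (c - a) / (d - a)
  | Some a, Some b, None, Some d => (d - b) / (d - a)
  | Some a, Some b, Some c, None => (c - a) / (c - b)
  | _, _, _, _ => 0
  end.

(* The unique theta in [0, pi[ such that exp(i theta) is parallel to u. *)
Definition angle u : R :=
  xget 0 [set theta | 0 <= theta < pi /\
                      parallel (cos theta +i* sin theta) u].

Definition U4Q (n : nat) : set {fset R[i]} :=
  [set U : {fset R[i]} | [/\ (4 <= #|` U|)%N,
      {in U, forall u, cyc_direction n u},
      pairwise_nonparallel U &
      forall u1 u2 u3 u4, u1 \in U -> u2 \in U -> u3 \in U -> u4 \in U ->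
        uniq [:: u1; u2; u3; u4] ->
        exists q : rat,
          cross_ratio (slope u1) (slope u2) (slope u3) (slope u4) = ratr q]].

Definition N1 : seq R := [:: 4 / 3; 3 / 2; 2; 3; 4].

Definition ordered_cross_ratio_notin_N1 (U : {fset R[i]}) : Prop :=
  forall u1 u2 u3 u4, U = [fset u1; u2; u3; u4]%fset ->
    angle u1 < angle u2 -> angle u2 < angle u3 -> angle u3 < angle u4 ->
    cross_ratio (slope u1) (slope u2) (slope u3) (slope u4) \notin N1.

End Tomography.

(* Main.v *)
Require Import Defs.
From mathcomp Require Import all_boot all_order all_algebra all_field.
From mathcomp Require Import finmap complex.
From mathcomp Require Import all_classical all_reals all_analysis.
From mathcomp Require Import zify ring lra.

Set Implicit Arguments.
Unset Strict Implicit.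
Unset Printing Implicit Defensive.

Import Order.TTheory GRing.Theory Num.Theory.
Import numFieldNormedType.Exports.

Local Open Scope ring_scope.
Local Open Scope complex_scope.

(** A convex subset of a point set is recovered from few X-rays because two
    candidates with the same X-rays carry a hidden symmetry.

    Suppose that [F] and [F'] are different convex subsets of a set [S] with equal
    X-rays in the directions of [U].  The differences of [F] and [F'] in the two
    senses have the same centroid, which lies in both hulls; take it as origin, and
    list the points of the two differences by their angle about it, with a colour
    telling in which set each point lies.  Consecutive points of one colour form
    runs, [N] in a turn.  For [u] in [U], the points of the two colours on a line
    parallel to [u] are equally many, hence can be paired, and by convexity this
    pairing reverses the order of the runs on each side of the origin
    ([no_parallel_crossing], [reflection_runs], [direction_reflection]): it is a
    reflection of the cyclic sequence of runs.  So the two real components of the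
    first Fourier harmonic of the points, with respect to the number of the run,
    satisfy a linear relation which says that [u] is parallel to the image of an
    edge or a diagonal of a regular [N]-gon under one linear map independent of [u]
    ([direction_harmonics]).  This map is invertible: otherwise a
    trigonometric weight of the right signs would make a sum of non-negative terms,
    not all zero, vanish ([harm_nondegenerate]).  The outcome is
    [same_Xray_sines].

    A linear map preserves cross ratios.  Those of chords of a regular polygon are
    quotients of products of two numbers [1 - z], with [z] a root of unity, and the
    valuations of these numbers are known: [z] of order a power of a prime [p]
    gives a root of [p] up to a unit, any other [z] a unit.  A rational quotient
    larger than 1 is therefore 4/3, 3/2, 2, 3 or 4 ([rational_cyclotomic_ratio],
    [sines_ratio_N1]).  So four directions determine the convex subsets of any
    point set when their cross ratio is rational and not one of these five numbers,
    and so do seven directions with rational cross ratios, because seven points of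
    the projective line in cyclic order have some cross ratio outside this list
    ([four_directions_determine], [seven_directions_determine]).  The directions of
    slopes 0, infinity, 1 and 6, in the basis formed by 1 and [zeta], are an example
    of the first kind.

    For the negative results, take a convex polygon with vertices in [Z[zeta]]
    such that its vertices of even and of odd rank have the same X-rays in the
    directions of [U].  Any model set contains a homothetic copy of it
    ([homothetic_copy]), since [Z[zeta]] contains non-zero real numbers whose
    other conjugates are small, by the box principle ([small_norms]), and
    is dense in the internal space, by interpolation and rounding
    ([values_dense]).  It is also locally finite.  The points of the model set in
    the copy, without the vertices of one parity or of the other, are then two
    different convex subsets with the same X-rays ([polygon_not_determined]).  An
    affinely regular hexagon serves for three directions, and a 12-gon with the
    symmetries of the root system G2 for six. *)

(** * Runs of a coloured sequence *)

Section ColourRuns.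
Local Open Scope nat_scope.
Variable c : nat -> bool.

Definition runs (i : nat) : nat := \sum_(k < i) (c k != c k.+1).

Lemma runsS i : runs i.+1 = runs i + (c i != c i.+1).
Proof. by rewrite /runs big_ord_recr. Qed.

Lemma runs0 : runs 0 = 0.
Proof. by rewrite /runs big_ord0. Qed.

Lemma leq_runs i j : i <= j -> runs i <= runs j.
Proof.
elim: j => [|j IHj]; first by rewrite leqn0 => /eqP ->.
rewrite leq_eqVlt => /predU1P[->//|]; rewrite ltnS => /IHj h.
by rewrite runsS (leq_trans h) ?leq_addr.
Qed.

(** The two colours alternate from a run to the next one, so the colour of an index
    is read off the parity of its run. *)
Lemma odd_runs i : odd (runs i) = c i (+) c 0.
Proof.
elim: i => [|i IHi]; first by rewrite runs0 addbb.
by rewrite runsS oddD IHi; case: (c i); case: (c i.+1); case: (c 0).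
Qed.

Lemma runs_parity i j : (c i == c j) = (odd (runs i) == odd (runs j)).
Proof. by rewrite !odd_runs; case: (c i); case: (c j); case: (c 0). Qed.

Lemma ltn_runs i j : c i != c j -> i < j -> runs i < runs j.
Proof.
move=> cij lt_ij; rewrite ltn_neqAle leq_runs ?(ltnW lt_ij)// andbT.
by apply: contra cij; rewrite runs_parity => /eqP ->.
Qed.

Lemma runs_le_lt i j : c i != c j -> runs i <= runs j -> i < j.
Proof.
move=> cij h; rewrite ltnNge; apply/negP => ji.
have := leq_runs ji => h'.
by move: cij; rewrite runs_parity (_ : runs i = runs j) ?eqxx //; lia.
Qed.

(** The count of changes grows by at most one at each step, hence takes every
    intermediate value. *)
Lemma runs_ivt i j v : i <= j -> runs i <= v <= runs j ->
  exists2 k, i <= k <= j & runs k = v.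
Proof.
elim: j => [|j IHj] ij.
  move: ij; rewrite leqn0 => /eqP ->; rewrite runs0 => ?; exists 0 => //.
  by rewrite runs0; lia.
have [v_le|v_gt] := leqP v (runs j).
  case: (ltnP i j.+1) => ij1.
    move=> /andP[iv _]; have [||k ki kv] := IHj; [lia|lia|].
    by exists k => //; lia.
  have -> : i = j.+1 by lia.
  by move=> vv; exists j.+1; lia.
by move=> vv; exists j.+1; [lia|]; move: vv v_gt; rewrite runsS; case: (_ != _); lia.
Qed.

Section Periodic.
Variable L : nat.
Hypothesis cL : forall i, c (i + L) = c i.

Lemma runsDL i : runs (i + L) = runs i + runs L.
Proof.
elim: i => [|i IHi]; first by rewrite runs0.
by rewrite addSn !runsS IHi -addSn !cL addnAC.
Qed.

Lemma runsML m i : runs (i + m * L) = runs i + m * runs L.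
Proof.
elim: m => [|m IHm]; first by rewrite !mul0n !addn0.
by rewrite !mulSn (addnC L) addnA runsDL IHm -addnA (addnC (_ * _)%N).
Qed.

Lemma odd_runsL : ~~ odd (runs L).
Proof. by rewrite odd_runs -[L]add0n cL addbb. Qed.
End Periodic.

(** The relation [Q] between partners is known to reverse the order of oppositely
    coloured indices only.  That is enough: between two indices of one colour in
    different runs there is an index of the other colour, so that partners reverse
    the order of the runs, and change of colour is propagated one run at a time. *)
Section Reflection.
Variables (W : pred nat) (Q : nat -> nat -> Prop).
Hypothesis W_interval : forall i j z, W i -> W j -> i <= z <= j -> W z.
Hypothesis Q_sym : forall i j, Q i j -> Q j i.
Hypothesis Q_dom : forall i j, Q i j -> W i.
Hypothesis Q_ex : forall i, W i -> exists j, Q i j.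
Hypothesis Q_col : forall i j, Q i j -> c i != c j.
Hypothesis Q_rev : forall i i' j j', Q i i' -> Q j j' -> c i != c j ->
  i < j -> j' < i'.

Let Q_anti i i' j j' : Q i i' -> Q j j' -> runs i <= runs j -> runs j' <= runs i'.
Proof.
move=> Qi Qj le_ij; rewrite leqNgt; apply/negP => lt_ij'.
have := Q_col Qi; have := Q_col Qj; move=> cj ci.
have [cij|cij] := boolP (c i == c j); last first.
  have ij := runs_le_lt cij le_ij.
  by have := Q_rev Qi Qj cij ij => /ltnW/leq_runs; rewrite leqNgt lt_ij'.
have ij' : i' < j'.
  by rewrite ltnNge; apply/negP => /leq_runs; rewrite leqNgt lt_ij'.
have [|z zij rz] := @runs_ivt i' j' (runs i').+1 (ltnW ij'); first by rewrite lt_ij' leqnSn.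
have czi' : c z != c i' by rewrite runs_parity rz /=; case: (odd _).
have ii' := Q_dom (Q_sym Qi); have jj' := Q_dom (Q_sym Qj).
have [z' Qz] := Q_ex (W_interval ii' jj' zij).
have czi : c z = c i by move: czi' ci; case: (c z); case: (c i); case: (c i').
have iz : i' < z.
  move: zij => /andP[]; rewrite leq_eqVlt => /predU1P[zi|//] _.
  by rewrite zi eqxx in czi'.
have cjz : c j' != c z by rewrite czi (eqP cij) eq_sym.
have zj : z < j'.
  move: zij => /andP[_]; rewrite leq_eqVlt => /predU1P[zi|//].
  by rewrite zi eqxx in cjz.
have h1 : z' < i by apply: (Q_rev (Q_sym Qi) Qz) => //; rewrite eq_sym.
have h2 : j < z' by apply: (Q_rev Qz (Q_sym Qj)) => //; rewrite eq_sym.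
have cz'i : c j != c z' by have := Q_col Qz; rewrite czi -(eqP cij).
have := ltn_runs cz'i h2; rewrite eq_sym -(eqP cij) in cz'i.
have := ltn_runs cz'i h1; lia.
Qed.

Let Q_step m i i' j j' : Q i i' -> Q j j' -> runs i + m <= runs j ->
  runs j' + m <= runs i'.
Proof.
elim: m i i' j j' => [|m IHm] i i' j j' Qi Qj; rewrite ?addn0; first exact: Q_anti.
move=> le_ij.
have ij : i < j by rewrite ltnNge; apply/negP => /leq_runs; lia.
have [|z zij rz] := @runs_ivt i j (runs j).-1 (ltnW ij); first by lia.
have czj : c z != c j.
  by rewrite runs_parity rz; move: le_ij; case: (runs j) => [|r] //=; [lia|case: (odd r)].
have zj : z < j by rewrite ltnNge; apply/negP => /leq_runs; lia.
have [z' Qz] := Q_ex (W_interval (Q_dom Qi) (Q_dom Qj) zij).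
have jz := Q_rev Qz Qj czj zj.
have cz' : c j' != c z'.
  by move: czj (Q_col Qz) (Q_col Qj); case: (c z); case: (c j); case: (c z'); case: (c j').
have := ltn_runs cz' jz.
have := IHm i i' z z' Qi Qz; lia.
Qed.

Lemma reflection_runs i i' j j' : Q i i' -> Q j j' ->
  runs i + runs i' = runs j + runs j'.
Proof.
wlog le_ij : i i' j j' / runs i <= runs j => [hwlog Qi Qj|Qi Qj].
  by have [le_ij|/ltnW le_ji] := leqP (runs i) (runs j);
    [exact: hwlog|apply/esym; exact: hwlog].
have h1 : runs j' + (runs j - runs i) <= runs i' by apply: Q_step Qi Qj _; lia.
have h2 : runs i + (runs i' - runs j') <= runs j.
  by apply: (Q_step (Q_sym Qj) (Q_sym Qi)); lia.
lia.
Qed.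
End Reflection.
End ColourRuns.

(** * The oriented plane *)

Section Plane.
Variable R : realType.
Implicit Types (x y z u v w : R[i]) (a b t k : R).

Definition cross x y : R :=
  complex.Re x * complex.Im y - complex.Im x * complex.Re y.

Definition cis a : R[i] := cos a +i* sin a.

Lemma ReD x y : complex.Re (x + y) = complex.Re x + complex.Re y.
Proof. by case: x; case: y. Qed.
Lemma ImD x y : complex.Im (x + y) = complex.Im x + complex.Im y.
Proof. by case: x; case: y. Qed.
Lemma ReN x : complex.Re (- x) = - complex.Re x.
Proof. by case: x. Qed.
Lemma ImN x : complex.Im (- x) = - complex.Im x.
Proof. by case: x. Qed.
Lemma ReM x y : complex.Re (x * y) =
  complex.Re x * complex.Re y - complex.Im x * complex.Im y.
Proof. by case: x; case: y. Qed.
Lemma ImM x y : complex.Im (x * y) =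
  complex.Re x * complex.Im y + complex.Im x * complex.Re y.
Proof. by case: x; case: y. Qed.
Lemma ReZ k y : complex.Re (k%:C * y) = k * complex.Re y.
Proof. by case: y => a b /=; rewrite mul0r subr0. Qed.
Lemma ImZ k y : complex.Im (k%:C * y) = k * complex.Im y.
Proof. by case: y => a b /=; rewrite mul0r addr0. Qed.
Definition complex_lin := (ReD, ImD, ReN, ImN, ReZ, ImZ).

Lemma complex_ext x y :
  complex.Re x = complex.Re y -> complex.Im x = complex.Im y -> x = y.
Proof. by case: x; case: y => a b a' b' /= -> ->. Qed.

Lemma complex_neq0 x :
  x != 0 -> (complex.Re x != 0) || (complex.Im x != 0).
Proof. by case: x => a b; rewrite eq_complex /= negb_and. Qed.

Lemma crossDr x y z : cross x (y + z) = cross x y + cross x z.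
Proof. by rewrite /cross !complex_lin; ring. Qed.
Lemma crossDl x y z : cross (y + z) x = cross y x + cross z x.
Proof. by rewrite /cross !complex_lin; ring. Qed.
Lemma crossNr x y : cross x (- y) = - cross x y.
Proof. by rewrite /cross !complex_lin; ring. Qed.
Lemma crossNl x y : cross (- x) y = - cross x y.
Proof. by rewrite /cross !complex_lin; ring. Qed.
Lemma crossZr k x y : cross x (k%:C * y) = k * cross x y.
Proof. by rewrite /cross !complex_lin; ring. Qed.
Lemma crossZl k x y : cross (k%:C * x) y = k * cross x y.
Proof. by rewrite /cross !complex_lin; ring. Qed.
Lemma cross0r x : cross x 0 = 0.
Proof. by rewrite /cross /= !mulr0 subrr. Qed.
Lemma cross0l x : cross 0 x = 0.
Proof. by rewrite /cross /= !mul0r subrr. Qed.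
Lemma crossxx x : cross x x = 0.
Proof. by rewrite /cross; ring. Qed.
Lemma crossC x y : cross x y = - cross y x.
Proof. by rewrite /cross; ring. Qed.
Definition crossE := (crossDr, crossDl, crossNr, crossNl, crossZr, crossZl).

Lemma cross_sum (I : Type) (r : seq I) (P : pred I) (F : I -> R[i]) x :
  cross x (\sum_(i <- r | P i) F i) = \sum_(i <- r | P i) cross x (F i).
Proof. by elim/big_rec2: _ => [|i u v _ <-]; rewrite ?cross0r ?crossDr. Qed.

(** Cramer's rule, in the form that treats the three vectors symmetrically. *)
Lemma cross_id x y z :
  (cross y z)%:C * x + (cross z x)%:C * y + (cross x y)%:C * z = 0.
Proof. by apply: complex_ext; rewrite !complex_lin /cross /=; ring. Qed.

Lemma cross_plucker x y z w :
  cross x z * cross y w = cross x y * cross z w + cross y z * cross x w.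
Proof. by rewrite /cross; ring. Qed.

Lemma cross_det u v k k' l l' :
  cross (k%:C * u + l%:C * v) (k'%:C * u + l'%:C * v) =
  (k * l' - l * k') * cross u v.
Proof. by rewrite /cross !complex_lin; ring. Qed.

Lemma cross_eq0 u x : u != 0 -> cross u x = 0 -> exists k, x = k%:C * u.
Proof.
move=> /complex_neq0 u0; rewrite /cross => ux; case/orP: u0 => u0.
  exists (complex.Re x / complex.Re u); apply: complex_ext; rewrite !complex_lin.
    by field.
  apply: (mulfI u0); rewrite mulrA [_ * (_ / _)]mulrC divfK //; lra.
exists (complex.Im x / complex.Im u); apply: complex_ext; rewrite !complex_lin.
  by apply: (mulfI u0); rewrite mulrA [_ * (_ / _)]mulrC divfK //; lra.
by field.
Qed.

Lemma cross2_eq0 u v x : cross u v != 0 -> cross u x = 0 -> cross v x = 0 -> x = 0.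
Proof.
move=> uv ux vx; have := cross_id u v x.
rewrite vx (crossC x u) ux oppr0 !mul0r !add0r => /eqP.
rewrite mulf_eq0 => /orP[|/eqP//].
by rewrite eq_complex /= eqxx andbT (negPf uv).
Qed.

Lemma parallelP u v : u != 0 -> v != 0 -> parallel u v <-> cross u v = 0.
Proof.
move=> u0 v0; split=> [[k k0 ->]|/(cross_eq0 u0)[k vk]].
  by rewrite crossZr crossxx mulr0.
by exists k => //; apply: contraNneq v0 => k0; rewrite vk k0 mul0r.
Qed.

Lemma cisD a b : cis (a + b) = cis a * cis b.
Proof. by apply: complex_ext; rewrite ?ReM ?ImM /= ?cosD ?sinD; ring. Qed.

Lemma cis0 : cis 0 = 1.
Proof. by rewrite /cis cos0 sin0. Qed.

Lemma cisN a : cis a * cis (- a) = 1.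
Proof. by rewrite -cisD subrr cis0. Qed.

Lemma cis_neq0 a : cis a != 0.
Proof.
apply: contra_neq (oner_neq0 R[i]) => h.
by rewrite -(cisN a) h mul0r.
Qed.

Lemma cross_cis a b : cross (cis a) (cis b) = sin (b - a).
Proof. by rewrite /cross /= sinB; ring. Qed.

Lemma cis_mulrn a (m : nat) : cis (a *+ m) = cis a ^+ m.
Proof. by elim: m => [|m IHm]; rewrite ?cis0 // mulrS cisD exprS IHm. Qed.

Lemma cis2pi : cis (2 * pi) = 1.
Proof. by rewrite /cis mulr_natl cos2pi sin2pi. Qed.

Lemma cisD2pi a (m : nat) : cis (a + 2 * pi * m%:R) = cis a.
Proof. by rewrite cisD mulr_natr cis_mulrn cis2pi expr1n mulr1. Qed.

Lemma cispi : cis pi = -1.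
Proof. by rewrite /cis cospi sinpi; apply: complex_ext => /=; rewrite ?oppr0. Qed.

Lemma cisDpi a : cis (a + pi) = - cis a.
Proof. by rewrite cisD cispi mulrN1. Qed.

Lemma polar_unit (p q : R) : p ^+ 2 + q ^+ 2 = 1 ->
  exists2 a, 0 <= a < 2 * pi & cis a = p +i* q.
Proof.
move=> pq; have p1 : -1 <= p <= 1 by nra.
have [h0 hp] : 0 <= acos p /\ acos p <= pi by rewrite acos_ge0 ?acos_lepi.
have cp : cos (acos p) = p by rewrite acosK // in_itv.
have sp : sin (acos p) = `|q|.
  by rewrite sin_acos // (_ : 1 - p ^+ 2 = q ^+ 2) ?sqrtr_sqr; lra.
have pi0 := pi_gt0 R.
have [q0|q0] := leP 0 q.
  exists (acos p); first by rewrite h0; lra.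
  by rewrite /cis cp sp ger0_norm.
have h1 : 0 < acos p.
  rewrite lt_neqAle h0 andbT; apply: contraTneq q0 => ap0.
  by move: sp; rewrite -ap0 sin0 => /esym/eqP; rewrite normr_eq0 => /eqP ->; rewrite ltxx.
exists (- acos p + 2 * pi * 1%:R); first by lra.
by rewrite cisD2pi /cis cosN sinN cp sp ltr0_norm // opprK.
Qed.

Lemma polar z : z != 0 ->
  exists r a, [/\ 0 < r, 0 <= a < 2 * pi & z = r%:C * cis a].
Proof.
move=> /complex_neq0 z0.
set n2 := complex.Re z ^+ 2 + complex.Im z ^+ 2.
have n20 : 0 < n2.
  by case/orP: z0 => z0; rewrite /n2; [rewrite ltr_wpDr ?sqr_ge0 ?exprn_even_gt0|
    rewrite ltr_wpDl ?sqr_ge0 ?exprn_even_gt0].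
set r := Num.sqrt n2.
have r0 : 0 < r by rewrite sqrtr_gt0.
have rr : r ^+ 2 = n2 by rewrite sqr_sqrtr ?ltW.
have [|a ha ca] := @polar_unit (complex.Re z / r) (complex.Im z / r).
  by rewrite !expr_div_n rr -mulrDl divff // gt_eqF.
exists r, a; split => //; rewrite ca.
by apply: complex_ext; rewrite !complex_lin /= mulrCA divff ?mulr1 ?gt_eqF.
Qed.

End Plane.

(** * Convexity and parallel lines *)

Section Convexity.
Variable R : realType.
Implicit Types (x y z p q v : R[i]) (K : R[i] -> Prop).

Definition convex_pred K := forall x y (t : R), 0 <= t <= 1 ->
  K x -> K y -> K (t%:C * x + (1 - t)%:C * y).

Lemma convex_ray K x (t : R) : convex_pred K -> K 0 -> 0 <= t <= 1 -> K x ->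
  K (t%:C * x).
Proof. by move=> cK K0 t01 Kx; have := cK x 0 t t01 Kx K0; rewrite mulr0 addr0. Qed.

(** A linear form [cross w] that is not constant along [v] orders the points of each
    parallel to [v]; betweenness stated in this way needs no parametrisation of the
    line. *)
Lemma convex_between K x y z v : convex_pred K -> v != 0 -> K x -> K z ->
  cross v x = cross v y -> cross v z = cross v y ->
  (exists2 w, 0 < cross v w & cross w x <= cross w y <= cross w z) -> K y.
Proof.
move=> cK v0 Kx Kz vx vz [w w0 /andP[xy yz]].
have vw : cross v w != 0 by rewrite gt_eqF.
have ext p q : cross v p = cross v q -> cross w p = cross w q -> p = q.
  move=> e1 e2; apply/eqP; rewrite -subr_eq0; apply/eqP.
  by apply: (cross2_eq0 vw); rewrite !crossE; lra.
have [xz|xz] := eqVneq (cross w x) (cross w z).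
  by rewrite (ext y x) //; lra.
have d0 : 0 < cross w z - cross w x.
  rewrite subr_gt0 lt_neqAle xz /=; lra.
pose t := (cross w z - cross w y) / (cross w z - cross w x).
have t01 : 0 <= t <= 1.
  rewrite /t divr_ge0 ?(ltW d0) ?subr_ge0 //= ler_pdivrMr // mul1r; lra.
have := cK x z t t01 Kx Kz; congr (K _); apply: ext; rewrite !crossE.
  by rewrite vx vz; ring.
rewrite /t; field; exact: lt0r_neq0.
Qed.

(** The reason why pairing points along parallels reverses their angular order.
    Move the pair farther from the origin onto the line of the nearer one, along
    rays towards the origin: both points stay in their convex sets, which contain
    the origin.  The four points are then on one line, and if [q] followed [p] and
    [q'] followed [p'] there, then whatever the order of [p] and [p'], a point of
    one set would lie between two points of the other set. *)
Lemma no_parallel_crossing K K' p p' q q' v :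
  convex_pred K -> convex_pred K' -> K 0 -> K' 0 ->
  K p -> K q' -> K' p' -> K' q -> ~ K' p -> ~ K' q' -> ~ K p' -> ~ K q ->
  0 < cross v p -> cross v p' = cross v p ->
  0 < cross v q -> cross v q' = cross v q ->
  0 < cross p q -> 0 < cross p' q' -> False.
Proof.
move=> cK cK' K0 K0' Kp Kq' Kp' Kq nKp nKq' nKp' nKq vp vp' vq vq' pq pq'.
have v0 : v != 0 by apply: contraTneq vp => ->; rewrite cross0l ltxx.
have H1 : 0 < cross v p' by rewrite vp'.
have H2 : 0 < cross v q' by rewrite vq'.
have proj a b : 0 < cross v a -> cross v a <= cross v b ->
  exists t : R, [/\ 0 < t, 0 <= t <= 1 & cross v (t%:C * b) = cross v a].
  move=> va vab; have vb := lt_le_trans va vab.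
  exists (cross v a / cross v b); split; first exact: divr_gt0.
    by rewrite divr_ge0 ?(ltW va) ?(ltW vb) //= ler_pdivrMr ?mul1r.
  by rewrite crossZr divfK ?gt_eqF.
(* on a parallel to [v], cross products with two of its points differ by a
   constant: both measure the height *)
have height a b z z' : 0 < cross v a -> cross v b = cross v a ->
    cross v z = cross v a -> cross v z' = cross v a ->
    cross b z' - cross b z = cross a z' - cross a z.
  move=> va vb vz vz'; apply: (mulfI (lt0r_neq0 va)).
  have := cross_plucker v a b z; have := cross_plucker v a b z'.
  rewrite vz vz' vb; nra.
have [le_pq|/ltW le_qp] := leP (cross v p) (cross v q).
- have le_pq' : cross v p <= cross v q' by rewrite vq'.
  have [t [t0 t01 vt]] := proj _ _ vp le_pq.
  have [t' [t0' t01' vt']] := proj _ _ vp le_pq'.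
  have Kt := convex_ray cK' K0' t01 Kq.
  have Kt' := convex_ray cK K0 t01' Kq'.
  have h1 : 0 < cross p (t%:C * q) by rewrite crossZr mulr_gt0.
  have h2 : 0 < cross p' (t'%:C * q') by rewrite crossZr mulr_gt0.
  have := height p p' p' (t'%:C * q') vp vp' vp' vt'; rewrite crossxx => e1.
  have pp' : cross p p' < 0.
    rewrite ltNge; apply/negP => pp'; apply: nKp'.
    apply: (@convex_between K p p' (t'%:C * q') v) => //; rewrite ?vp' ?vt' //.
    by exists p => //; rewrite crossxx pp' /=; lra.
  apply: nKp; apply: (@convex_between K' p' p (t%:C * q) v) => //; rewrite ?vp' ?vt //.
  by exists p => //; rewrite crossxx (ltW pp') ltW.
- have le_qp' : cross v q <= cross v p' by rewrite vp'.
  have [t [t0 t01 vt]] := proj _ _ vq le_qp.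
  have [t' [t0' t01' vt']] := proj _ _ vq le_qp'.
  have Kt := convex_ray cK K0 t01 Kp.
  have Kt' := convex_ray cK' K0' t01' Kp'.
  have h1 : cross q (t%:C * p) < 0.
    by rewrite crossZr (crossC q) mulrN oppr_lt0 mulr_gt0.
  have h2 : cross q' (t'%:C * p') < 0.
    by rewrite crossZr (crossC q') mulrN oppr_lt0 mulr_gt0.
  have := height q q' (t'%:C * p') q' vq vq' vt' vq'; rewrite crossxx => e1.
  have qq' : cross q q' < 0.
    rewrite ltNge; apply/negP => qq'; apply: nKq.
    apply: (@convex_between K (t%:C * p) q q' v) => //; rewrite ?vq' ?vt //.
    by exists q => //; rewrite crossxx (ltW h1) qq'.
  apply: nKq'; apply: (@convex_between K' (t'%:C * p') q' q v) => //; rewrite ?vq' ?vt' //.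
  by exists q => //; rewrite crossxx (ltW qq') andbT; lra.
Qed.
End Convexity.

(** * Points enumerated by angle *)

Section AngularEnumeration.
Variable R : realType.

(** The enumeration is continued periodically, the angles growing by a full turn in
    each period, so that arcs of any starting point are intervals of indices. *)
Lemma angular_enum (P : seq R[i]) : (forall z, z \in P -> z != 0) ->
  P <> [::] ->
  exists (x : nat -> R[i]) (r a : nat -> R),
  [/\ P =i [seq x i | i <- iota 0 (size P)],
      perm_eq P [seq x i | i <- iota 0 (size P)],
      forall i, 0 < r i /\ x i = (r i)%:C * cis (a i),
      forall i, a i <= a i.+1 &
      forall i, x (i + size P)%N = x i /\ a (i + size P)%N = a i + 2 * pi].
Proof.
move=> P0 Pne.
pose good (z : R[i]) (p : R * R) :=
  z = 0 \/ [/\ 0 < p.1, 0 <= p.2 < 2 * pi & z = p.1%:C * cis p.2].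
have /choice[pol polP] : forall z, exists p, good z p.
  move=> z; have [->|/polar[r [a ra]]] := eqVneq z 0; first by exists (0, 0); left.
  by exists (r, a); right.
pose le z w := (pol z).2 <= (pol w).2.
have le_total : total le by move=> z w; exact: le_total.
have le_trans : transitive le by move=> w z t; exact: le_trans.
pose s := sort le P; pose L := size P.
have L0 : (0 < L)%N by rewrite /L lt0n size_eq0; apply/eqP.
have sL : size s = L by rewrite size_sort.
pose x i := nth 0 s (i %% L).
pose a i : R := (pol (x i)).2 + 2 * pi * (i %/ L)%:R.
have xs i : x i \in s by rewrite mem_nth // sL ltn_mod.
have xP i : [/\ 0 < (pol (x i)).1, 0 <= (pol (x i)).2 < 2 * pi &
    x i = (pol (x i)).1%:C * cis (pol (x i)).2].
  have [x0|//] := polP (x i); have := xs i; rewrite mem_sort => /P0.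
  by rewrite x0 eqxx.
have s_eq : [seq x i | i <- iota 0 L] = s.
  apply: (@eq_from_nth _ 0) => [|i]; rewrite size_map size_iota ?sL // => iL.
  by rewrite (nth_map 0%N) ?size_iota // nth_iota // /x add0n modn_small.
exists x, (fun i => (pol (x i)).1), a; split.
- by move=> z; rewrite s_eq mem_sort.
- by rewrite s_eq perm_sym perm_sort.
- by move=> i; have [h1 _ h2] := xP i; rewrite /a cisD2pi; split.
- move=> i; rewrite /a /x.
  have [lt_iL|ge_iL] := ltnP (i %% L).+1 L.
    have e1 : (i.+1 %% L = (i %% L).+1)%N.
      by rewrite -addn1 -modnDml addn1 modn_small.
    have e2 : (i.+1 %/ L = i %/ L)%N.
      have -> : (i.+1 = i %/ L * L + (i %% L).+1)%N by rewrite addnS -divn_eq.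
      by rewrite divnMDl // [X in (_ + X)%N]divn_small // addn0.
    rewrite e1 e2 lerD2r.
    have le_refl : reflexive le by move=> z; exact: lexx.
    have := sorted_leq_nth le_trans le_refl 0 (sort_sorted le_total P).
    by move/(_ (i %% L)%N (i %% L).+1); apply; rewrite ?inE -/s ?sL ?ltn_mod.
  have e0 : ((i %% L).+1 = L)%N by apply/eqP; rewrite eqn_leq ge_iL ltn_mod L0.
  have e1 : (i.+1 = (i %/ L).+1 * L)%N by rewrite mulSn addnC -e0 addnS e0 -divn_eq.
  have -> : (i.+1 %/ L = (i %/ L).+1)%N by rewrite e1 mulnK.
  have [_ h1 _] := xP i; have [_ h2 _] := xP i.+1.
  have e2 : 2 * pi * (i %/ L).+1%:R = 2 * pi * (i %/ L)%:R + 2 * pi :> R.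
    by rewrite -[(i %/ L).+1%:R]natr1; ring.
  move: h1 h2; rewrite /x e2 => h1 h2; have := pi_gt0 R; lra.
- move=> i; have e : x (i + L) = x i by rewrite /x modnDr.
  split => //; rewrite /a e divnDr ?dvdnn // divnn L0 [(_ + _)%:R]natrD /= mulr1n; ring.
Qed.
End AngularEnumeration.

(** * The first harmonic of the runs *)

Section NatSums.
Variable R : realType.

Lemma sum_nat_eq0 (k m : nat) (P : pred nat) (F : nat -> R) :
  (forall i, (k <= i < m)%N -> P i -> 0 <= F i) ->
  \sum_(k <= i < m | P i) F i = 0 ->
  forall i, (k <= i < m)%N -> P i -> F i = 0.
Proof.
move=> F0 /eqP; rewrite big_seq_cond psumr_eq0 => [/allP h i ki Pi|i].
  by have := h i; rewrite mem_index_iota ki Pi /= => /(_ isT)/eqP.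
by rewrite mem_index_iota => /andP[]; exact: F0.
Qed.
End NatSums.

(** The points [x i] are those of the two differences of two convex sets of points,
    the colour [c i] telling which difference, seen from their common centroid, and
    [K true], [K false] are the hulls of the two sets. *)
Section Harmonic.
Variable R : realType.
Variables (L : nat) (x : nat -> R[i]) (r a : nat -> R) (c : nat -> bool).
Variable K : bool -> R[i] -> Prop.
Hypothesis L0 : (0 < L)%N.
Hypothesis xE : forall i, x i = (r i)%:C * cis (a i).
Hypothesis r_gt0 : forall i, 0 < r i.
Hypothesis a_le : forall i, a i <= a i.+1.
Hypothesis aL : forall i, a (i + L)%N = a i + 2 * pi.
Hypothesis xL : forall i, x (i + L)%N = x i.
Hypothesis cL : forall i, c (i + L)%N = c i.
Hypothesis K_convex : forall b, convex_pred (K b).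
Hypothesis K0 : forall b, K b 0.
Hypothesis Kx : forall i, K (c i) (x i).
Hypothesis nKx : forall i, ~ K (~~ c i) (x i).
Hypothesis sum_x : forall b, \sum_(0 <= i < L | c i == b) x i = 0.
Hypothesis c_ex : forall b, exists i, c i = b.

Let pi0 := pi_gt0 R.
Let N := runs c L.

Lemma ler_a i j : (i <= j)%N -> a i <= a j.
Proof.
move=> /subnK <-; elim: (j - i)%N => [|m IHm] //.
by rewrite addSn (le_trans IHm).
Qed.

(** Two points on a ray from the origin have the same colour: the nearer one
    lies on the segment from the origin to the farther one. *)
Lemma same_angle_colour i j : a i = a j -> c i = c j.
Proof.
wlog le_r : i j / r i <= r j => [hw|] aij.
  by have [/hw->|/ltW/hw h] := leP (r i) (r j); rewrite // h.
apply/eqP/contraT => cij; case: (@nKx i).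
have -> : ~~ c i = c j by move: cij; case: (c i); case: (c j).
have -> : x i = (r i / r j)%:C * x j.
  rewrite !xE aij mulrA; congr (_ * _); apply: complex_ext => /=.
    by rewrite mul0r subr0 divfK ?gt_eqF.
  by rewrite mulr0 mul0r addr0.
apply: convex_ray (Kx j) => //.
by rewrite divr_ge0 ?(ltW (r_gt0 _)) //= ler_pdivrMr ?mul1r.
Qed.

Lemma opp_colour_lt i j : c i != c j -> (i < j)%N -> a i < a j.
Proof.
move=> cij /ltnW/ler_a; rewrite le_eqVlt => /predU1P[/same_angle_colour|//].
by move=> cE; rewrite cE eqxx in cij.
Qed.

Lemma same_angle_runs i j : (i <= j)%N -> a i = a j -> runs c i = runs c j.
Proof.
move=> ij aij; apply/eqP; rewrite eqn_leq leq_runs //= leqNgt; apply/negP => rij.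
have [|k /andP[ik kj] rk] := @runs_ivt c i j (runs c i).+1 ij; first by lia.
have cik : c i != c k by rewrite runs_parity rk /=; case: (odd _).
have ltik : (i < k)%N by apply: runs_le_lt cik _; rewrite rk.
by have := opp_colour_lt cik ltik; have := ler_a kj; lra.
Qed.

Lemma a_mulL i m : a (i + m * L)%N = a i + 2 * pi * m%:R.
Proof.
elim: m => [|m IHm]; first by rewrite mul0n addn0 mulr0 addr0.
by rewrite mulSn addnCA addnC aL IHm -[m.+1%:R]natr1; ring.
Qed.

Lemma x_mulL i m : x (i + m * L)%N = x i.
Proof.
elim: m => [|m IHm]; first by rewrite mul0n addn0.
by rewrite mulSn addnCA addnC xL IHm.
Qed.

Lemma c_mulL i m : c (i + m * L)%N = c i.
Proof.
elim: m => [|m IHm]; first by rewrite mul0n addn0.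
by rewrite mulSn addnCA addnC cL IHm.
Qed.

(** A sum over a period may start anywhere. *)
Lemma sum_window (V : zmodType) (F : nat -> V) k :
  (forall i, F (i + L)%N = F i) ->
  \sum_(k <= i < k + L) F i = \sum_(0 <= i < L) F i.
Proof.
move=> FL; elim: k => [|k IHk]; first by rewrite add0n.
rewrite -IHk addSn big_nat_recr ?leq_addl /=; last by lia.
by rewrite [RHS]big_ltn ?FL 1?addrC //; lia.
Qed.

Lemma sum_window_colour k b : \sum_(k <= i < k + L | c i == b) x i = 0.
Proof.
rewrite big_mkcond /= sum_window => [|i]; last by rewrite cL xL.
by rewrite -big_mkcond sum_x.
Qed.

Lemma sum_window_all k : \sum_(k <= i < k + L) x i = 0.
Proof.
rewrite (bigID (fun i => c i == true)) /= sum_window_colour add0r.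
rewrite (eq_bigl (fun i => c i == false)) ?sum_window_colour // => i.
by case: (c i).
Qed.

Lemma cross_window theta i : cross (cis theta) (x i) = r i * sin (a i - theta).
Proof. by rewrite xE crossZr cross_cis. Qed.

Lemma window_repr k i : exists m j, [/\ (k <= j < k + L)%N,
  x j = x i, c j = c i & (i + m * L = j \/ j + m * L = i)%N].
Proof.
have [ki|ik] := leqP k i.
  exists ((i - k) %/ L)%N, (k + (i - k) %% L)%N.
  have e : (k + (i - k) %% L + (i - k) %/ L * L = i)%N.
    by rewrite -addnA (addnC (_ %% _)%N) -divn_eq subnKC.
  split; [by rewrite leq_addr ltn_add2l ltn_mod| | |by right].
    by rewrite -{2}e x_mulL.
  by rewrite -{2}e c_mulL.
have [m hm] : exists m, (k <= i + m * L < k + L)%N.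
  exists ((k - i + L.-1) %/ L)%N.
  have := leq_trunc_div (k - i + L.-1) L; have := ltn_ceil (k - i + L.-1) L0; lia.
by exists m, (i + m * L)%N; split; rewrite ?x_mulL ?c_mulL //; left.
Qed.

(** The points of one colour have centroid zero, so they lie in no half-open
    half-plane. *)
Lemma colour_not_pointed k b phi :
  (forall i, (k <= i < k + L)%N -> c i = b -> phi <= a i < phi + pi) -> False.
Proof.
move=> H; have [i0 ci0] := c_ex b.
have [m [j [kj _ cj _]]] := window_repr k i0; rewrite ci0 in cj.
have s0 : \sum_(k <= i < k + L | c i == b) cross (cis phi) (x i) = 0.
  by rewrite -cross_sum sum_window_colour cross0r.
have s_ge0 i : (k <= i < k + L)%N -> c i == b -> 0 <= cross (cis phi) (x i).
  move=> ki /eqP/(H i ki) ai; rewrite cross_window mulr_ge0 ?(ltW (r_gt0 _)) //.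
  by apply: sin_ge0_pi; lra.
have aE i : (k <= i < k + L)%N -> c i == b -> a i = phi.
  move=> ki ci; have := sum_nat_eq0 s_ge0 s0 ki ci.
  rewrite cross_window => /eqP; rewrite mulf_eq0 gt_eqF //= => /eqP si.
  have /andP[h1 h2] := H i ki (eqP ci); apply/eqP; rewrite eq_le h1 andbT leNgt.
  by apply/negP => lt_phi; have := @sin_gt0_pi R (a i - phi); rewrite si ltxx => f; suff: false by []; apply: f; lra.
have sum_r : (\sum_(k <= i < k + L | c i == b) r i)%:C * cis phi = 0.
  rewrite -(sum_window_colour k b) rmorph_sum mulr_suml big_nat_cond.
  rewrite [RHS]big_nat_cond; apply: eq_bigr => i /andP[ki ci].
  by rewrite xE (aE i).
have {}sum_r : \sum_(k <= i < k + L | c i == b) r i = 0.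
  move/eqP: sum_r; rewrite mulf_eq0 (negPf (cis_neq0 _)) orbF.
  by rewrite eq_complex /= eqxx andbT => /eqP.
have := sum_nat_eq0 (fun i _ _ => ltW (r_gt0 i)) sum_r kj.
by rewrite cj eqxx => /(_ isT)/eqP; rewrite gt_eqF.
Qed.

Lemma a_unbounded t : exists m, t < a (m * L)%N.
Proof.
pose y := (t - a 0%N) / (2 * pi); exists (Num.bound `|y|).
have := archi_boundP (normr_ge0 y); move: (Num.bound _) => m ym.
have {}ym : y < m%:R by apply: le_lt_trans ym; exact: ler_norm.
rewrite -[(m * L)%N]add0n a_mulL.
by move: ym; rewrite /y ltr_pdivrMr ?mulr_gt0 //; lra.
Qed.

Lemma cut_exists t : exists k, forall i, (i < k)%N = (a i < t).
Proof.
have ex : exists i, t <= a i.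
  by have [m hm] := a_unbounded t; exists (m * L)%N; exact: ltW.
have [k tk kmin] := ex_minnP ex; exists k => i; apply/idP/idP => [ik|ai].
  by rewrite ltNge; apply: contraTN ik => /kmin; rewrite -leqNgt.
by rewrite ltnNge; apply: contraTN ai => /ler_a ka; rewrite -leNgt (le_trans tk).
Qed.

(** Starting after the first period keeps the end of the previous turn at a
    non-negative index. *)
Lemma cut_window t k : a L < t -> (forall i, (i < k)%N = (a i < t)) ->
  forall i, (i < k + L)%N = (a i < t + 2 * pi).
Proof.
move=> Lt kP i; have [Li|iL] := leqP L i.
  by rewrite -{2}(subnK Li) aL ltrD2r -kP ltn_subLR // addnC.
rewrite (ltn_addl _ iL); apply/esym/idP.
have aiL := ler_a (ltnW iL); have := pi0; lra.
Qed.

(** The components of the first Fourier coefficient of the points, each point being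
    placed at the vertex of a regular [N]-gon numbered by its run. *)
Definition harm_sin : R[i] :=
  \sum_(0 <= i < L) (sin (2 * pi * (runs c i)%:R / N%:R))%:C * x i.
Definition harm_cos : R[i] :=
  \sum_(0 <= i < L) (cos (2 * pi * (runs c i)%:R / N%:R))%:C * x i.

(** With only two runs, each colour fills one arc, and one of the two arcs is
    contained in a half-turn; this contradicts [colour_not_pointed]. *)
Lemma runs_gt2 : (2 < N)%N.
Proof.
have evN : ~~ odd N by exact: odd_runsL.
have [i ci] := c_ex true; have [j0 cj0] := c_ex false.
have [j [ij cj]] : exists j, (i <= j)%N /\ c j = false.
  by exists (j0 + i * L)%N; rewrite c_mulL; split => //; nia.
have [k ck] : exists k, c k != c k.+1.
  have := @ltn_runs c i j; rewrite ci cj => /(_ isT).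
  have ij' : (i < j)%N by rewrite ltn_neqAle ij andbT; apply/eqP => e; rewrite -e ci in cj.
  move=> /(_ ij') rij; have [||k' hk rk] := @runs_ivt c i j (runs c i).+1; [exact: ltnW|lia|].
  have ki : (i < k')%N by rewrite ltnNge; apply/negP => /(leq_runs c); lia.
  apply: contrapT => nk; have : runs c k' = runs c i; last lia.
  have -> : k' = (i + (k' - i))%N by lia.
  elim: (k' - i)%N => [|d IHd]; first by rewrite addn0.
  rewrite addnS runsS IHd; case: eqP => [|/eqP h]; rewrite ?addn0 //.
  by case: nk; exists (i + d)%N.
rewrite ltnNge; apply/negP => N2.
have N_gt0 : (0 < N)%N.
  rewrite lt0n; apply/negP => /eqP N0.
  have := runsDL cL k; have := runsDL cL k.+1; rewrite -/N N0.
  have : (k.+1 <= k + L)%N by lia.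
  by move=> /(leq_runs c); have := runsS c k; rewrite ck; lia.
have {evN N_gt0 N2} N2 : N = 2%N by move: N2 N_gt0 evN; rewrite /N; case: (runs c L) => [|[|[]]].
have rk : runs c k.+1 = (runs c k).+1 by rewrite runsS ck addn1.
have rend : runs c (k + L) = (runs c k.+1).+1 by rewrite runsDL // -/N N2 rk addn2.
have win i' : (k.+1 <= i' < k.+1 + L)%N -> runs c i' = (runs c k.+1 + (c i' != c k.+1))%N.
  move=> /andP[h1 h2]; have := leq_runs c h1; have : (i' <= k + L)%N by lia.
  move=> /(leq_runs c); rewrite rend runs_parity => h3 h4.
  have [->|->] : runs c i' = runs c k.+1 \/ runs c i' = (runs c k.+1).+1 by lia.
    by rewrite eqxx addn0.
  by rewrite /=; case: (odd _); rewrite /= addn1.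
have aend : a (k.+1 + L)%N = a k.+1 + 2 * pi by rewrite aL.
have [[j' [hj cj' aj']]|noj] := pselect (exists j', [/\ (k.+1 <= j' < k.+1 + L)%N, c j' != c k.+1 & a j' < a k.+1 + pi]).
  apply: (@colour_not_pointed k.+1 (c k.+1) (a k.+1)) => i' hi ci'.
  rewrite ler_a; last by case/andP: hi.
  apply: le_lt_trans aj'; apply: ler_a; apply: ltnW.
  rewrite ltnNge; apply/negP => /(leq_runs c).
  by rewrite (win j' hj) (win i' hi) ci' eqxx cj' addn1 addn0 ltnn.
apply: (@colour_not_pointed k.+1 (~~ c k.+1) (a k.+1 + pi)) => i' hi ci'.
have ci2 : c i' != c k.+1 by rewrite ci'; case: (c k.+1).
apply/andP; split.
  by rewrite leNgt; apply/negP => ai; apply: noj; exists i'.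
have : c i' != c (k.+1 + L)%N by rewrite cL.
by move=> /opp_colour_lt; rewrite aend => /(_ _); case/andP: hi => _ hi /(_ hi); lra.
Qed.

Lemma harm_combination theta (al be : R) :
  \sum_(0 <= i < L) (sin (2 * pi * (runs c i)%:R / N%:R) * al +
     cos (2 * pi * (runs c i)%:R / N%:R) * be) * cross (cis theta) (x i) =
  al * cross (cis theta) harm_sin + be * cross (cis theta) harm_cos.
Proof.
rewrite /harm_sin /harm_cos !cross_sum !mulr_sumr -big_split /=.
by apply: eq_bigr => i _; rewrite !crossZr; ring.
Qed.

Let NR_gt0 : 0 < N%:R :> R.
Proof. by rewrite ltr0n; have := runs_gt2; lia. Qed.

Lemma sin_runs_ge0 (d : R) : 0 <= d <= N%:R -> 0 <= sin (pi * d / N%:R).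
Proof.
move=> /andP[d0 dN]; apply: sin_ge0_pi.
by rewrite divr_ge0 ?mulr_ge0 ?(ltW pi0) ?ler_pdivrMr ?ler_pM2l // ltW.
Qed.

Lemma sin_runs_gt0 (d : R) : 0 < d < N%:R -> 0 < sin (pi * d / N%:R).
Proof.
move=> /andP[d0 dN]; apply: sin_gt0_pi.
by rewrite divr_gt0 ?mulr_gt0 ?pi0 //= ltr_pdivrMr ?ltr_pM2l.
Qed.

(** During a turn starting at the angle [theta], the height over the line of that
    angle is first positive and then negative.  So is the weight
    [sin (pi d / N) * sin (pi (b - d) / N)], where [d] counts the runs met and [b]
    is its value at the half-turn.  The product of sines is a constant plus a
    combination of the first harmonics, and the points have sum zero: the weighted
    sum of the heights is a combination of the heights of [harm_sin] and
    [harm_cos].  If these vanished, so would all its terms, which are non-negative;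
    but as there are more than two runs, one of them is positive. *)
Lemma harm_nondegenerate theta : a L < theta ->
  cross (cis theta) harm_sin = 0 -> cross (cis theta) harm_cos = 0 -> False.
Proof.
move=> Lt hs hc.
have [k kP] := cut_exists theta.
have kLP := cut_window Lt kP.
have [m mP] := cut_exists (theta + pi).
have km : (k <= m)%N.
  by rewrite leqNgt kP; apply/negP => am; have := mP m; rewrite ltnn; case: ltP => //; have := pi0; lra.
have mk : (m <= k + L)%N.
  rewrite leqNgt mP; apply/negP => am; have := kLP (k + L)%N; rewrite ltnn.
  by case: ltP => //; have := pi0; lra.
pose rr i : R := (runs c i)%:R.
pose F i := 2 * (sin (pi * (rr i - rr k) / N%:R) * sin (pi * (rr m - rr i) / N%:R)).
pose G i := F i * cross (cis theta) (x i).
have FE i : F i =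
   (sin (2 * pi * rr i / N%:R) * sin (pi * (rr k + rr m) / N%:R) +
    cos (2 * pi * rr i / N%:R) * cos (pi * (rr k + rr m) / N%:R))
    - cos (pi * (rr m - rr k) / N%:R).
  have -> : cos (pi * (rr m - rr k) / N%:R) =
    cos (pi * (rr i - rr k) / N%:R + pi * (rr m - rr i) / N%:R).
    by congr (cos _); field; rewrite gt_eqF.
  rewrite [X in X - _]addrC [X in _ + X - _]mulrC [X in X + _ - _]mulrC (mulrC (cos _)) (mulrC (sin (pi * (rr k + rr m) / N%:R))).
  rewrite -cosB (_ : 2 * pi * rr i / N%:R - _ = pi * (rr i - rr k) / N%:R - pi * (rr m - rr i) / N%:R).
    by rewrite cosB cosD /F; ring.
  by field; rewrite gt_eqF.
have Grun i : rr (i + L)%N = rr i + N%:R by rewrite /rr runsDL // natrD.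
have FL i : F (i + L)%N = F i.
  rewrite !FE Grun; have -> : 2 * pi * (rr i + N%:R) / N%:R = 2 * pi * rr i / N%:R + pi *+ 2.
    by field; rewrite gt_eqF.
  by rewrite cosD2pi sinD2pi.
have G0 : \sum_(k <= i < k + L) G i = 0.
  rewrite sum_window => [|i]; last by rewrite /G FL xL.
  transitivity (\sum_(0 <= i < L) ((sin (2 * pi * rr i / N%:R) * sin (pi * (rr k + rr m) / N%:R) +
    cos (2 * pi * rr i / N%:R) * cos (pi * (rr k + rr m) / N%:R))* cross (cis theta) (x i))
     - cos (pi * (rr m - rr k) / N%:R) * cross (cis theta) (\sum_(0 <= i < L) x i)).
    rewrite cross_sum mulr_sumr -sumrB; apply: eq_bigr => i _.
    by rewrite /G FE mulrBl.
  rewrite harm_combination hs hc -[L in X in _ - _ * cross _ X]add0n sum_window_all cross0r; ring.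
have win i : (k <= i < k + L)%N -> [/\ theta <= a i, a i < theta + 2 * pi,
    rr k <= rr i, rr i <= rr k + N%:R &
    if (i < m)%N then (a i < theta + pi) && (rr i <= rr m)
    else (theta + pi <= a i) && (rr m <= rr i)].
  move=> /andP[ki ikL]; split.
  - by rewrite leNgt -kP -leqNgt.
  - by rewrite -kLP.
  - by rewrite ler_nat leq_runs.
  - by rewrite -Grun ler_nat leq_runs // ltnW.
  - have [im|mi] := ltnP i m; first by rewrite -mP im ler_nat leq_runs // ltnW.
    by rewrite leNgt -mP -leqNgt mi ler_nat leq_runs.
have rmN : rr k <= rr m <= rr k + N%:R by rewrite -Grun !ler_nat !leq_runs.
have G_ge0 i : (k <= i < k + L)%N -> true -> 0 <= G i.
  move=> ki _; have [h1 h2 h3 h4] := win i ki; rewrite /G /F cross_window.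
  have s1 : 0 <= sin (pi * (rr i - rr k) / N%:R) by apply: sin_runs_ge0; lra.
  case: ifP => _ /andP[h5 h6].
    apply: mulr_ge0; first by rewrite !mulr_ge0 //; apply: sin_runs_ge0; lra.
    by rewrite mulr_ge0 ?(ltW (r_gt0 _)) //; apply: sin_ge0_pi; lra.
  have s2 : 0 <= sin (pi * (rr i - rr m) / N%:R) by apply: sin_runs_ge0; lra.
  have s3 : 0 <= sin (a i - (theta + pi)) by apply: sin_ge0_pi; lra.
  have -> : sin (pi * (rr m - rr i) / N%:R) = - sin (pi * (rr i - rr m) / N%:R).
    by rewrite -sinN; congr (sin _); ring.
  have -> : sin (a i - theta) = - sin (a i - (theta + pi)).
    by rewrite -[a i - theta](subrK pi) sinDpi; congr (- sin _); ring.
  by rewrite !mulrN mulNr opprK !mulr_ge0 // ltW.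
have Gz := sum_nat_eq0 G_ge0 G0.
(* a run met strictly inside the turn, away from the change of sign *)
have [v [vk vm vN]] : exists v, [/\ (runs c k < v)%N, v != runs c m & (v < runs c k + N)%N].
  have := runs_gt2; have [e|ne] := eqVneq (runs c k).+1 (runs c m) => N3.
    by exists (runs c k).+2; split; lia.
  by exists (runs c k).+1; split => //; lia.
have [||i /andP[ki ikL] ri] := @runs_ivt c k (k + L) v; first exact: leq_addr.
  by rewrite runsDL // -/N; lia.
have {}ikL : (i < k + L)%N.
  rewrite ltn_neqAle ikL andbT; apply/eqP => e; move: ri; rewrite e runsDL // -/N; lia.
have kiL : (k <= i < k + L)%N by rewrite ki.
have := Gz i kiL isT; have [h1 h2 h3 h4] := win i kiL.
have rik : rr k < rr i by rewrite /rr ri ltr_nat.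
have riN : rr i < rr k + N%:R by rewrite /rr ri -natrD ltr_nat.
have s1 : 0 < sin (pi * (rr i - rr k) / N%:R) by apply: sin_runs_gt0; lra.
have aik : a i != theta.
  apply/eqP => ai; have := @same_angle_runs k i ki.
  have : a i <= a k by rewrite ai leNgt -kP ltnn.
  have := ler_a ki => e1 e2 /(_ _) e; have {}e : runs c k = runs c i by apply: e; lra.
  by move: vk; rewrite -ri e ltnn.
rewrite /G /F cross_window; case: ltnP => im /andP[h5 h6] /eqP.
  rewrite !mulf_eq0 pnatr_eq0 /= (gt_eqF s1) (gt_eqF (r_gt0 i)) /= => /orP[|].
    have rim : rr i < rr m by rewrite lt_neqAle h6 andbT /rr eqr_nat ri.
    by rewrite gt_eqF //; apply: sin_runs_gt0; lra.
  by rewrite gt_eqF //; apply: sin_gt0_pi; rewrite subr_gt0 lt_neqAle eq_sym aik h1 /=; lra.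
have aim : theta + pi < a i.
  rewrite lt_neqAle h5 andbT; apply/eqP => ai; have := @same_angle_runs m i im.
  have : theta + pi <= a m by rewrite leNgt -mP ltnn.
  have := ler_a im => e1 e2 /(_ _) e; have {}e : runs c m = runs c i by apply: e; lra.
  by move: vm; rewrite -ri e eqxx.
rewrite !mulf_eq0 pnatr_eq0 /= (gt_eqF s1) (gt_eqF (r_gt0 i)) /=.
have -> : sin (pi * (rr m - rr i) / N%:R) = - sin (pi * (rr i - rr m) / N%:R).
  by rewrite -sinN; congr (sin _); ring.
have -> : sin (a i - theta) = - sin (a i - (theta + pi)).
  by rewrite -[a i - theta](subrK pi) sinDpi; congr (- sin _); ring.
rewrite !oppr_eq0 => /orP[|]; rewrite gt_eqF //; last by apply: sin_gt0_pi; lra.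
have rim : rr m < rr i by rewrite lt_neqAle h6 andbT /rr eqr_nat ri eq_sym.
by apply: sin_runs_gt0; lra.
Qed.

Section HalfTurn.
Variable theta : R.
Hypothesis Ltheta : a L < theta.
Let h i := cross (cis theta) (x i).
Hypothesis partner : forall i, exists j, c i != c j /\ h i = h j.

Definition half_turn i := (theta <= a i) && (a i <= theta + pi).
Definition mirror i j := [/\ half_turn i, half_turn j, c i != c j & h i = h j].

Lemma half_turn_ge0 i : half_turn i -> 0 <= h i.
Proof.
by case/andP=> h1 h2; rewrite /h cross_window mulr_ge0 ?(ltW (r_gt0 _)) // sin_ge0_pi; lra.
Qed.

Lemma half_turn_gt0 i : half_turn i -> 0 < h i -> theta < a i < theta + pi.
Proof.
case/andP=> h1 h2; rewrite /h cross_window pmulr_rgt0 // => s.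
rewrite !lt_neqAle h1 h2 !andbT; apply/andP; split; apply: contraTneq s.
  by move=> ->; rewrite subrr sin0 ltxx.
by move=> ->; rewrite addrC addKr sinpi ltxx.
Qed.

Lemma half_turn_eq0 i : half_turn i -> h i = 0 -> a i = theta \/ a i = theta + pi.
Proof.
case/andP=> h1 h2 /eqP; rewrite /h cross_window mulf_eq0 gt_eqF //= => /eqP s.
have [->|n1] := eqVneq (a i) theta; first by left.
have [->|n2] := eqVneq (a i) (theta + pi); first by right.
have : 0 < sin (a i - theta); last by rewrite s ltxx.
by apply: sin_gt0_pi; rewrite subr_gt0 ltrBlDl !lt_neqAle h1 h2 eq_sym n1 n2.
Qed.

Lemma half_turn_repr i : 0 <= h i -> exists m j,
  [/\ half_turn j, x j = x i, c j = c i & (i + m * L = j \/ j + m * L = i)%N].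
Proof.
move=> hi; have [k kP] := cut_exists theta.
have [m [j [/andP[kj jk] xj cj mj]]] := window_repr k i.
exists m, j; split => //; apply/andP; split; first by rewrite leNgt -kP -leqNgt.
rewrite (cut_window Ltheta kP) in jk.
rewrite leNgt; apply/negP => aj; move: hi.
rewrite /h -xj cross_window pmulr_rge0 // -[a j - theta](subrK pi) sinDpi.
have : 0 < sin (a j - theta - pi) by apply: sin_gt0_pi; lra.
lra.
Qed.

Lemma mirror_exists i : half_turn i -> exists j, mirror i j.
Proof.
move=> Wi; have hi := half_turn_ge0 Wi; have [j [cij hij]] := partner i.
have [|_ [j' [Wj' xj' cj' _]]] := @half_turn_repr j; first by rewrite -hij.
by exists j'; split => //; rewrite ?cj' // hij /h xj'.
Qed.

Lemma mirror_sym i j : mirror i j -> mirror j i.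
Proof. by case=> *; split => //; rewrite eq_sym. Qed.

(** This is [no_parallel_crossing], which speaks of points off the axis: the points
    on the axis are at both ends of the half-turn, where two pairs of partners
    cannot be in the same order. *)
Lemma mirror_rev i i' j j' : mirror i i' -> mirror j j' -> c i != c j ->
  (i < j)%N -> (j' < i')%N.
Proof.
move=> [Wi Wi' cii' hii'] [Wj Wj' cjj' hjj'] cij ij.
have aij := opp_colour_lt cij ij.
have cij' : c i' != c j' by move: cij cii' cjj'; do 4!case: (c _).
rewrite ltnNge leq_eqVlt; apply/negP => /predU1P[e|ij']; first by rewrite e eqxx in cij'.
have aij' := opp_colour_lt cij' ij'.
have angle_neq p q : c p != c q -> a p != a q.
  by apply: contra => /eqP/same_angle_colour ->.
have /andP[i1 i2] := Wi; have /andP[i3 i4] := Wi'.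
have /andP[j1 j2] := Wj; have /andP[j3 j4] := Wj'.
have hi : 0 < h i.
  rewrite lt_neqAle half_turn_ge0 // andbT; apply/eqP => h0.
  have := angle_neq _ _ cii'; have := half_turn_eq0 Wi (esym h0).
  have := half_turn_eq0 Wi'; rewrite -hii' -h0 => /(_ erefl).
  by move=> [e|e] [e'|e']; rewrite e e' ?eqxx // => _; lra.
have hj : 0 < h j.
  rewrite lt_neqAle half_turn_ge0 // andbT; apply/eqP => h0.
  have := angle_neq _ _ cjj'; have := half_turn_eq0 Wj (esym h0).
  have := half_turn_eq0 Wj'; rewrite -hjj' -h0 => /(_ erefl).
  by move=> [e|e] [e'|e']; rewrite e e' ?eqxx // => _; lra.
have /andP[i5 i6] := half_turn_gt0 Wi hi; have /andP[j5 j6] := half_turn_gt0 Wj hj.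
have /andP[i7 i8] : theta < a i' < theta + pi by apply: half_turn_gt0; rewrite -?hii'.
have /andP[j7 j8] : theta < a j' < theta + pi by apply: half_turn_gt0; rewrite -?hjj'.
have cross_pos p q : 0 < a q - a p < pi -> 0 < cross (x p) (x q).
  by move=> ?; rewrite !xE crossZl crossZr cross_cis !mulr_gt0 // sin_gt0_pi.
have [e1 [e2 e3]] : c j' = c i /\ c i' = ~~ c i /\ c j = ~~ c i.
  by move: cij cii' cjj'; case: (c i); case: (c i'); case: (c j); case: (c j').
apply: (@no_parallel_crossing R (K (c i)) (K (~~ c i)) (x i) (x i') (x j) (x j') (cis theta)) => //.
- by rewrite -e1; exact: Kx.
- by rewrite -e2; exact: Kx.
- by rewrite -e3; exact: Kx.
- by rewrite -e1; exact: nKx.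
- by rewrite -[c i]negbK -e2; exact: nKx.
- by rewrite -[c i]negbK -e3; exact: nKx.
- by apply: cross_pos; lra.
- by apply: cross_pos; lra.
Qed.

Lemma mirror_runs i i' j j' : mirror i i' -> mirror j j' ->
  (runs c i + runs c i' = runs c j + runs c j')%N.
Proof.
apply: (@reflection_runs c half_turn mirror).
- move=> p q z /andP[p1 _] /andP[_ q2] /andP[pz zq].
  by rewrite /half_turn (le_trans p1) ?ler_a //= (le_trans _ q2) ?ler_a.
- exact: mirror_sym.
- by move=> p q [].
- exact: mirror_exists.
- by move=> p q [].
- exact: mirror_rev.
Qed.

(** A reflection of an interval exchanges its ends. *)
Lemma mirror_extreme k m i i' : (forall j, half_turn j = (k <= j < m)%N) ->
  mirror i i' -> (k < m)%N /\ (runs c i + runs c i' = runs c k + runs c m.-1)%N.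
Proof.
move=> WE Qi; have /andP[ki im] : (k <= i < m)%N by rewrite -WE; case: Qi.
have km : (k < m)%N by lia.
split => //; apply/eqP; rewrite eqn_leq.
have [|k' Qk] := @mirror_exists k; first by rewrite WE leqnn.
have [|l Ql] := @mirror_exists m.-1; first by rewrite WE; lia.
have : (k <= k' < m)%N by rewrite -WE; case: Qk.
have : (k <= l < m)%N by rewrite -WE; case: Ql.
move=> /andP[kl _] /andP[_ k'm]; apply/andP; split.
  by rewrite (mirror_runs Qi Qk) leq_add2l leq_runs; lia.
by rewrite (mirror_runs Qi Ql) addnC leq_add2l leq_runs.
Qed.

(** Otherwise all the points would be in an open half-plane. *)
Lemma half_turn_nonempty : exists i, half_turn i.
Proof.
have [k kP] := cut_exists theta; have kLP := cut_window Ltheta kP.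
apply: contrapT => no.
apply: (@colour_not_pointed k true (theta + pi)) => i /andP[ki ikL] _.
have ak : theta <= a i by rewrite leNgt -kP -leqNgt.
rewrite kLP in ikL; rewrite leNgt; apply/andP; split; last by lra.
by apply/negP => ai; apply: no; exists i; rewrite /half_turn ak ltW.
Qed.

End HalfTurn.

Lemma cross_cisDpi (theta : R) (z : R[i]) : cross (cis (theta + pi)) z = - cross (cis theta) z.
Proof. by rewrite cisDpi crossNl. Qed.

(** Crossing from one half-turn to the next one, the constant of the reflection
    grows by the total number of runs: it is the sum of the extreme runs of the
    half-turn, by [mirror_extreme], and the second half-turn starts at the end of
    the first one.  The points on the axis, if any, need a separate argument. *)
Lemma mirror_runs_opposite theta i i' j j' : a L < theta ->
  (forall i, exists j, c i != c j /\ cross (cis theta) (x i) = cross (cis theta) (x j)) ->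
  mirror theta i i' -> mirror (theta + pi) j j' ->
  (runs c j + runs c j' = runs c i + runs c i' + N)%N.
Proof.
move=> Lt par Qi Qj.
have Lt' : a L < theta + pi by have := pi0; lra.
have par' p : exists q, c p != c q /\
    cross (cis (theta + pi)) (x p) = cross (cis (theta + pi)) (x q).
  by have [q [cpq hpq]] := par p; exists q; rewrite !cross_cisDpi hpq.
have [[p [q [ap aq Qpq]]]|noaxis] :=
    pselect (exists p q, [/\ a p = theta, a q = theta + pi & mirror theta p q]).
  have [_ _ cpq hpq] := Qpq.
  have Q' : mirror (theta + pi) q (p + L).
    split; rewrite ?cL ?xL; [| |by rewrite eq_sym|by rewrite !cross_cisDpi hpq].
      by rewrite /half_turn aq lexx lerDl ltW.
    by rewrite /half_turn aL ap; have := pi0; lra.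
  rewrite (mirror_runs Lt par Qi Qpq) (mirror_runs Lt' par' Qj Q') runsDL // -/N; lia.
have [k kP] := cut_exists theta; have kLP := cut_window Lt kP.
have [m mP] := cut_exists (theta + pi).
have nax p : half_turn theta p -> a p != theta /\ a p != theta + pi.
  move=> Wp; have [q Qpq] := mirror_exists Lt par Wp.
  have [_ Wq cpq hpq] := Qpq.
  have npq : a p != a q by apply: contra cpq => /eqP/same_angle_colour ->.
  have zero : cross (cis theta) (x p) = 0 -> False.
    move=> h0; case: noaxis.
    have [ep|ep] := half_turn_eq0 Wp h0; have [eq|eq] := half_turn_eq0 Wq (etrans (esym hpq) h0).
    - by rewrite ep eq eqxx in npq.
    - by exists p, q.
    - by exists q, p; split => //; apply: mirror_sym.
    - by rewrite ep eq eqxx in npq.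
  split; apply/eqP => e; apply: zero; rewrite cross_window e ?subrr ?sin0 ?mulr0 //.
  by rewrite addrC addKr sinpi mulr0.
have WE p : half_turn theta p = (k <= p < m)%N.
  rewrite leqNgt kP mP -leNgt; apply/idP/idP => [Wp|/andP[h1 h2]].
    have [n1 n2] := nax _ Wp; have /andP[h1 h2] := Wp.
    by rewrite h1 lt_neqAle n2.
  by rewrite /half_turn h1 ltW.
have WE' p : half_turn (theta + pi) p = (m <= p < k + L)%N.
  rewrite leqNgt mP kLP -leNgt; apply/idP/idP => [Wp|/andP[h1 h2]].
    have /andP[h1 h2] := Wp; rewrite h1 lt_neqAle /=; apply/andP; split; last lra.
    apply/eqP => e; have Lp : (L <= p)%N.
      by rewrite leqNgt; apply/negP => /ltnW/ler_a; rewrite e; have := pi0; lra.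
    have : half_turn theta (p - L).
      have := aL (p - L); rewrite subnK // e => e'.
      by rewrite /half_turn; have := pi0; lra.
    by move=> /nax[/eqP + _]; apply; have := aL (p - L); rewrite subnK // e; lra.
  by rewrite /half_turn h1 /=; lra.
have [km ->] := mirror_extreme Lt par WE Qi.
have [mkL ->] := mirror_extreme Lt' par' WE' Qj.
have odd1 : odd (runs c k + runs c m.-1).
  rewrite -(mirror_extreme Lt par WE Qi).2 oddD !odd_runs.
  by case: Qi => _ _ + _; do 3!case: (c _).
have odd2 : odd (runs c m + runs c (k + L).-1).
  rewrite -(mirror_extreme Lt' par' WE' Qj).2 oddD !odd_runs.
  by case: Qj => _ _ + _; do 3!case: (c _).
have := runsS c m.-1; rewrite prednK; last by lia.
have := runsS c (k + L).-1; rewrite prednK; last by lia.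
rewrite runsDL // -/N; have := odd_runsL cL; rewrite -/N.
move: odd1 odd2; do 2!case: (_ != _); rewrite ?addn0 ?addn1; lia.
Qed.

(** The constants [s] found on the two sides of the axis agree modulo [N], by
    [mirror_runs_opposite]; so the pairing along the parallels to [cis phi] is one
    reflection of the whole cycle of runs. *)
Lemma direction_reflection phi :
  (forall i, exists j, c i != c j /\ cross (cis phi) (x i) = cross (cis phi) (x j)) ->
  exists s : nat, forall i j, c i != c j ->
    cross (cis phi) (x i) = cross (cis phi) (x j) ->
    (runs c i + runs c j = s %[mod N])%N.
Proof.
move=> par0.
have [theta [Lt cisE]] : exists theta, a L < theta /\ cis theta = cis phi.
  have [m hm] := a_unbounded (a L + a 0%N - phi).
  exists (phi + 2 * pi * m%:R); rewrite cisD2pi; split => //.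
  by move: hm; rewrite -[(m * L)%N]add0n a_mulL; lra.
have par : forall i, exists j, c i != c j /\ cross (cis theta) (x i) = cross (cis theta) (x j).
  by rewrite cisE.
have Lt' : a L < theta + pi by have := pi0; lra.
have par' p : exists q, c p != c q /\
    cross (cis (theta + pi)) (x p) = cross (cis (theta + pi)) (x q).
  by have [q [cpq hpq]] := par p; exists q; rewrite !cross_cisDpi hpq.
have [i1 /(mirror_exists Lt par)[i1' Q1]] := half_turn_nonempty Lt.
have [i2 /(mirror_exists Lt' par')[i2' Q2]] := half_turn_nonempty Lt'.
have S2 := mirror_runs_opposite Lt par Q1 Q2.
exists (runs c i1 + runs c i1')%N => i j cij; rewrite -cisE => hij.
have shift p q m : (p + m * L = q \/ q + m * L = p)%N -> (runs c p = runs c q %[mod N])%N.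
  by move=> [<-|<-]; rewrite runsML // -/N addnC modnMDl.
have [hi|hi] := leP 0 (cross (cis theta) (x i)).
  have [m [p [Wp xp cp mp]]] := half_turn_repr Lt hi.
  have [|m' [q [Wq xq cq mq]]] := @half_turn_repr theta Lt j; first by rewrite -hij.
  have Q : mirror theta p q by split; rewrite ?cp ?cq ?xp ?xq.
  by rewrite (mirror_runs Lt par Q1 Q) -modnDm (shift _ _ _ mp) (shift _ _ _ mq) modnDm.
have [|m [p [Wp xp cp mp]]] := @half_turn_repr (theta + pi) Lt' i.
  by rewrite cross_cisDpi oppr_ge0 ltW.
have [|m' [q [Wq xq cq mq]]] := @half_turn_repr (theta + pi) Lt' j.
  by rewrite cross_cisDpi oppr_ge0 -hij ltW.
have Q : mirror (theta + pi) p q.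
  by split; rewrite ?cp ?cq ?xp ?xq // !cross_cisDpi hij.
rewrite -modnDm (shift _ _ _ mp) (shift _ _ _ mq) modnDm (mirror_runs Lt' par' Q Q2) S2.
by rewrite modnDr.
Qed.

Section SameXray.
Variable phi : R.
Let h i := cross (cis phi) (x i).
Hypothesis same_heights : perm_eq [seq h i | i <- iota 0 L & c i]
                                  [seq h i | i <- iota 0 L & ~~ c i].

Lemma height_partner i : exists j, c i != c j /\ h i = h j.
Proof.
have [m [p [/andP[_ pL] xp cp _]]] := window_repr 0 i.
have hip : h i = h p by rewrite /h xp.
have pin b : c i = b -> h i \in [seq h i | i <- iota 0 L & c i == b].
  move=> ci; rewrite hip; apply: map_f.
  by rewrite mem_filter mem_iota cp ci eqxx pL.
have E b : [seq h i | i <- iota 0 L & c i == b] = [seq h i | i <- iota 0 L & if b then c i else ~~ c i].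
  by congr (map _ _); apply: eq_filter => q; case: b; case: (c q).
have := pin _ erefl; rewrite E; case ci: (c i).
  rewrite (perm_mem same_heights) => /mapP[q]; rewrite mem_filter => /andP[cq _] e.
  by exists q; rewrite (negPf cq).
rewrite -(perm_mem same_heights) => /mapP[q]; rewrite mem_filter => /andP[cq _] e.
by exists q; rewrite cq.
Qed.

(** The weight [sin (2 pi d / N - pi s / N)] of the run [d] takes opposite values at
    partners, by [direction_reflection].  Up to the sign given by the colour it
    depends only on the height of the point; since the two colours have the same
    heights, the weighted sum of the heights is zero. *)
Lemma direction_harmonics : exists s : nat,
  cos (pi * s%:R / N%:R) * cross (cis phi) harm_sin -
  sin (pi * s%:R / N%:R) * cross (cis phi) harm_cos = 0.
Proof.
have [s sP] := direction_reflection height_partner; exists s.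
pose G i : R := sin (2 * pi * (runs c i)%:R / N%:R) * cos (pi * s%:R / N%:R) +
     cos (2 * pi * (runs c i)%:R / N%:R) * - sin (pi * s%:R / N%:R).
have GE i : G i = sin (2 * pi * (runs c i)%:R / N%:R - pi * s%:R / N%:R).
  by rewrite sinB /G; ring.
have N0 : N%:R != 0 :> R by rewrite gt_eqF.
have Gopp i j : c i != c j -> h i = h j -> G j = - G i.
  move=> cij hij; have := sP i j cij hij.
  set ri := runs c i; set rj := runs c j => e.
  have er := congr1 (fun z => z%:R : R) (divn_eq (ri + rj) N).
  have es := congr1 (fun z => z%:R : R) (divn_eq s N).
  rewrite e /= in er; rewrite /= in es.
  set q' := ((ri + rj) %/ N)%N in er; set q := (s %/ N)%N in es.
  rewrite !natrD !natrM in er; rewrite !natrD !natrM in es.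
  have sinE (y : R) : sin y = complex.Im (cis y) by [].
  rewrite !GE -sinN !sinE -(cisD2pi _ q) -[in RHS](cisD2pi _ q').
  congr (complex.Im (cis _)).
  have -> : (runs c j)%:R = q'%:R * N%:R + s%:R - q%:R * N%:R - ri%:R :> R.
    by rewrite -/rj; lra.
  by rewrite -/ri; field.
(* the weight of the points of colour [true] at height [v] *)
pose gam (v : R) : R := G (xget 0%N [set i | c i /\ h i = v]%classic).
have gamT i : c i -> G i = gam (h i).
  move=> ci; rewrite /gam; case: xgetP => [p _ [cp hp]|no]; last by case: (no i).
  have [j [cij hij]] := height_partner i.
  have cpj : c p != c j by rewrite cp -ci.
  have hpj : h p = h j by rewrite hp.
  by rewrite -[LHS]opprK -(Gopp _ _ cij hij) (Gopp _ _ cpj hpj) opprK.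
have gamF i : ~~ c i -> G i = - gam (h i).
  move=> ci; have [j [cij hij]] := height_partner i.
  have cj : c j by move: cij ci; case: (c i); case: (c j).
  have cji : c j != c i by rewrite eq_sym.
  by rewrite hij -gamT // (Gopp _ _ cji (esym hij)).
have := @harm_combination phi (cos (pi * s%:R / N%:R)) (- sin (pi * s%:R / N%:R)).
rewrite mulNr => <-.
rewrite (bigID c) /=.
rewrite (eq_bigr (fun i => h i * gam (h i))) => [|i ci]; last first.
  by rewrite -gamT // mulrC.
rewrite [X in _ + X](eq_bigr (fun i => - (h i * gam (h i)))) => [|i ci]; last first.
  by rewrite -[LHS]mulrC -mulrN -gamF.
rewrite sumrN; apply/eqP; rewrite subr_eq0; apply/eqP.
rewrite -[LHS]big_filter -[RHS]big_filter /index_iota subn0.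
rewrite -(big_map h predT (fun v => v * gam v)) -[RHS](big_map h predT (fun v => v * gam v)).
exact: perm_big.
Qed.
End SameXray.
End Harmonic.

(** * From equal X-rays to chords of a regular polygon *)

Section SineDirections.
Variable R : realType.
Variables (D D' : seq R[i]) (K K' : R[i] -> Prop).
Hypothesis K_convex : convex_pred K.
Hypothesis K'_convex : convex_pred K'.
Hypothesis K0 : K 0.
Hypothesis K'0 : K' 0.
Hypothesis DK : forall z, z \in D -> K z /\ ~ K' z.
Hypothesis D'K : forall z, z \in D' -> K' z /\ ~ K z.
Hypothesis sumD : \sum_(z <- D) z = 0.
Hypothesis sumD' : \sum_(z <- D') z = 0.
Hypothesis D_ne : D <> [::].
Hypothesis D'_ne : D' <> [::].

(** If [V] and [W] were parallel, then both would have height zero over the line that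
    they span, against [harm_nondegenerate]. *)
Theorem sine_directions : exists (V W : R[i]) (N : nat),
  [/\ (0 < N)%N, cross V W != 0 &
      forall u, u != 0 -> perm_eq (map (cross u) D) (map (cross u) D') ->
      exists s : nat, cos (pi * s%:R / N%:R) * cross u V =
                      sin (pi * s%:R / N%:R) * cross u W].
Proof.
pose P := D ++ D'.
have P0 z : z \in P -> z != 0.
  rewrite mem_cat => /orP[/DK|/D'K][_ nz]; first by apply: contra_notN nz => /eqP->.
  by apply: contra_notN nz => /eqP->.
have Pne : P <> [::] by rewrite /P; case: (D) D_ne.
have [x [r [a [memP permP xrP a_le perP]]]] := angular_enum P0 Pne.
set L := size P in memP permP perP.
have L0 : (0 < L)%N by rewrite /L lt0n size_eq0; apply/eqP.
pose c i := x i \in D.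
have cL i : c (i + L)%N = c i by rewrite /c (perP i).1.
pose KK (b : bool) := if b then K else K'.
have xP i : x i \in P.
  rewrite memP.
  have -> : x i = x (i %% L)%N.
    rewrite {1}(divn_eq i L) addnC; elim: (i %/ L)%N => [|m IHm].
      by rewrite mul0n addn0.
    by rewrite mulSn addnCA addnC (perP _).1.
  by apply: map_f; rewrite mem_iota ltn_mod.
have DD' z : z \in D -> z \in D' -> False.
  by move=> /DK[Kz _] /D'K[_].
have cF i : c i = false -> x i \in D'.
  by move=> ci; have := xP i; rewrite mem_cat -/(c i) ci.
have KKx i : KK (c i) (x i).
  by case ci: (c i); [have [] := DK ci|have [] := D'K (cF i ci)].
have nKKx i : ~ KK (~~ c i) (x i).
  by case ci: (c i); [have [] := DK ci|have [] := D'K (cF i ci)].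
have nDD' z : z \in D' -> (z \in D) = false.
  by move=> zD'; apply/negP => /DD'; exact.
have filtT : perm_eq [seq x i | i <- iota 0 L & c i] D.
  rewrite -(filter_map x (fun z => z \in D)) -(permPl (perm_filter _ permP)) filter_cat.
  have -> : [seq z <- D | z \in D] = D by apply/all_filterP/allP.
  have -> : [seq z <- D' | z \in D] = seq.filter pred0 D' by apply: eq_in_filter => z /nDD'.
  by rewrite filter_pred0 cats0.
have filtF : perm_eq [seq x i | i <- iota 0 L & ~~ c i] D'.
  rewrite -(filter_map x (fun z => z \notin D)) -(permPl (perm_filter _ permP)) filter_cat.
  have -> : [seq z <- D | z \notin D] = seq.filter pred0 D by apply: eq_in_filter => z ->.
  have -> : [seq z <- D' | z \notin D] = D'.
    by apply/all_filterP/allP => z /nDD' ->.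
  by rewrite filter_pred0.
have sum_x b : \sum_(0 <= i < L | c i == b) x i = 0.
  rewrite -big_filter /index_iota subn0 -(big_map x predT id) /=.
  case: b; last first.
    rewrite (eq_filter (a2 := fun i => ~~ c i)); last by move=> i; case: (c i).
    by rewrite (perm_big _ filtF).
  rewrite (eq_filter (a2 := c)); last by move=> i; case: (c i).
  by rewrite (perm_big _ filtT).
have c_ex b : exists i, c i = b.
  case: b.
    case: (D) D_ne filtT => // z s _ /perm_mem/(_ z); rewrite mem_head.
    by move/mapP => [ i ]; rewrite mem_filter => /andP[ci _] _; exists i.
  case: (D') D'_ne filtF => // z s _ /perm_mem/(_ z); rewrite mem_head.
  by move/mapP => [ i ]; rewrite mem_filter => /andP[/negPf ci _] _; exists i.
have KK_convex b : convex_pred (KK b) by case: b.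
have KK0 b : KK b 0 by case: b.
have xE i : x i = (r i)%:C * cis (a i) by case: (xrP i).
have r_gt0 i : 0 < r i by case: (xrP i).
have aL i : a (i + L)%N = a i + 2 * pi by case: (perP i).
have xL i : x (i + L)%N = x i by case: (perP i).
have N2 := runs_gt2 L0 xE r_gt0 a_le aL xL cL KK_convex KK0 KKx nKKx sum_x c_ex.
pose V := harm_sin L x c; pose W := harm_cos L x c.
exists V, W, (runs c L); split; first by lia.
  apply/eqP => VW.
  have nondeg w : w != 0 -> cross w V = 0 -> cross w W = 0 -> False.
    move=> /polar[q [phi [q0 _ ->]]]; rewrite !crossZl => /eqP + /eqP.
    rewrite !mulf_eq0 gt_eqF //= => /eqP wV /eqP wW.
    have [m hm] := a_unbounded aL (a L + a 0%N - phi).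
    have ea := a_mulL aL 0 m; rewrite add0n in ea.
    apply: (harm_nondegenerate L0 xE r_gt0 a_le aL xL cL KK_convex KK0 KKx nKKx sum_x c_ex
      (theta := phi + 2 * pi * m%:R)); rewrite ?cisD2pi //.
    by move: hm; rewrite ea; lra.
  have [V0|V0] := eqVneq V 0.
    have [W0|W0] := eqVneq W 0.
      by apply: (nondeg 1 (oner_neq0 _)); rewrite ?V0 ?W0 cross0r.
    by apply: (nondeg W W0); rewrite ?crossxx // V0 cross0r.
  by apply: (nondeg V V0); rewrite ?crossxx.
move=> u /polar[q [phi [q0 _ ->]]] same.
have {}same : perm_eq (map (cross (cis phi)) D) (map (cross (cis phi)) D').
  have := perm_map (fun t => q^-1 * t) same; rewrite -!map_comp.
  have E s : map ((fun t => q^-1 * t) \o cross (q%:C * cis phi)) s = map (cross (cis phi)) s.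
    by apply: eq_map => z /=; rewrite crossZl mulKf ?gt_eqF.
  by rewrite !E.
have E (p : pred nat) : [seq cross (cis phi) (x i) | i <- iota 0 L & p i] =
    map (cross (cis phi)) [seq x i | i <- iota 0 L & p i] by rewrite -map_comp.
have same_x : perm_eq [seq cross (cis phi) (x i) | i <- iota 0 L & c i]
                      [seq cross (cis phi) (x i) | i <- iota 0 L & ~~ c i].
  rewrite !E (permPl (perm_map _ filtT)) perm_sym (permPl (perm_map _ filtF)).
  by rewrite perm_sym.
have [s hs] := direction_harmonics L0 xE r_gt0 a_le aL xL cL KK_convex KK0 KKx nKKx sum_x c_ex same_x.
by exists s; rewrite !crossZl; apply/eqP; rewrite -subr_eq0 -(mulr0 q) -hs; apply/eqP; ring.
Qed.
End SineDirections.

Section Hulls.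
Variable R : realType.
Implicit Types (A : set R[i]) (x y z : R[i]).
Local Open Scope classical_set_scope.

Lemma scale_Rcomplex (k : R) (x : Rcomplex R) : k *: x = k%:C * x.
Proof. by case: x => a b; apply: complex_ext; rewrite /= !mul0r ?subr0 ?addr0. Qed.

(** Convexity with the multiplication of [R[i]] in place of the scaling of a real
    vector space. *)
Lemma convex_setE A : @convex_set R (Rcomplex R) A <-> convex_pred A.
Proof.
split=> [cA x y t /andP[t0 t1] Ax Ay|cA x y l].
  have := cA x y (Itv01 t0 t1); rewrite !inE => /(_ Ax Ay).
  by rewrite /conv /= !scale_Rcomplex.
rewrite !inE => Ax Ay; have := cA x y l%:num _ Ax Ay.
rewrite /conv /= !scale_Rcomplex; apply.
by apply/andP; split => //; exact: ge0.
Qed.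

Lemma convex_hull_convex A : convex_pred (convex_hull A).
Proof.
move=> x y t t01 Ax Ay B [cB AB].
by apply: (proj1 (convex_setE B) cB) => //; [exact: Ax|exact: Ay].
Qed.

Lemma sub_convex_hull A : A `<=` convex_hull A.
Proof. by move=> x Ax B [_]; apply. Qed.

Lemma convex_hull_sub A (B : set R[i]) : convex_pred B -> A `<=` B -> convex_hull A `<=` B.
Proof. by move=> cB AB x; apply; split => //; apply/convex_setE. Qed.

Lemma convex_average (K : R[i] -> Prop) (s : seq R[i]) :
  convex_pred K -> s <> [::] -> (forall z, z \in s -> K z) ->
  K ((size s)%:R^-1%:C * \sum_(z <- s) z).
Proof.
move=> cK; elim: s => // z [|w s] IHs _ Ks.
  by rewrite big_seq1 /= invr1 mul1r; apply: Ks; rewrite mem_head.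
have {}IHs : K ((size (w :: s))%:R^-1%:C * \sum_(v <- w :: s) v).
  by apply: IHs => // v vs; apply: Ks; rewrite inE vs orbT.
have m0 : (0 : R) < (size (w :: s))%:R by rewrite ltr0n.
have e : (size [:: z, w & s])%:R = (size (w :: s))%:R + 1 :> R by rewrite natr1.
rewrite big_cons e; move: (size (w :: s))%:R (\sum_(_ <- _) _) m0 IHs => m T m0 KT.
have t01 : 0 <= (m + 1)^-1 <= (1 : R).
  by rewrite invr_ge0 invf_le1; lra.
have Kz : K z by apply: Ks; rewrite mem_head.
have := cK z (m^-1%:C * T) (m + 1)^-1 t01 Kz KT; congr (K _).
have m1 : m + 1 != 0 by rewrite gt_eqF; lra.
apply: complex_ext; rewrite !complex_lin; field; rewrite m1 /=; exact: lt0r_neq0.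
Qed.
End Hulls.

Section XrayToSines.
Variable R : realType.
Implicit Types (F : {fset R[i]}) (S : set R[i]) (u v x y z : R[i]).
Local Open Scope classical_set_scope.

Lemma mem_line u x y : u != 0 ->
  [set x + c%:C * u | c in [set: R]] y <-> cross u y = cross u x.
Proof.
move=> u0; split=> [[k _ <-]|uxy].
  by rewrite crossDr crossZr crossxx mulr0 addr0.
have /(cross_eq0 u0)[k yx] : cross u (y - x) = 0 by rewrite crossDr crossNr; lra.
by exists k => //; rewrite -yx addrC subrK.
Qed.

Lemma Xray_count F u x (l : lines u) : u != 0 ->
  val l = [set x + c%:C * u | c in [set: R]] ->
  Xray F l = count (fun y => cross u y == cross u x) F.
Proof.
move=> u0 lE; rewrite /Xray -size_filter.
apply/perm_size/uniq_perm; rewrite ?filter_uniq ?fset_uniq // => y.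
rewrite mem_filter !inE /= andbC; congr (_ && _).
rewrite lE; apply/idP/eqP; rewrite inE; first by move/(mem_line x y u0).
by move=> h; apply/(mem_line x y u0).
Qed.

(** A line parallel to [u] is a level set of [cross u]: an X-ray is the multiset of
    the heights. *)
Lemma Xray_eqP F F' u : u != 0 ->
  Xray (u := u) F = Xray F' <->
  perm_eq (map (cross u) F) (map (cross u) F').
Proof.
move=> u0; split=> [FF'|/allP FF'].
  apply/allP => v /=; rewrite mem_cat => vFF'.
  have [x vx] : exists x, v = cross u x.
    by case/orP: vFF' => /mapP[x _ ->]; exists x.
  have Pl : [set x + c%:C * u | c in [set: R]] \in lines u by rewrite inE; exists x.
  have := congr1 (fun f => f (SigSub Pl)) FF'.
  rewrite !(@Xray_count _ u x) // vx !count_map => /eqP; congr (_ == _);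
    by apply: eq_count => y /=; rewrite eq_sym.
apply/funext => l; have := valP l; rewrite inE => -[x lE].
rewrite !(@Xray_count _ u x) //.
have E (s : seq R[i]) : count (fun y => cross u y == cross u x) s =
    count_mem (cross u x) (map (cross u) s).
  by rewrite count_map; apply: eq_count.
rewrite !E.
have [|h] := boolP (cross u x \in map (cross u) F ++ map (cross u) F').
  by move/FF'/eqP.
by move: h; rewrite mem_cat negb_or => /andP[/count_memPn -> /count_memPn ->].
Qed.

Lemma perm_cat_fsetD F F' : perm_eq F (enum_fset (F `\` F')%fset ++ enum_fset (F `&` F')%fset).
Proof.
apply: uniq_perm; rewrite ?fset_uniq //.
  rewrite cat_uniq !fset_uniq andbT /=; apply/hasPn => z.
  by rewrite !inE => /andP[_ ->].
by move=> z; rewrite mem_cat !inE; case: (z \in F); case: (z \in F').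
Qed.

(** The X-rays in two non-parallel directions already force the two differences to
    have the same size and the same sum.  Their common centroid is in the hulls of
    both [F] and [F'], and is taken as origin.  The conclusion means that [u] is
    parallel to [sin (pi s / N) W - cos (pi s / N) V], a linear image of a vector
    whose angle is a multiple of [pi / N], as are those of the edges and diagonals
    of a regular [N]-gon up to a rotation. *)
Theorem same_Xray_sines S F F' (U : {fset R[i]}) u1 u2 :
  convex_subsets S F -> convex_subsets S F' -> F <> F' ->
  {in U, forall u, Xray (u := u) F = Xray F'} ->
  (forall u, u \in U -> u != 0) ->
  u1 \in U -> u2 \in U -> cross u1 u2 != 0 ->
  exists (V W : R[i]) (N : nat), [/\ (0 < N)%N, cross V W != 0 &
    forall u, u \in U -> exists s : nat,
      cos (pi * s%:R / N%:R) * cross u V = sin (pi * s%:R / N%:R) * cross u W].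
Proof.
move=> SF SF' FF' UX U0 U1 U2 u12.
pose D := enum_fset (F `\` F')%fset; pose D' := enum_fset (F' `\` F)%fset.
have heights u : u \in U -> perm_eq (map (cross u) D) (map (cross u) D').
  move=> Uu; have := UX u Uu => /(Xray_eqP _ _ (U0 u Uu)).
  rewrite (permPl (perm_map _ (perm_cat_fsetD F F'))) perm_sym.
  rewrite (permPl (perm_map _ (perm_cat_fsetD F' F))) fsetIC perm_sym !map_cat.
  by rewrite perm_cat2r.
have sizeD : size D = size D'.
  by have := perm_size (heights u1 U1); rewrite !size_map.
have sumE u : u \in U -> cross u (\sum_(z <- D) z) = cross u (\sum_(z <- D') z).
  move=> /heights h; rewrite !cross_sum -(big_map (cross u) predT id).
  by rewrite -[RHS](big_map (cross u) predT id); exact: perm_big.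
have sumDD' : \sum_(z <- D) z = \sum_(z <- D') z.
  apply/eqP; rewrite -subr_eq0; apply/eqP; apply: (cross2_eq0 u12);
  by rewrite crossDr crossNr sumE ?subrr.
have Dne : D <> [::].
  move=> D0; apply: FF'; apply/eqP; rewrite eqEfsubset.
  have D'0 : D' = [::] by apply: size0nil; rewrite -sizeD D0.
  rewrite -!fsetD_eq0 -!cardfs_eq0 /= /D in D0 *; rewrite D0 /=.
  by move: D'0; rewrite /D' => ->.
have D'ne : D' <> [::] by move=> D'0; apply: Dne; apply: size0nil; rewrite sizeD D'0.
pose o := (size D)%:R^-1%:C * \sum_(z <- D) z.
have hullE (G : {fset R[i]}) (s : seq R[i]) : {subset s <= G} -> s <> [::] -> size s = size D ->
    \sum_(z <- s) z = \sum_(z <- D) z -> convex_hull [set` G] o.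
  move=> sG sne ss sumE'; rewrite /o -ss -sumE'.
  by apply: (convex_average (@convex_hull_convex _ _) sne) => z /sG zG; apply: sub_convex_hull.
have subD : {subset D <= F} by move=> z; rewrite inE => /andP[].
have subD' : {subset D' <= F'} by move=> z; rewrite inE => /andP[].
pose H (G : {fset R[i]}) z := convex_hull [set` G] (o + z).
have H_convex G : convex_pred (H G).
  move=> x y t t01 Hx Hy; have := convex_hull_convex t01 Hx Hy.
  by congr (convex_hull _ _); apply: complex_ext; rewrite !complex_lin; ring.
have H0 G : convex_hull [set` G] o -> H G 0 by rewrite /H addr0.
have HF : H F 0 by apply: H0; apply: (hullE F D).
have HF' : H F' 0 by apply: H0; apply: (hullE F' D').
have mem_shift s z : z \in map (fun z => z - o) s -> (o + z) \in s.
  by move=> /mapP[y ys ->]; rewrite addrC subrK.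
have nhull (G G' : {fset R[i]}) z : convex_subsets S G -> convex_subsets S G' ->
    z \in (G `\` G')%fset -> convex_hull [set` G] z /\ ~ convex_hull [set` G'] z.
  move=> SG SG'; rewrite inE => /andP[zG' zG]; split; first exact: sub_convex_hull.
  move=> hz; move: zG'; apply/negP/negPn.
  have : [set` G] z by [].
  rewrite SG => -[_ Sz]; have : [set` G'] z by rewrite SG'.
  by [].
have DK z : z \in map (fun z => z - o) D -> H F z /\ ~ H F' z.
  by move=> /mem_shift; exact: nhull.
have D'K z : z \in map (fun z => z - o) D' -> H F' z /\ ~ H F z.
  by move=> /mem_shift; exact: nhull.
have sum_shift s : size s = size D -> \sum_(z <- s) z = \sum_(z <- D) z ->
    \sum_(z <- map (fun z => z - o) s) z = 0.
  move=> ss e; rewrite big_map sumrB e big_const_seq count_predT ss iter_addr_0.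
  have n0 : (size D)%:R != 0 :> R by rewrite pnatr_eq0 size_eq0; apply/eqP.
  apply/eqP; rewrite subr_eq0 -mulr_natl /o mulrA -(rmorph_nat (real_complex R)).
  by rewrite -rmorphM /= divff // mul1r.
have [||V [W [N [N0 VW sP]]]] := sine_directions (H_convex F) (H_convex F') HF HF' DK D'K
  (sum_shift D erefl erefl) (sum_shift D' (esym sizeD) (esym sumDD')).
- by case: (D) Dne.
- by case: (D') D'ne.
exists V, W, N; split => // u Uu; apply: sP; first exact: U0.
have E s : map (cross u) (map (fun z => z - o) s) = map (fun t => t - cross u o) (map (cross u) s).
  by rewrite -!map_comp; apply: eq_map => z /=; rewrite crossDr crossNr.
by rewrite !E; apply: perm_map; exact: heights.
Qed.
End XrayToSines.

(** * Rational ratios of cyclotomic numbers *)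

Section CyclotomicValuation.
Variable F : numFieldType.
Implicit Types (x y z w : F).

Definition algint x := integralOver (intr : int -> F) x.

(** For a rational number, being a root of a monic integer polynomial does not
    depend on the field that contains it, so that the known case of [algC]
    applies. *)
Lemma algint_rat (q : rat) : algint (ratr q) -> exists k : int, q = k%:~R.
Proof.
move=> [p p_monic]; rewrite (_ : map_poly _ p = map_poly ratr (map_poly intr p)); last first.
  by rewrite -map_poly_comp; apply: eq_map_poly => k /=; rewrite ratr_int.
rewrite fmorph_root => pq.
have : (ratr q : algC) \is a Num.int.
  apply: Cint_rat_Aint; first by exact: Crat_rat.
  apply: (@root_monic_Aint (map_poly intr p)).
  - rewrite (_ : map_poly _ p = map_poly ratr (map_poly intr p)) ?fmorph_root //.
    by rewrite -map_poly_comp; apply: eq_map_poly => k /=; rewrite ratr_int.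
  - exact: monic_map.
  - by apply/polyOverP => i; rewrite coef_map /= intr_int.
move=> /intrP[k qk]; exists k; apply: (fmorph_inj (ratr : {rmorphism rat -> algC})).
by rewrite /= qk ratr_int.
Qed.

Definition associated x y :=
  exists w, [/\ w != 0, algint w, algint w^-1 & y = w * x].

Lemma associated_refl x : associated x x.
Proof.
by exists 1; rewrite oner_neq0 invr1 mul1r; split => //; apply: integral1.
Qed.

Lemma associatedM x y x' y' :
  associated x y -> associated x' y' -> associated (x * x') (y * y').
Proof.
move=> [w [w0 wi wVi ->]] [w' [w0' wi' wVi' ->]].
exists (w * w'); split; rewrite ?mulf_neq0 ?invfM //; first exact: integral_mul.
  exact: integral_mul.
by rewrite mulrACA.
Qed.

Lemma associatedX x y n : associated x y -> associated (x ^+ n) (y ^+ n).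
Proof.
move=> xy; elim: n => [|n IHn]; first exact: associated_refl.
by rewrite !exprS; apply: associatedM.
Qed.

(** The value 1 at [i = 0] replaces the factor zero, so that products may run over
    all exponents below the order of [z]. *)
Definition one_sub_expr z i := if i == 0%N then 1 else 1 - z ^+ i.

Lemma prod_one_sub_expr z m : m.-primitive_root z ->
  \prod_(0 <= i < m) one_sub_expr z i = m%:R.
Proof.
move=> mz; have m0 := prim_order_gt0 mz.
have := factor_Xn_sub_1 mz; rewrite big_ltn // expr0 subrX1.
move=> /(mulfI _)/(congr1 (horner^~ 1)); rewrite polyXsubC_eq0 => /(_ isT).
rewrite horner_prod horner_sum => e; rewrite big_ltn // {1}/one_sub_expr /= mul1r.
transitivity (\prod_(1 <= i < m) ('X - (z ^+ i)%:P).[1]).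
  apply: eq_big_nat => i /andP[i0 _]; rewrite /one_sub_expr !hornerE; by case: i i0.
by rewrite e (eq_bigr (fun=> 1)) ?sumr_const ?card_ord // => i _; rewrite !hornerE expr1n.
Qed.

Lemma big_nat_dvd (T : Type) (idx : T) (op : Monoid.com_law idx) (f : nat -> T) p q :
  (0 < p)%N ->
  \big[op/idx]_(0 <= i < p * q | (p %| i)%N) f i = \big[op/idx]_(0 <= j < q) f (p * j)%N.
Proof.
move=> p0; rewrite -big_filter -(big_map (muln p) predT f); apply: perm_big.
apply: uniq_perm; rewrite ?filter_uniq ?iota_uniq // ?map_inj_uniq ?iota_uniq //.
  by move=> i j /eqP; rewrite eqn_pmul2l // => /eqP.
move=> i; rewrite mem_filter mem_index_iota; apply/andP/mapP => [[/dvdnP[j ->] h]|[j]].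
  by exists j; rewrite 1?mulnC // mem_index_iota; nia.
by rewrite mem_index_iota => h ->; rewrite dvdn_mulr //; split => //; nia.
Qed.

Lemma algint_expr z m i : m.-primitive_root z -> algint (z ^+ i).
Proof.
move=> mz; apply: (@integral_root_monic _ _ _ _ ('X^m - 1)).
- by rewrite monicXnsubC // (prim_order_gt0 mz).
- by rewrite /root !hornerE exprAC (prim_expr_order mz) expr1n subrr.
- apply/(integral_poly (intr : {rmorphism int -> F}) _).1 => j.
  rewrite coefB coefXn coef1; apply: integral_sub; exact: integral_nat.
Qed.

Lemma one_sub_expr_quotient z m i : m.-primitive_root z ->
  exists2 w, algint w & 1 - z ^+ i = w * (1 - z).
Proof.
move=> mz; exists (\sum_(j < i) z ^+ j).
  elim/big_ind: _ => [|u v|j _]; [exact: mxpoly.integral0|exact: integral_add|exact: algint_expr mz].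
by rewrite -[LHS]opprB subrX1; ring.
Qed.

Lemma one_sub_neq0 z m : m.-primitive_root z -> (1 < m)%N -> 1 - z != 0.
Proof.
move=> mz m1; rewrite subr_eq0 eq_sym -(expr1 z) -(prim_order_dvd mz) dvdn1.
by rewrite gtn_eqF.
Qed.

(** [z] is in turn a power of [z ^+ i], so each of the two numbers divides the
    other. *)
Lemma one_sub_expr_associated z m i : m.-primitive_root z -> (1 < m)%N ->
  coprime i m -> associated (1 - z) (1 - z ^+ i).
Proof.
move=> mz m1 co; have [w wi zi] := one_sub_expr_quotient i mz.
have mzi : m.-primitive_root (z ^+ i) by rewrite prim_root_exp_coprime.
have [j zE] : exists j, z = (z ^+ i) ^+ j.
  by have [j zj] := prim_rootP mzi (prim_expr_order mz); exists j.
have [w' wi'] := one_sub_expr_quotient j mzi; rewrite -zE => zj.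
have z0 := one_sub_neq0 mz m1.
have ww' : w' * w = 1 by apply: (mulIf z0); rewrite mul1r -mulrA -zi -zj.
have w0 : w != 0 by apply: contra_eq_neq ww' => ->; rewrite mulr0 eq_sym oner_eq0.
exists w; split => //; rewrite (_ : w^-1 = w') //.
by apply: (mulIf w0); rewrite mulVf.
Qed.

(** The prime [p] is totally ramified in the field generated by [z]: the product of
    [1 - z ^+ i] over the exponents prime to [p] is [p], as the quotient of the
    products over the roots of unity of orders [p ^ e.+1] and [p ^ e], and its
    factors are all associated to [1 - z]. *)
Lemma one_sub_prime_power z p e : prime p -> (p ^ e.+1).-primitive_root z ->
  associated ((1 - z) ^+ (p ^ e * p.-1)) p%:R.
Proof.
move=> pp mz; set m := (p ^ e.+1)%N in mz.
have p0 := prime_gt0 pp; have p1 := prime_gt1 pp.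
have q0 : (0 < p ^ e)%N by rewrite expn_gt0 p0.
have mE : m = (p * p ^ e)%N by rewrite /m expnS.
have m1 : (1 < m)%N by rewrite mE; nia.
have qzp : (p ^ e).-primitive_root (z ^+ p).
  have dm : (p ^ e %| m)%N by rewrite mE dvdn_mull.
  by have := dvdn_prim_root mz dm; rewrite mE mulnK.
have prodE : \prod_(0 <= i < m | ~~ (p %| i)%N) (1 - z ^+ i) = p%:R.
  have := prod_one_sub_expr mz; rewrite (bigID (fun i => p %| i)%N) /= {1}mE.
  rewrite (big_nat_dvd _ (one_sub_expr z) _ p0).
  rewrite (eq_bigr (one_sub_expr (z ^+ p))) => [|i _]; last first.
    by rewrite /one_sub_expr muln_eq0 gtn_eqF //= exprM.
  rewrite prod_one_sub_expr // mE natrM mulrC => /(mulIf _).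
  rewrite pnatr_eq0 gtn_eqF // => /(_ isT) <-; apply: eq_bigr => i pi.
  by rewrite /one_sub_expr; case: eqP pi => // ->; rewrite dvdn0.
have cardE : (\sum_(0 <= i < m | ~~ (p %| i)) 1 = p ^ e * p.-1)%N.
  have : (\sum_(0 <= i < m) 1 = m)%N by rewrite sum_nat_const_nat muln1 subn0.
  rewrite (bigID (fun i => p %| i)%N) /= {1}mE (big_nat_dvd _ (fun=> 1%N) _ p0).
  by rewrite sum_nat_const_nat muln1 subn0 mE; move: (\sum_(_ <= _ < _ | _) _)%N; nia.
rewrite -prodE -cardE; elim/big_rec2: _ => [|i x y pi]; first exact: associated_refl.
rewrite exprD expr1; apply: associatedM; apply: one_sub_expr_associated mz m1 _.
by rewrite coprime_sym coprimeXl // prime_coprime.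
Qed.

(** In the other cases [1 - z] divides two coprime integers. *)
Lemma one_sub_not_prime_power z a b : (a * b).-primitive_root z ->
  (1 < a)%N -> (1 < b)%N -> coprime a b -> associated (1 - z) 1.
Proof.
move=> mz a1 b1 co; have m1 : (1 < a * b)%N by nia.
have z0 := one_sub_neq0 mz m1.
have quot c d : (c * d = a * b)%N -> (1 < c)%N -> (1 < d)%N -> algint (d%:R / (1 - z)).
  move=> cd c1 d1.
  have dz : d.-primitive_root (z ^+ c).
    have dm : (d %| a * b)%N by rewrite -cd dvdn_mull.
    by have := dvdn_prim_root mz dm; rewrite -cd mulnK // ltnW.
  have := prod_one_sub_expr dz; rewrite big_ltn ?(ltnW d1) // big_ltn // mul1r.
  rewrite {1}/one_sub_expr /= expr1; have [w wi ->] := one_sub_expr_quotient c mz.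
  move=> <-; rewrite mulrAC mulfK //; apply: integral_mul => //.
  rewrite big_seq_cond; elim/big_ind: _ => [|u v|i _]; [exact: integral1|exact: integral_mul|].
  rewrite /one_sub_expr; case: eqP => _; first exact: integral1.
  by apply: integral_sub; [exact: integral1|exact: algint_expr dz].
have [u v uv _] := egcdnP b (ltnW a1); rewrite (eqP co) in uv.
exists (1 - z)^-1; rewrite invr_eq0 invrK mulVf //; split => //.
  have -> : (1 - z)^-1 = u%:R * (a%:R / (1 - z)) - v%:R * (b%:R / (1 - z)).
    by rewrite !mulrA -mulrBl -!natrM uv natrD addrAC subrr add0r div1r.
  apply: integral_sub; apply: integral_mul; try exact: integral_nat.
    by apply: (quot b a) => //; rewrite mulnC.
  exact: quot.
by rewrite -(expr1 z) -[1 in X in algint X](expr0 z);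
  apply: integral_sub; apply: algint_expr mz.
Qed.

(** For each prime [l] the valuation of [1 - z] is [logn l g / h], where [g] is
    [1] or a prime. *)
Lemma one_sub_root_of_unity z m : (0 < m)%N -> z ^+ m = 1 -> z != 1 ->
  exists g h : nat, [/\ associated ((1 - z) ^+ h) g%:R, (0 < h)%N &
    g = 1%N \/ exists p e, [/\ prime p, g = p & h = (p ^ e * p.-1)%N]].
Proof.
move=> m0 zm z1; have [k kz _] := prim_order_exists m0 zm.
have k0 := prim_order_gt0 kz.
have k1 : (1 < k)%N.
  rewrite ltn_neqAle k0 andbT eq_sym; apply: contraNneq z1 => k1.
  by rewrite -(expr1 z) -k1 prim_expr_order.
pose p := pdiv k; have pp : prime p by exact: pdiv_prime.
have p0 := prime_gt0 pp.
have lk : (0 < logn p k)%N by rewrite logn_gt0 mem_primes pp k0 pdiv_dvd.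
have [q co kE] := pfactor_coprime pp k0.
have [q1|q1] := leqP q 1.
  have {}q1 : q = 1%N by move: k0; rewrite kE; case: (q) q1 => [|[]].
  exists p, (p ^ (logn p k).-1 * p.-1)%N; split.
  - by apply: one_sub_prime_power; rewrite // prednK // -[(p ^ _)%N]mul1n -q1 -kE.
  - by rewrite muln_gt0 expn_gt0 p0 /=; have := prime_gt1 pp; lia.
  - by right; exists p, (logn p k).-1.
exists 1%N, 1%N; split => //; last by left.
rewrite expr1; apply: (@one_sub_not_prime_power z q (p ^ logn p k)) => //.
- by rewrite -kE.
- by rewrite -(expn0 p) ltn_exp2l ?prime_gt1.
- by rewrite coprime_sym coprimeXl.
Qed.

Lemma dvdn_logn (a n : nat) : (0 < a)%N -> (0 < n)%N ->
  (forall l, prime l -> logn l a <= logn l n)%N -> (a %| n)%N.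
Proof.
move=> a0 n0 H; apply/dvdn_partP => // l; rewrite mem_primes => /and3P[pl _ _].
by rewrite p_part pfactor_dvdn // H.
Qed.

(** The valuations at a prime [l.+1] in the equation of the next lemma, multiplied
    by [M] to make them integers: [x] and [y] are those of the numerator and of the
    denominator of the ratio, and the [t]s those of the four numbers [1 - z], which
    are at most the inverse of [l]. *)
Lemma valuation_bound (M x y t1 t2 t3 t4 l : nat) : (0 < M)%N ->
  (M * x + (t3 + t4) = M * y + (t1 + t2))%N -> (x = 0 \/ y = 0)%N ->
  (t1 * l <= M)%N -> (t2 * l <= M)%N -> (t3 * l <= M)%N -> (t4 * l <= M)%N ->
  (x * l <= 2 /\ y * l <= 2)%N.
Proof.
move=> M0 e xy h1 h2 h3 h4.
have e' : (M * (x * l) + (t3 * l + t4 * l) = M * (y * l) + (t1 * l + t2 * l))%N.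
  by rewrite !mulnA -!mulnDl e.
by case: xy => xy; rewrite xy ?mul0n ?muln0 in e' *; split => //;
  rewrite -(leq_pmul2l M0); lia.
Qed.

(** Write [q] as [a / b].  At a prime [l], a number [1 - z] has valuation at most
    [1 / (l - 1)], so a product of two of them at most [2 / (l - 1)]: both [a] and
    [b] divide 12.  Moreover 6 does not divide [a], and five fractions larger than
    1 remain. *)
Lemma rational_cyclotomic_ratio (q : rat) (m : nat) z1 z2 z3 z4 :
  (0 < m)%N -> z1 ^+ m = 1 -> z2 ^+ m = 1 -> z3 ^+ m = 1 -> z4 ^+ m = 1 ->
  z1 != 1 -> z2 != 1 -> z3 != 1 -> z4 != 1 -> 1 < q ->
  ratr q * ((1 - z3) * (1 - z4)) = (1 - z1) * (1 - z2) ->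
  q \in [:: 4 / 3; 3 / 2; 2; 3; 4].
Proof.
move=> m0 z1m z2m z3m z4m z11 z21 z31 z41 q1 qE.
have [g1 [h1 [A1 h10 G1]]] := one_sub_root_of_unity m0 z1m z11.
have [g2 [h2 [A2 h20 G2]]] := one_sub_root_of_unity m0 z2m z21.
have [g3 [h3 [A3 h30 G3]]] := one_sub_root_of_unity m0 z3m z31.
have [g4 [h4 [A4 h40 G4]]] := one_sub_root_of_unity m0 z4m z41.
pose M1 := (h2 * h3 * h4)%N; pose M2 := (h1 * h3 * h4)%N.
pose M3 := (h1 * h2 * h4)%N; pose M4 := (h1 * h2 * h3)%N.
pose M := (h1 * M1)%N.
have e2 : (M = h2 * M2)%N by rewrite /M /M1 /M2; ring.
have e3 : (M = h3 * M3)%N by rewrite /M /M1 /M3; ring.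
have e4 : (M = h4 * M4)%N by rewrite /M /M1 /M4; ring.
have M0 : (0 < M)%N by rewrite /M /M1 !muln_gt0 h10 h20 h30 h40.
pose A := (g1 ^ M1 * g2 ^ M2)%N; pose B := (g3 ^ M3 * g4 ^ M4)%N.
have [w [w0 wi wVi AE]] : associated (((1 - z1) * (1 - z2)) ^+ M) A%:R.
  have -> : ((1 - z1) * (1 - z2)) ^+ M = (1 - z1) ^+ h1 ^+ M1 * (1 - z2) ^+ h2 ^+ M2.
    by rewrite exprMn -!exprM -e2.
  by rewrite natrM !natrX; apply: associatedM; apply: associatedX.
have [w' [w0' wi' wVi' BE]] : associated (((1 - z3) * (1 - z4)) ^+ M) B%:R.
  have -> : ((1 - z3) * (1 - z4)) ^+ M = (1 - z3) ^+ h3 ^+ M3 * (1 - z4) ^+ h4 ^+ M4.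
    by rewrite exprMn -!exprM -e3 -e4.
  by rewrite natrM !natrX; apply: associatedM; apply: associatedX.
have g_gt0 g h : g = 1%N \/ (exists p e, [/\ prime p, g = p & h = (p ^ e * p.-1)%N]) -> (0 < g)%N.
  by case=> [->|[p [e [/prime_gt0 p0 -> _]]]].
have A0 : (0 < A)%N by rewrite muln_gt0 !expn_gt0 (g_gt0 _ _ G1) (g_gt0 _ _ G2).
have B0 : (0 < B)%N by rewrite muln_gt0 !expn_gt0 (g_gt0 _ _ G3) (g_gt0 _ _ G4).
have q0 : 0 < q by apply: lt_trans q1.
(* a rational number that is a unit among the algebraic integers, hence equal
   to 1 because it is positive *)
pose t : rat := A%:R / (q ^+ M * B%:R).
have t0 : 0 < t by rewrite divr_gt0 ?mulr_gt0 ?exprn_gt0 ?ltr0n.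
have tE : ratr t = w / w' :> F.
  have ratrE (A' B' M' : nat) :
      ratr (A'%:R / (q ^+ M' * B'%:R)) = A'%:R / (ratr q ^+ M' * B'%:R) :> F.
    by rewrite fmorph_div rmorphM rmorphXn /= !ratr_nat.
  rewrite /t ratrE AE BE -qE exprMn.
  have Y0 : (1 - z3) * (1 - z4) != 0 by rewrite mulf_neq0 // subr_eq0 eq_sym.
  rewrite mulrCA [X in _ / X]mulrCA; field.
  rewrite w0' /= expf_neq0 //= expf_neq0 //.
  by rewrite fmorph_eq0 gt_eqF.
have t_unit : t = 1.
  have [k tk] : exists k : int, t = k%:~R.
    by apply: algint_rat; rewrite /algint tE; apply: integral_mul.
  have [k' tk'] : exists k : int, t^-1 = k%:~R.
    apply: algint_rat; rewrite /algint fmorphV /= tE invfM invrK.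
    exact: integral_mul.
  have t_ge1 (r : rat) (j : int) : 0 < r -> r = j%:~R -> 1 <= r.
    by move=> r0 e; move: r0; rewrite e ltr0z ler1z.
  apply/eqP; rewrite eq_le (t_ge1 _ _ t0 tk) andbT -invf_ge1 //.
  by apply: t_ge1 tk'; rewrite invr_gt0.
have qAB : q ^+ M * B%:R = A%:R.
  have qB : q ^+ M * B%:R != 0 by rewrite gt_eqF // mulr_gt0 ?exprn_gt0 ?ltr0n.
  by have := divfK qB A%:R; rewrite -/t t_unit mul1r.
pose a := `|numq q|%N; pose b := `|denq q|%N.
have aE : (a%:R : rat) = (numq q)%:~R by rewrite pmulrn gez0_abs // numq_ge0 ltW.
have bE : (b%:R : rat) = (denq q)%:~R by rewrite pmulrn gez0_abs.
have b0 : (0 < b)%N by rewrite absz_gt0 denq_neq0.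
have qab : q = a%:R / b%:R by rewrite aE bE divq_num_den.
have a0 : (0 < a)%N.
  by rewrite absz_gt0 numq_eq0 gt_eqF.
have co : coprime a b by exact: coprime_num_den.
have eAB : (a ^ M * B = b ^ M * A)%N.
  move: (A) (B) (M) qAB => A' B' M' qAB.
  apply/eqP; rewrite -(eqr_nat rat) !natrM !natrX -qAB qab exprMn exprVn.
  by apply/eqP; field; rewrite expf_neq0 // pnatr_eq0 -lt0n.
have vE l : prime l -> (M * logn l a + (M3 * logn l g3 + M4 * logn l g4) =
    M * logn l b + (M1 * logn l g1 + M2 * logn l g2))%N.
  move=> pl; have := congr1 (logn l) eAB.
  rewrite !lognM ?muln_gt0 ?expn_gt0 ?a0 ?b0 ?(g_gt0 _ _ G1) ?(g_gt0 _ _ G2) ?(g_gt0 _ _ G3) ?(g_gt0 _ _ G4) //.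
  by rewrite !lognX.
have co_l l : prime l -> (logn l a = 0 \/ logn l b = 0)%N.
  move=> pl; have [/eqP|] := posnP (logn l a); first by move/eqP; left.
  rewrite logn_gt0 mem_primes => /and3P[_ _ la]; right.
  apply/eqP; rewrite lognE pl b0 /=; case: ifP => // lb.
  have : (l %| gcdn a b)%N by rewrite dvdn_gcd la lb.
  by rewrite (eqP co) dvdn1 => /eqP l1; rewrite l1 in pl.
have tB g h Mi l : prime l -> (M = h * Mi)%N ->
   g = 1%N \/ (exists p e, [/\ prime p, g = p & h = (p ^ e * p.-1)%N]) ->
   (Mi * logn l g * l.-1 <= M)%N.
  move=> pl -> [->|[p [e [pp -> ->]]]]; first by rewrite logn1 muln0.
  rewrite logn_prime //; case: eqP => [->|_]; last by rewrite muln0.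
  rewrite muln1 mulnC leq_mul2r -[X in (X <= _)%N]mul1n leq_mul2r expn_gt0.
  by rewrite prime_gt0 //= !orbT.
have bound l (pl : prime l) := valuation_bound M0 (vE l pl) (co_l l pl)
  (tB g1 h1 M1 l pl erefl G1) (tB g2 h2 M2 l pl e2 G2)
  (tB g3 h3 M3 l pl e3 G3) (tB g4 h4 M4 l pl e4 G4).
have dvd12 d : (0 < d)%N -> (forall l, prime l -> logn l d * l.-1 <= 2)%N -> (d %| 12)%N.
  move=> d0 H; apply: dvdn_logn => // l pl; have := H l pl.
  have [l2|l2] := eqVneq l 2%N; first by rewrite l2 muln1.
  have [l3|l3] := eqVneq l 3%N; first by rewrite l3 /= (_ : logn 3%N 12%N = 1%N) //; lia.
  have l4 : l != 4%N by apply: contraTneq pl => ->.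
  by have := prime_gt1 pl; case: (logn l d) => // k; nia.
have a12 : (a %| 12)%N by apply: dvd12 => // l /bound[].
have b12 : (b %| 12)%N by apply: dvd12 => // l /bound[].
(* if [3] divides [a], then [z1] and [z2] have order [3], and [1 - z1], [1 - z2]
   contribute no factor [2] *)
have no6 : ~~ (6 %| a)%N.
  apply/negP => a6.
  have v2a : (0 < logn 2 a)%N by rewrite logn_gt0 mem_primes a0 (dvdn_trans _ a6).
  have v3a : (0 < logn 3 a)%N by rewrite logn_gt0 mem_primes a0 (dvdn_trans _ a6).
  have v3b : logn 3%N b = 0%N by case: (co_l 3%N isT) => // e; rewrite e in v3a.
  have v2b : logn 2%N b = 0%N by case: (co_l 2%N isT) => // e; rewrite e in v2a.
  have := vE 3%N isT; have := vE 2%N isT; rewrite v3b v2b !muln0 !add0n => E2 E3.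
  have := tB g1 h1 M1 3%N isT erefl G1; have := tB g2 h2 M2 3%N isT e2 G2.
  have excl g : (exists p, prime p /\ g = p) \/ g = 1%N -> logn 3%N g = 0%N \/ (logn 3 g = 1 /\ logn 2 g = 0)%N.
    case=> [[p [pp ->]]|->]; last by left; rewrite logn1.
    by rewrite !logn_prime //; have [<-|] := eqVneq 3%N p; [right|left].
  have g_pr g h : g = 1%N \/ (exists p e, [/\ prime p, g = p & h = (p ^ e * p.-1)%N]) -> (exists p, prime p /\ g = p) \/ g = 1%N.
    by case=> [|[p [e [pp -> _]]]]; [right|left; exists p].
  have X1 := excl _ (g_pr _ _ G1); have X2 := excl _ (g_pr _ _ G2).
  have Mv3 : (M <= M * logn 3 a)%N by rewrite leq_pmulr.
  have Mv2 : (M <= M * logn 2 a)%N by rewrite leq_pmulr.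
  clearbody M M1 M2 M3 M4.
  move: E2 E3; case: X1 => [X1|[X1 Y1]]; case: X2 => [X2|[X2 Y2]];
    rewrite ?X1 ?X2 ?muln0 ?muln1 ?addn0 ?add0n /=; [lia|lia|lia|].
  by rewrite Y1 Y2 !muln0; lia.
have ab : (b < a)%N by move: q1; rewrite qab ltr_pdivlMr ?ltr0n // mul1r ltr_nat.
have pairs : (all (fun a => all (fun b => [&& b < a, coprime a b & ~~ (6 %| a)] ==>
    ((a, b) \in [:: (4, 3); (3, 2); (2, 1); (3, 1); (4, 1)])) (divisors 12)) (divisors 12))%N.
  by [].
have ha : a \in divisors 12 by rewrite -dvdn_divisors.
have hb : b \in divisors 12 by rewrite -dvdn_divisors.
have := allP (allP pairs a ha) b hb; rewrite ab co no6 /= !inE qab.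
by do 4?[case/predU1P=> [[-> ->]|]] => [||||/eqP[-> ->]]; rewrite ?divr1 ?eqxx ?orbT.
Qed.
End CyclotomicValuation.

(** * Cross ratios of slopes *)

Section CrossRatio.
Variable R : realType.
Implicit Types (u v w : R[i]).

(** The cross ratio in homogeneous coordinates, for which vertical directions are no
    exception. *)
Definition det_ratio u1 u2 u3 u4 : R :=
  (cross u1 u3 * cross u2 u4) / (cross u2 u3 * cross u1 u4).

Lemma cross_ratioE u1 u2 u3 u4 :
  cross u1 u2 != 0 -> cross u1 u3 != 0 -> cross u1 u4 != 0 ->
  cross u2 u3 != 0 -> cross u2 u4 != 0 -> cross u3 u4 != 0 ->
  cross_ratio (slope u1) (slope u2) (slope u3) (slope u4) = det_ratio u1 u2 u3 u4.
Proof.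
case: u1 u2 u3 u4 => [x1 y1] [x2 y2] [x3 y3] [x4 y4].
rewrite /det_ratio /cross /slope /=.
have nz (x x' y y' : R) : x * y' - y * x' != 0 -> x = 0 -> x' != 0.
  by move=> + e; rewrite e; apply: contra_neq => ->; ring.
have fact (x x' y y' : R) : x != 0 -> x' != 0 ->
    y' / x' - y / x = (x * y' - y * x') / (x * x').
  by move=> x0 x0'; field; rewrite x0 x0'.
move=> h12 h13 h14 h23 h24 h34.
case: (eqVneq x1 0) => [e|n1].
  have n2 := nz _ _ _ _ h12 e; have n3 := nz _ _ _ _ h13 e; have n4 := nz _ _ _ _ h14 e.
  move: h12 h13 h14; rewrite (negPf n2) (negPf n3) (negPf n4) e /= !mul0r !sub0r !oppr_eq0 !mulf_eq0 !negb_or.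
  move=> /andP[y1n _] _ _; rewrite !fact //; field.
  by rewrite h23 n2 n3 n4 y1n.
case: (eqVneq x2 0) => [e|n2].
  have n3 := nz _ _ _ _ h23 e; have n4 := nz _ _ _ _ h24 e.
  move: h12 h23 h24; rewrite (negPf n3) (negPf n4) e /= !mul0r !sub0r !oppr_eq0 !mulf_eq0 !negb_or.
  move=> _ /andP[y2n _] _; rewrite !fact //; field.
  by rewrite h14 n1 n3 n4 y2n.
case: (eqVneq x3 0) => [e|n3].
  have n4 := nz _ _ _ _ h34 e.
  move: h13 h23 h34; rewrite (negPf n4) e /= !mulr0 !mul0r !subr0 !sub0r !oppr_eq0 !mulf_eq0 !negb_or.
  move=> /andP[_ y3n] _ _; rewrite !fact //; field.
  by rewrite h14 n1 n2 n4 y3n.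
case: (eqVneq x4 0) => [e|n4].
  move: h14 h24 h34; rewrite e /= !mulr0 !subr0 !mulf_eq0 !negb_or.
  move=> /andP[_ y4n] _ _; rewrite !fact //; field.
  by rewrite h23 n1 n2 n3 y4n.
rewrite /= !fact //; field.
by rewrite h23 h14 n1 n2 n3 n4.
Qed.

Lemma angleP u : u != 0 -> 0 <= angle u < pi /\
  exists2 k : R, k != 0 & u = k%:C * cis (angle u).
Proof.
move=> u0; rewrite /angle; case: xgetP => [t _ [t01 [k k0 uk]]|no].
  by split => //; exists k.
have [r [a [r0 /andP[a0 a2] ur]]] := polar u0.
have [a_lt|a_ge] := ltP a pi.
  case: (no a); split; first by rewrite a0.
  by exists r => //; rewrite gt_eqF.
case: (no (a - pi)); split; first by apply/andP; split; lra.
exists (- r); first by rewrite oppr_eq0 gt_eqF.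
rewrite ur -[a in LHS](subrK pi) cisDpi mulrN -mulNr.
by congr (_ * _); apply: complex_ext; rewrite !complex_lin /= ?oppr0.
Qed.

Lemma cross_angle u v : u != 0 -> v != 0 -> exists2 k : R, k != 0 &
  cross u v = k * sin (angle v - angle u).
Proof.
move=> /angleP[_ [k k0 uE]] /angleP[_ [l l0 vE]]; exists (k * l); first exact: mulf_neq0.
by rewrite {1}uE {1}vE crossZl crossZr cross_cis mulrA.
Qed.

(** By the Pluecker relation, the numerator exceeds the denominator by the product of
    the other two determinants, which are positive for vectors of increasing
    angles. *)
Lemma det_ratio_gt1 u1 u2 u3 u4 : u1 != 0 -> u2 != 0 -> u3 != 0 -> u4 != 0 ->
  angle u1 < angle u2 -> angle u2 < angle u3 -> angle u3 < angle u4 ->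
  1 < det_ratio u1 u2 u3 u4.
Proof.
move=> /angleP[/andP[a1 b1] [k1 k10 e1]] /angleP[/andP[a2 b2] [k2 k20 e2]].
move=> /angleP[/andP[a3 b3] [k3 k30 e3]] /angleP[/andP[a4 b4] [k4 k40 e4]] h12 h23 h34.
move: (angle u1) (angle u2) (angle u3) (angle u4) a1 a2 a3 a4 b1 b2 b3 b4 e1 e2 e3 e4 h12 h23 h34.
move=> t1 t2 t3 t4 a1 a2 a3 a4 b1 b2 b3 b4 -> -> -> -> h12 h23 h34.
have sp (x y : R) : x < y -> y < x + pi -> 0 < cross (cis x) (cis y).
  by move=> xy yx; rewrite cross_cis sin_gt0_pi //; lra.
have s12 := sp t1 t2; have s13 := sp t1 t3; have s14 := sp t1 t4.
have s23 := sp t2 t3; have s24 := sp t2 t4; have s34 := sp t3 t4.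
rewrite /det_ratio !crossZl !crossZr.
have pl := cross_plucker (cis t1) (cis t2) (cis t3) (cis t4).
have {}s12 : 0 < cross (cis t1) (cis t2) by apply: s12; lra.
have {}s34 : 0 < cross (cis t3) (cis t4) by apply: s34; lra.
have {}s23 : 0 < cross (cis t2) (cis t3) by apply: s23; lra.
have {}s14 : 0 < cross (cis t1) (cis t4) by apply: s14; lra.
have -> : k1 * (k3 * cross (cis t1) (cis t3)) * (k2 * (k4 * cross (cis t2) (cis t4))) /
   (k2 * (k3 * cross (cis t2) (cis t3)) * (k1 * (k4 * cross (cis t1) (cis t4)))) =
   (cross (cis t1) (cis t3) * cross (cis t2) (cis t4)) / (cross (cis t2) (cis t3) * cross (cis t1) (cis t4)).
  by field; rewrite k10 k20 k30 k40 (gt_eqF s23) (gt_eqF s14).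
by rewrite ltr_pdivlMr ?mulr_gt0 // mul1r pl ltrDr mulr_gt0.
Qed.

Lemma angle_inj u v : u != 0 -> v != 0 -> angle u = angle v -> parallel u v.
Proof.
move=> u0 v0 uv; apply/parallelP => //; have [k _ ->] := cross_angle u0 v0.
by rewrite uv subrr sin0 mulr0.
Qed.

(** The chord between two points of the unit circle has the length of a sine and is
    perpendicular to their bisector; thus ratios of sines become ratios of differences
    of roots of unity. *)
Lemma cis_sub (a b : R) : cis (2 * b) - cis (2 * a) = (0 -i* 2) * (sin (a - b))%:C * cis (a + b).
Proof.
have -> : 2 * b = (a + b) + - (a - b) by ring.
have -> : 2 * a = (a + b) + (a - b) by ring.
rewrite (cisD (a + b) (a - b)) (cisD (a + b) (- (a - b))) [RHS]mulrC -mulrBr.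
by congr (_ * _); apply: complex_ext; rewrite ?ReM ?ImM !complex_lin /= ?cosN ?sinN; ring.
Qed.

Lemma ratr_complex (q : rat) : ratr q = (ratr q)%:C :> R[i].
Proof. by rewrite -[RHS]/(real_complex R (ratr q)) fmorph_rat. Qed.

(** Linear maps multiply all the determinants by one factor, so the cross ratio is
    the quotient [sin * sin / (sin * sin)] at differences of multiples of [pi / N].
    By [cis_sub] each sine is, up to factors that cancel, a number [1 - z] with [z]
    an [N]-th root of unity. *)
Theorem sines_ratio_N1 (V W : R[i]) (N : nat) (U : {fset R[i]}) u1 u2 u3 u4 (q : rat) :
  (0 < N)%N -> cross V W != 0 ->
  (forall u, u \in U -> exists s : nat,
      cos (pi * s%:R / N%:R) * cross u V = sin (pi * s%:R / N%:R) * cross u W) ->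
  u1 \in U -> u2 \in U -> u3 \in U -> u4 \in U ->
  u1 != 0 -> u2 != 0 -> u3 != 0 -> u4 != 0 ->
  cross u1 u3 != 0 -> cross u2 u4 != 0 -> cross u2 u3 != 0 -> cross u1 u4 != 0 ->
  det_ratio u1 u2 u3 u4 = ratr q -> 1 < ratr q :> R ->
  ratr q \in N1 R.
Proof.
move=> N0 VW sP U1 U2 U3 U4 u10 u20 u30 u40 c13 c24 c23 c14 dq q1.
pose al (s : nat) : R := pi * s%:R / N%:R.
have repr u : u \in U -> u != 0 -> exists s (k : R), k != 0 /\
    u = k%:C * ((sin (al s))%:C * W + (- cos (al s))%:C * V).
  move=> Uu u0; have [s sE] := sP u Uu.
  set X := (sin (al s))%:C * W + (- cos (al s))%:C * V.
  have uX : cross u X = 0 by rewrite /X crossDr !crossZr -sE; ring.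
  have [k Xk] := cross_eq0 u0 uX.
  have k0 : k != 0.
    apply/eqP => k0; have := cos2Dsin2 (al s); have X0 : X = 0 by rewrite Xk k0 mul0r.
    have := congr1 (cross V) X0; have := congr1 (cross W) X0.
    rewrite !cross0r /X !crossDr !crossZr !crossxx !mulr0 addr0 add0r => /eqP.
    rewrite mulf_eq0 oppr_eq0 crossC oppr_eq0 (negPf VW) orbF => /eqP -> /eqP.
    by rewrite mulf_eq0 (negPf VW) orbF => /eqP ->; rewrite expr0n addr0 => /esym/eqP; rewrite oner_eq0.
  exists s, k^-1; rewrite invr_eq0; split => //.
  by rewrite -/X Xk mulrA -rmorphM /= mulVf // mul1r.
have crossE' s s' : cross ((sin (al s))%:C * W + (- cos (al s))%:C * V)
    ((sin (al s'))%:C * W + (- cos (al s'))%:C * V) = sin (al s - al s') * cross V W.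
  by rewrite cross_det sinB (crossC W); ring.
have [s1 [k1 [k10 e1]]] := repr u1 U1 u10; have [s2 [k2 [k20 e2]]] := repr u2 U2 u20.
have [s3 [k3 [k30 e3]]] := repr u3 U3 u30; have [s4 [k4 [k40 e4]]] := repr u4 U4 u40.
move: c13 c24 c23 c14 dq; rewrite e1 e2 e3 e4 /det_ratio !crossZl !crossZr !crossE'.
rewrite !mulf_eq0 !negb_or => /and3P[_ _ /andP[n13 _]] /and3P[_ _ /andP[n24 _]].
move=> /and3P[_ _ /andP[n23 _]] /and3P[_ _ /andP[n14 _]] dq.
pose w (s : nat) := cis (2 * al s).
have wN s : w s ^+ N = 1.
  rewrite -[RHS](cis0 R) -[in RHS](cisD2pi _ s) /w -cis_mulrn -mulr_natr.
  by congr cis; rewrite /al; field; rewrite pnatr_eq0 -lt0n.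
have w0 s : w s != 0 by exact: cis_neq0.
have zN s s' : (w s / w s') ^+ N = 1 by rewrite expr_div_n !wN divr1.
have wB s s' : w s' - w s = (0 -i* 2) * (sin (al s - al s'))%:C * cis (al s + al s').
  exact: cis_sub.
have i20 : (0 -i* 2 : R[i]) != 0 by rewrite eq_complex /= oppr_eq0 pnatr_eq0 andbF.
have z1 s s' : sin (al s - al s') != 0 -> w s / w s' != 1.
  move=> ss; rewrite -subr_eq0 -(divff (w0 s')) -mulrBl mulf_neq0 ?invr_eq0 //.
  rewrite -oppr_eq0 opprB wB !mulf_neq0 ?cis_neq0 //.
  by rewrite eq_complex /= eqxx andbT.
have q1' : 1 < q by move: q1; rewrite -(ltr_rat R) rmorph1.
have qE : ratr q * ((1 - w s2 / w s3) * (1 - w s1 / w s4)) =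
    (1 - w s1 / w s3) * (1 - w s2 / w s4).
  have sub1 a b : 1 - w a / w b = (w b - w a) / w b by rewrite mulrBl divff.
  rewrite !sub1 !wB ratr_complex.
  have e5 : (sin (al s1 - al s3))%:C * (sin (al s2 - al s4))%:C =
     (ratr q)%:C * ((sin (al s2 - al s3))%:C * (sin (al s1 - al s4))%:C) :> R[i].
    rewrite -!rmorphM -dq; congr (_%:C); field.
    by rewrite k10 k20 k30 k40 VW n23 n14.
  have e6 : cis (al s1 + al s3) * cis (al s2 + al s4) =
      cis (al s2 + al s3) * cis (al s1 + al s4).
    by rewrite -!cisD; congr cis; ring.
  have rearr (p a b c d e f : R[i]) : p * (((0 -i* 2) * a * b * e) * ((0 -i* 2) * c * d * f)) =
     (0 -i* 2) ^+ 2 * (p * (a * c)) * (b * d) * e * f.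
    by ring.
  rewrite rearr -e5 -e6 -[RHS]mul1r rearr mul1r.
  by [].
have := rational_cyclotomic_ratio N0 (zN _ _) (zN _ _) (zN _ _) (zN _ _)
  (z1 _ _ n13) (z1 _ _ n24) (z1 _ _ n23) (z1 _ _ n14) q1' qE.
rewrite /N1 !inE => h.
have E (p : rat) (x : R) : ratr p = x -> (q == p) -> ratr q == x.
  by move=> <- /eqP ->.
have E2 (a b : nat) : (ratr (a%:R / b%:R) = a%:R / b%:R :> R).
  by rewrite fmorph_div /= !ratr_nat.
case/or4P: h => [h|h|h|/orP[h|h]]; apply/or4P.
- by apply: Or41; apply: E h; exact: (E2 4 3).
- by apply: Or42; apply: E h; exact: (E2 3 2).
- by apply: Or43; apply: E h; exact: (ratr_nat _ 2).
- by apply: Or44; apply/orP; left; apply: E h; exact: (ratr_nat _ 3).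
- by apply: Or44; apply/orP; right; apply: E h; exact: (ratr_nat _ 4).
Qed.
End CrossRatio.

(** * Determination by four and by seven directions *)

Section Determination.
Variables (R : realType) (n : nat).
Implicit Types (u v : R[i]) (U : {fset R[i]}).

Lemma direction_neq0 u : direction u -> u != 0.
Proof. by move=> u1; rewrite -normr_eq0 u1 oner_eq0. Qed.

Lemma nonparallel_cross U u v : (forall u, u \in U -> u != 0) ->
  pairwise_nonparallel U -> u \in U -> v \in U -> u != v -> cross u v != 0.
Proof.
move=> U0 np Uu Uv uv; apply/eqP => c0; apply: (np u v Uu Uv uv).
by apply/parallelP; rewrite ?U0.
Qed.

Lemma angle_sorted U : (forall u, u \in U -> u != 0) -> pairwise_nonparallel U ->
  exists s : seq R[i], [/\ uniq s, s =i U, size s = #|` U| &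
    forall i j, (i < j < size s)%N -> angle (nth 0 s i) < angle (nth 0 s j)].
Proof.
move=> U0 np; pose le u v := angle u <= angle v.
have le_total : total le by move=> u v; exact: le_total.
have le_trans : transitive le by move=> v u w; exact: le_trans.
exists (sort le (enum_fset U)); have us : uniq (sort le (enum_fset U)) by rewrite sort_uniq fset_uniq.
split => //; [by move=> u; rewrite mem_sort|by rewrite size_sort|].
move=> i j /andP[ij js]; have is_ := ltn_trans ij js.
have := sorted_ltn_nth le_trans 0 (sort_sorted le_total (enum_fset U)).
move/(_ i j is_ js ij); rewrite /le le_eqVlt => /predU1P[e|//].
have Ui := mem_nth 0 is_; have Uj := mem_nth 0 js; rewrite !mem_sort in Ui Uj.
have ne : nth 0 (sort le (enum_fset U)) i != nth 0 (sort le (enum_fset U)) j.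
  by rewrite nth_uniq // neq_ltn ij.
by case: (np _ _ Ui Uj ne); apply: angle_inj => //; exact: U0.
Qed.

Section FourDirections.
Variables (U : {fset R[i]}) (S : set R[i]) (F F' : {fset R[i]}).
Hypothesis UQ : U4Q n U.
Hypothesis SF : convex_subsets S F.
Hypothesis SF' : convex_subsets S F'.
Hypothesis FF' : F <> F'.
Hypothesis UX : {in U, forall u, Xray (u := u) F = Xray F'}.

Lemma U4Q_neq0 u : u \in U -> u != 0.
Proof. by case: UQ => _ h _ _ /h[/direction_neq0]. Qed.

Lemma U4Q_cross u v : u \in U -> v \in U -> u != v -> cross u v != 0.
Proof. by apply: nonparallel_cross; [exact: U4Q_neq0|case: UQ]. Qed.

Lemma angle_lt_neq u v : angle u < angle v -> u != v.
Proof. by apply: contraTneq => ->; rewrite ltxx. Qed.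

Lemma U4Q_cross_ratioE u1 u2 u3 u4 : u1 \in U -> u2 \in U -> u3 \in U -> u4 \in U ->
  uniq [:: u1; u2; u3; u4] ->
  cross_ratio (slope u1) (slope u2) (slope u3) (slope u4) = det_ratio u1 u2 u3 u4.
Proof.
move=> U1 U2 U3 U4; rewrite /= !inE !negb_or !andbT.
move=> /and3P[/and3P[? ? ?] /andP[? ?] ?].
by apply: cross_ratioE; apply: U4Q_cross.
Qed.

(** Here [same_Xray_sines] and [sines_ratio_N1] meet: all the cross ratios of
    directions in increasing order are in the exceptional list. *)
Lemma ordered_det_ratio_N1 u1 u2 u3 u4 :
  u1 \in U -> u2 \in U -> u3 \in U -> u4 \in U ->
  angle u1 < angle u2 -> angle u2 < angle u3 -> angle u3 < angle u4 ->
  1 < det_ratio u1 u2 u3 u4 /\ det_ratio u1 u2 u3 u4 \in N1 R.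
Proof.
move=> U1 U2 U3 U4 h12 h23 h34.
have n0 := U4Q_neq0.
have gt1 := det_ratio_gt1 (n0 _ U1) (n0 _ U2) (n0 _ U3) (n0 _ U4) h12 h23 h34.
split => //.
have n12 := angle_lt_neq h12; have n23 := angle_lt_neq h23; have n34 := angle_lt_neq h34.
have n13 := angle_lt_neq (lt_trans h12 h23); have n24 := angle_lt_neq (lt_trans h23 h34).
have n14 := angle_lt_neq (lt_trans (lt_trans h12 h23) h34).
have uq : uniq [:: u1; u2; u3; u4] by rewrite /= !inE !negb_or n12 n13 n14 n23 n24 n34.
have [q] : exists q : rat, cross_ratio (slope u1) (slope u2) (slope u3) (slope u4) = ratr q.
  by case: UQ => _ _ _; apply.
rewrite U4Q_cross_ratioE // => qE; rewrite qE in gt1 *.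
have [V [W [N [N0 VW sP]]]] := same_Xray_sines SF SF' FF' UX U4Q_neq0 U1 U2 (U4Q_cross U1 U2 n12).
by apply: (sines_ratio_N1 N0 VW sP U1 U2 U3 U4) qE gt1; rewrite ?n0 ?U4Q_cross.
Qed.
End FourDirections.

Theorem four_directions_determine U S : U4Q n U -> #|` U| = 4%N ->
  ordered_cross_ratio_notin_N1 U -> determined (convex_subsets S) U.
Proof.
move=> UQ U4 notN1 F F' SF SF' UX; apply: contrapT => FF'.
have [s [us sU]] := angle_sorted (@U4Q_neq0 U UQ) (let: And4 _ _ h _ := UQ in h).
rewrite U4; case: s us sU => [|u1 [|u2 [|u3 [|u4 [|]]]]] // us sU _ ang.
have h12 := ang 0%N 1%N isT; have h23 := ang 1%N 2%N isT; have h34 := ang 2%N 3%N isT.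
have mU u : u \in [:: u1; u2; u3; u4] -> u \in U by rewrite sU.
have [U1 U2 U3 U4'] : [/\ u1 \in U, u2 \in U, u3 \in U & u4 \in U].
  by split; apply: mU; rewrite !inE eqxx ?orbT.
have UE : U = [fset u1; u2; u3; u4]%fset.
  apply/fsetP => u; rewrite -sU !inE; case: (u == u1) => //=.
  by case: (u == u2) => //=; case: (u == u3).
have := notN1 u1 u2 u3 u4 UE h12 h23 h34; rewrite (U4Q_cross_ratioE UQ) //.
by rewrite (ordered_det_ratio_N1 UQ SF SF' FF' UX U1 U2 U3 U4' h12 h23 h34).2.
Qed.

(** Exactly one of the five numbers is left out. *)
Lemma N1_increasing4 (x y z w : R) : x \in N1 R -> y \in N1 R -> z \in N1 R -> w \in N1 R ->
  x < y -> y < z -> z < w -> (x = 4 / 3 /\ 3 <= w) \/ (x = 3 / 2 /\ w = 4).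
Proof.
rewrite /N1 !inE => hx hy hz hw xy yz zw.
case/or4P: hx xy => [/eqP->|/eqP->|/eqP->|/orP[/eqP->|/eqP->]] xy;
case/or4P: hy xy yz => [/eqP->|/eqP->|/eqP->|/orP[/eqP->|/eqP->]] xy yz; try lra;
case/or4P: hz yz zw => [/eqP->|/eqP->|/eqP->|/orP[/eqP->|/eqP->]] yz zw; try lra;
case/or4P: hw zw => [/eqP->|/eqP->|/eqP->|/orP[/eqP->|/eqP->]] zw; try lra;
by (left + right); split; lra.
Qed.

(** [A l] is the projective coordinate of [u l] for which [u 0], [u 1] and [u 2] have
    coordinates infinity, 0 and 1.  If the sets were different, then [A 3] to [A 6]
    would increase in the exceptional list, which forces the cross ratio
    [(A 6 - 1) / (A 3 - 1)] of [u 0], [u 2], [u 3], [u 6] to be at least 6; but it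
    is in the list as well. *)
Theorem seven_directions_determine U S : U4Q n U -> #|` U| = 7%N ->
  determined (convex_subsets S) U.
Proof.
move=> UQ U7 F F' SF SF' UX; apply: contrapT => FF'.
have [s [us sU ss ang]] := angle_sorted (@U4Q_neq0 U UQ) (let: And4 _ _ h _ := UQ in h).
rewrite U7 in ss; pose u i := nth 0 s i.
have Uu i : (i < 7)%N -> u i \in U by move=> i7; rewrite -sU mem_nth // ss.
have an i j : (i < j < 7)%N -> angle (u i) < angle (u j) by rewrite -ss; exact: ang.
have c0 i j : (i < j < 7)%N -> cross (u i) (u j) != 0.
  move=> ij; apply: (U4Q_cross UQ); first by apply: Uu; lia.
    by apply: Uu; lia.
  exact: angle_lt_neq (an _ _ ij).
have dN i j k l : (i < j)%N -> (j < k)%N -> (k < l < 7)%N ->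
    1 < det_ratio (u i) (u j) (u k) (u l) /\ det_ratio (u i) (u j) (u k) (u l) \in N1 R.
  by move=> *; apply: (ordered_det_ratio_N1 UQ SF SF' FF' UX); (apply: Uu || apply: an); lia.
pose A l := det_ratio (u 0%N) (u 1%N) (u 2%N) (u l).
have AE k l : (2 < k)%N -> (k < l < 7)%N ->
    det_ratio (u 0%N) (u 2%N) (u k) (u l) * (A k - 1) = A l - 1.
  move=> k2 kl.
  have plk := cross_plucker (u 0%N) (u 1%N) (u 2%N) (u k).
  have pll := cross_plucker (u 0%N) (u 1%N) (u 2%N) (u l).
  have n12 := c0 1%N 2%N isT.
  have n0k : cross (u 0%N) (u k) != 0 by apply: c0; lia.
  have n0l : cross (u 0%N) (u l) != 0 by apply: c0; lia.
  have n2k : cross (u 2%N) (u k) != 0 by apply: c0; lia.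
  have AE' j : cross (u 0%N) (u j) != 0 ->
      A j - 1 = cross (u 0%N) (u 1%N) * cross (u 2%N) (u j) / (cross (u 1%N) (u 2%N) * cross (u 0%N) (u j)).
    move=> n0j; rewrite /A /det_ratio cross_plucker; field.
    by rewrite n12 n0j.
  rewrite !AE' // /det_ratio; field.
  by rewrite n12 n0k n0l n2k.
have A1 k : (2 < k < 7)%N -> 1 < A k by move=> k2; have [] := dN 0%N 1%N 2%N k isT isT k2.
have AN k : (2 < k < 7)%N -> A k \in N1 R by move=> k2; have [] := dN 0%N 1%N 2%N k isT isT k2.
have Alt k l : (2 < k)%N -> (k < l < 7)%N -> A k < A l.
  move=> k2 kl; have [d1 _] := dN 0%N 2%N k l isT k2 kl.
  have Ak : 1 < A k by apply: A1; lia.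
  have := AE k l k2 kl; nra.
have A36 := N1_increasing4 (AN 3%N isT) (AN 4%N isT) (AN 5%N isT) (AN 6%N isT)
  (Alt 3%N 4%N isT isT) (Alt 4%N 5%N isT isT) (Alt 5%N 6%N isT isT).
have [_] := dN 0%N 2%N 3%N 6%N isT isT isT; have := AE 3%N 6%N isT isT.
rewrite /N1 !inE => e; case/or4P => [/eqP d|/eqP d|/eqP d|/orP[/eqP d|/eqP d]];
  rewrite d in e; case: A36 => [[A3 A6]|[A3 A6]]; rewrite A3 in e; clear -e A6; lra.
Qed.
End Determination.

(** * Small values and interpolation of integer polynomials *)

Section SmallValues.
Variable R : realType.
Implicit Types (p : {poly int}) (y z : R[i]).

Definition ev p z : R[i] := (map_poly intr p).[z].

Definition coord (b : bool) z : R := if b then complex.Re z else complex.Im z.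

Lemma coordD b y z : coord b (y + z) = coord b y + coord b z.
Proof. by case: b; rewrite /coord ?ReD ?ImD. Qed.
Lemma coordN b z : coord b (- z) = - coord b z.
Proof. by case: b; rewrite /coord ?ReN ?ImN. Qed.

(** The norm of [R[i]] takes its values in [R[i]], whence the embeddings of real
    bounds below. *)
Lemma norm_coord b z : `|coord b z|%:C <= `|z|.
Proof.
case: b => /=; first exact: normc_ge_Re.
have := normc_ge_Re (z * 'i); rewrite ReiNIm normrN normrM.
suff -> : `|'i%C| = 1 :> R[i] by rewrite mulr1.
by rewrite normc_def /= expr0n expr1n add0r sqrtr1.
Qed.

Lemma norm_le_coord z : `|z| <= (`|coord true z| + `|coord false z|)%:C.
Proof.
rewrite {1}[z]complexE; apply: le_trans (ler_normD _ _) _.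
rewrite normrM; have -> : `|'i%C| = 1 :> R[i].
  by rewrite normc_def /= expr0n expr1n add0r sqrtr1.
have nC (k : R) : `|k%:C| = `|k|%:C :> R[i].
  by rewrite normc_def /= expr0n addr0 sqrtr_sqr.
by rewrite mul1r !nC rmorphD.
Qed.

Lemma evD p q z : ev (p + q) z = ev p z + ev q z.
Proof. by rewrite /ev rmorphD hornerD. Qed.
Lemma evB p q z : ev (p - q) z = ev p z - ev q z.
Proof. by rewrite /ev rmorphB hornerD hornerN. Qed.
Lemma evM p q z : ev (p * q) z = ev p z * ev q z.
Proof. by rewrite /ev rmorphM hornerM. Qed.

Lemma ev_wide m p z : (size p <= m)%N -> ev p z = \sum_(i < m) (p`_i)%:~R * z ^+ i.
Proof.
move=> pm; rewrite /ev (@horner_coef_wide _ m); last first.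
  by rewrite size_map_inj_poly //; exact: intr_inj.
by apply: eq_bigr => i _; rewrite coef_map.
Qed.

Lemma norm_ev_le m p z (B : R[i]) : `|z| <= 1 -> (size p <= m)%N ->
  (forall i, (i < m)%N -> `|(p`_i)%:~R| <= B) -> `|ev p z| <= B *+ m.
Proof.
move=> z1 pm pB; rewrite (ev_wide _ pm) (le_trans (ler_norm_sum _ _ _)) //.
rewrite -[m in B *+ m]card_ord -sumr_const; apply: ler_sum => i _.
rewrite normrM normrX -[B]mulr1 ler_pM ?normr_ge0 ?exprn_ge0 ?pB //.
by rewrite exprn_ile1.
Qed.

(** Dirichlet's box principle: the [2 s] real coordinates of the values at [s]
    points are made small by [2 s + 1] integer coefficients. *)
Lemma small_values (s : nat) (y : 'I_s -> R[i]) (e : R) :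
  (forall j, `|y j| <= 1) -> 0 < e ->
  exists p, [/\ p != 0, (size p <= s.*2.+1)%N &
    forall j b, `|coord b (ev p (y j))| <= e].
Proof.
move=> y1 e0; set K := s.*2.+1.
have [q q0 qe] : exists2 q : nat, (0 < q)%N & 1 <= e * q%:R.
  exists (Num.trunc e^-1).+1 => //; rewrite mulrC -ler_pdivrMr // div1r.
  exact: ltW (truncnS_gt _).
pose c := (2 * K * q + 1)%N; pose M := (c ^ s.*2).+1.
have cM0 : (0 < c * M)%N by rewrite muln_gt0 /c addn1.
pose P (f : {ffun 'I_K -> 'I_M}) : {poly int} := \poly_(i < K) (if insub i is Some k then (f k : nat)%:Z else 0).
have Pcoef f (k : 'I_K) : (P f)`_k = (f k : nat)%:Z.
  by rewrite coef_poly ltn_ord valK.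
have Psize f : (size (P f) <= K)%N by exact: size_poly.
have Pnorm f j : `|ev (P f) (y j)| <= (K * M)%:R.
  rewrite mulnC natrM mulr_natr; apply: norm_ev_le => // i iK.
  by rewrite (Pcoef f (Ordinal iK)) ger0_norm ?ler0n // -pmulrn ler_nat ltnW.
have Pcoord f j b : 0 <= coord b (ev (P f) (y j)) + (K * M)%:R <= 2 * (K * M)%:R.
  have := le_trans (norm_coord b _) (Pnorm f j).
  rewrite -(rmorph_nat (real_complex R)) lecR ler_norml => /andP[h1 h2].
  by apply/andP; split; lra.
pose box f j b := Num.trunc ((coord b (ev (P f) (y j)) + (K * M)%:R) * q%:R).
have boxP f j b : (box f j b < c * M)%N.
  have /andP[h1 h2] := Pcoord f j b.
  rewrite /box truncn_lt_nat ?mulr_ge0 ?ler0n //.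
  apply: le_lt_trans (_ : 2 * (K * M)%:R * q%:R < _).
    by rewrite ler_wpM2r ?ler0n.
  rewrite -!natrM ltr_nat /c; have : (0 < M)%N by [].
  by move: (M) => m m0; lia.
pose G f : {ffun 'I_s * bool -> 'I_(c * M)} := [ffun jb => Ordinal (boxP f jb.1 jb.2)].
have [f1 [f2 [f12 G12]]] : exists f1 f2, f1 <> f2 /\ G f1 = G f2.
  apply: contrapT => H; have /leq_card : injective G.
    by move=> f1 f2 G12; apply: contrapT => ne; apply: H; exists f1, f2.
  rewrite !card_ffun card_prod !card_ord card_bool muln2 leqNgt => /negP; apply.
  by rewrite expnMn expnS ltn_pmul2r ?expn_gt0 // /M ltnS.
exists (P f1 - P f2); split.
- apply/eqP => /eqP; rewrite subr_eq0 => /eqP P12; apply: f12; apply/ffunP => k.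
  by apply: val_inj; have := Pcoef f1 k; rewrite P12 Pcoef => -[].
- by rewrite (leq_trans (size_polyD _ _)) // size_polyN geq_max !Psize.
- move=> j b; rewrite evB coordD coordN.
  have /(congr1 val)/= := congr1 (fun g : {ffun 'I_s * bool -> 'I_(c * M)} => g (j, b)) G12.
  rewrite !ffunE /= /box => E.
  have /andP[h1 _] := Pcoord f1 j b; have /andP[h2 _] := Pcoord f2 j b.
  have := truncn_itv (mulr_ge0 h1 (ler0n _ q)); have := truncn_itv (mulr_ge0 h2 (ler0n _ q)).
  rewrite E -natr1; move: (Num.trunc _)%:R => t /andP[u1 u2] /andP[u3 u4].
  have q0' : 0 < q%:R :> R by rewrite ltr0n.
  rewrite -(ler_pM2r q0'); apply: le_trans qe.
  rewrite -[X in _ * X](ger0_norm (ltW q0')) -normrM ler_norml; apply/andP; split; lra.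
Qed.

Lemma small_norms (s : nat) (y : 'I_s -> R[i]) (e : R) :
  (forall j, `|y j| <= 1) -> 0 < e ->
  exists p, [/\ p != 0, (size p <= s.*2.+1)%N & forall j, `|ev p (y j)| <= e%:C].
Proof.
move=> y1 e0; have [|p [p0 sp pe]] := @small_values s y (e / 2) y1; first by lra.
exists p; split => // j; apply: le_trans (norm_le_coord _) _; rewrite lecR.
by have := pe j true; have := pe j false; lra.
Qed.
End SmallValues.

Section Nodes.
Variables (R : realType) (d : nat) (w : 'I_d -> R[i]).
Hypothesis w_inj : injective w.
Hypothesis w_conj : forall i j, w i != conjc (w j).
Hypothesis w_norm : forall i, `|w i| <= 1.
Implicit Types (p a b : {poly int}) (z : R[i]).

(** The points [w i] and their conjugates together: integer or real polynomials take
    conjugate values at conjugate nodes, so [d] complex values amount to [2 d] real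
    coefficients. *)
Let node (k : bool * 'I_d) := if k.1 then w k.2 else conjc (w k.2).

Lemma node_inj : injective node.
Proof.
move=> [[] i] [[] j]; rewrite /node /=.
- by move=> /w_inj ->.
- by move=> e; have := w_conj i j; rewrite e eqxx.
- by move=> e; have := w_conj j i; rewrite e eqxx.
- by move=> /(can_inj (@conjcK R))/w_inj ->.
Qed.

Let lagrange k : {poly R[i]} :=
  \prod_(l | l != k) ((node k - node l)^-1 *: ('X - (node l)%:P)).

Let lagrangeE k l : (lagrange k).[node l] = (l == k)%:R.
Proof.
rewrite /lagrange horner_prod; have [->|lk] := eqVneq l k.
  rewrite big1 // => j jk; rewrite !hornerE mulVf // subr_eq0.
  by rewrite (inj_eq node_inj) eq_sym.
by rewrite (bigD1 l) //= !hornerE subrr mulr0 mul0r.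
Qed.

Let size_lagrange k : (size (lagrange k) <= d.*2)%N.
Proof.
apply: leq_trans (size_prod_leq _ _) _.
have cardT : (#|[pred l | l != k]|.+1 = d.*2)%N.
  have := cardC1 k; rewrite card_prod card_bool card_ord mul2n => e.
  rewrite (@eq_card _ _ (predC1 k)) // e prednK // -mul2n muln_gt0 /=.
  by case: k e => _ [i id] _; apply: leq_ltn_trans id.
rewrite -cardT; set m := #|_|; apply: (@leq_trans ((m * 2).+1 - m)%N); last by lia.
apply: leq_sub2r; rewrite ltnS /m -sum_nat_const; apply: leq_sum => l _.
by rewrite (leq_trans (size_scale_leq _ _)) // size_XsubC.
Qed.

Definition interpolant (t : bool * 'I_d -> R[i]) := \sum_k t k *: lagrange k.

Lemma interpolantE t k : (interpolant t).[node k] = t k.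
Proof.
rewrite /interpolant horner_sum (bigD1 k) //= hornerZ lagrangeE eqxx mulr1.
rewrite big1 ?addr0 // => l lk; rewrite hornerZ lagrangeE eq_sym (negPf lk) mulr0 //.
Qed.

Lemma size_interpolant t : (size (interpolant t) <= d.*2)%N.
Proof.
apply: leq_trans (size_sum _ _ _) _; apply/bigmax_leqP => k _.
exact: leq_trans (size_scale_leq _ _) (size_lagrange k).
Qed.

Lemma interpolant_unique (p : {poly R[i]}) : (size p <= d.*2)%N ->
  p = interpolant (fun k => p.[node k]).
Proof.
move=> sp; apply/eqP; rewrite -subr_eq0; apply/eqP.
apply: (@roots_geq_poly_eq0 _ _ [seq node k | k <- enum {: bool * 'I_d}]).
- apply/allP => _ /mapP[k _ ->].
  by rewrite /root hornerD hornerN interpolantE subrr.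
- by rewrite map_inj_uniq ?enum_uniq //; exact: node_inj.
- rewrite size_map -cardE card_prod card_bool card_ord mul2n.
  by rewrite (leq_trans (size_polyD _ _)) // size_polyN geq_max sp size_interpolant.
Qed.

Lemma ev_conj p z : ev p (conjc z) = conjc (ev p z).
Proof.
rewrite /ev -horner_map /= -map_poly_comp; congr (_.[_]).
by apply: eq_map_poly => k /=; rewrite rmorph_int.
Qed.

Let ev_node_norm p k : `|ev p (node k)| = `|ev p (w k.2)|.
Proof. by case: k => [[] i]; rewrite /node //= ev_conj normcJ. Qed.

(** Integer polynomials of bounded degree with bounded values at the nodes have
    bounded coefficients, by Lagrange interpolation. *)
Lemma finitely_many_bounded (B : R[i]) : 0 <= B -> exists s : seq {poly int}, forall p,
  (size p <= d.*2)%N -> (forall i, `|ev p (w i)| <= B) -> p \in s.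
Proof.
move=> B0; pose C := B * \sum_k \sum_(i < d.*2) `|(lagrange k)`_i|.
have C0 : 0 <= C by rewrite mulr_ge0 // !sumr_ge0 // => k _; rewrite sumr_ge0.
have [m mC] : exists m : nat, C <= m%:R.
  exists (Num.trunc (complex.Re C)).+1.
  rewrite -(RRe_real (ger0_real C0)) -(rmorph_nat (real_complex R)) lecR.
  exact: ltW (truncnS_gt _).
exists [seq \poly_(i < d.*2) (if insub i is Some k then ((f k : nat)%:Z - m%:Z) else 0)
       | f : {ffun 'I_d.*2 -> 'I_(m.*2.+1)}].
move=> p sp pB.
have coefB (i : 'I_d.*2) : (absz p`_i)%:R <= C.
  have sp' : (size (map_poly (intr : int -> R[i]) p) <= d.*2)%N.
    by rewrite size_map_inj_poly //; exact: intr_inj.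
  have -> : (absz p`_i)%:R = `|(map_poly intr p)`_i| :> R[i].
    by rewrite coef_map /= natr_absz intr_norm.
  rewrite (interpolant_unique sp') coef_sum (le_trans (ler_norm_sum _ _ _)) //.
  rewrite /C mulr_sumr; apply: ler_sum => k _.
  rewrite coefZ normrM ler_pM ?normr_ge0 //; first by rewrite -/(ev p _) ev_node_norm.
  by rewrite (bigD1 i) //= lerDl sumr_ge0.
have pm (i : 'I_d.*2) : (absz (p`_i)%R <= m)%N.
  by rewrite -(ler_nat R[i]); exact: le_trans (coefB i) mC.
have bnd (i : 'I_d.*2) : (absz (p`_i + m%:Z)%R < m.*2.+1)%N.
  by have := pm i; lia.
apply/mapP; exists [ffun i => Ordinal (bnd i)]; first by rewrite mem_enum.
apply/polyP => i; rewrite coef_poly; case: ltnP => id; last by rewrite nth_default // (leq_trans sp).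
rewrite insubT ffunE /=; have := pm (Ordinal id) => /=; lia.
Qed.

(** Data symmetric under conjugation are interpolated by a polynomial and by its
    conjugate, hence by their mean, which is real. *)
Lemma real_interpolation (y : 'I_d -> R[i]) : exists2 c : {poly R},
  (size c <= d.*2)%N & forall i, (map_poly (real_complex R) c).[w i] = y i.
Proof.
pose t (k : bool * 'I_d) := if k.1 then y k.2 else conjc (y k.2).
pose P := interpolant t; exists (\poly_(i < d.*2) complex.Re P`_i) => [|i].
  exact: size_poly.
have sP : (size P <= d.*2)%N by exact: size_interpolant.
have Py : P.[w i] = y i by have := interpolantE t (true, i).
have Pc : P.[conjc (w i)] = conjc (y i) by have := interpolantE t (false, i).
have {}Pc : (map_poly conjc P).[w i] = y i.
  by rewrite -[w i]conjcK -[LHS]/((map_poly conjc P).[conjc (conjc (w i))]) horner_map /= Pc conjcK.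
have e : map_poly (real_complex R) (\poly_(i < d.*2) complex.Re P`_i) = 2^-1 *: (P + map_poly conjc P).
  apply/polyP => j; rewrite coef_map coefZ coefD coef_map coef_poly /=.
  case: ltnP => jd; last by rewrite [P`_j]nth_default ?(leq_trans sP) // conjc0 addr0 mulr0.
  by rewrite ReJ_add mulrC.
by rewrite e hornerZ hornerD Py Pc -mulr2n -[y i *+ 2]mulr_natl mulKf // pnatr_eq0.
Qed.

(** Interpolate [y / a] with real coefficients and round them: the error is [a]
    times a polynomial with coefficients at most 1.  So the multiples of [a] have
    dense values when [a] has small ones. *)
Lemma values_dense a (y : 'I_d -> R[i]) : (forall i, ev a (w i) != 0) ->
  exists b, forall i, `|ev b (w i) - y i| <= `|ev a (w i)| *+ d.*2.
Proof.
move=> a0; have [c sc cE] := real_interpolation (fun i => y i / ev a (w i)).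
pose f : {poly int} := \poly_(i < d.*2) Num.floor c`_i.
exists (a * f) => i; rewrite evM.
have -> : ev a (w i) * ev f (w i) - y i =
    ev a (w i) * \sum_(j < d.*2) (((Num.floor c`_j)%:~R - c`_j)%:C * w i ^+ j).
  rewrite -[y i](divfK (a0 i)) -cE [X in _ - X]mulrC -mulrBr; congr (_ * _).
  rewrite (@ev_wide _ d.*2) ?size_poly // (@horner_coef_wide _ d.*2); last first.
    exact: leq_trans (size_poly _ _) sc.
  rewrite -sumrB; apply: eq_bigr => j _.
  rewrite coef_poly ltn_ord coef_map /= -mulrBl; congr (_ * _).
  by rewrite rmorphB rmorph_int.
rewrite normrM -[_ *+ d.*2]mulr_natr ler_wpM2l //; apply: le_trans (ler_norm_sum _ _ _) _.
rewrite -[X in _ <= X%:R]card_ord -sumr_const; apply: ler_sum => j _.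
rewrite normrM normrX mulr_ile1 ?normr_ge0 ?exprn_ge0 ?exprn_ile1 //.
rewrite normc_def /= expr0n addr0 sqrtr_sqr -[X in _ <= X]/(1%:C) lecR ler_norml.
by have := floor_itv c`_j; rewrite intrD; lra.
Qed.
End Nodes.

(** * The star map and model sets *)

Section Window.
Local Open Scope classical_set_scope.
Variables (R : realType) (n : nat).
Lemma window_ball (W : set (star_space R n)) : window W ->
  exists (y : 'I_(star_dim n) -> R[i]) (e : R), 0 < e /\
   forall v : star_space R n, (forall j, `|v 0 j - y j| < e%:C) -> W v.
Proof.
move=> [[v0 /nbhs_ballP[e e0 eW]] _ _ _].
have eE : e = (complex.Re e)%:C by rewrite RRe_real // gtr0_real.
exists (fun j => v0 0 j), (complex.Re e); split; first by move: e0; rewrite /= eE ltcR.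
move=> v vy; apply: eW; split=> // i j; rewrite /ball /= -eE in vy *.
by rewrite ord1 distrC.
Qed.
(** The balls of integer radius about 0 cover the compact closure of the interior. *)
Lemma window_bounded (W : set (star_space R n)) : window W ->
  exists B : R[i], 0 <= B /\ forall v, W v -> forall j, `|v 0 j| <= B.
Proof.
move=> [_ _ WW]; rewrite compact_cover => Wco.
pose U (m : nat) := ball (0 : star_space R n) (m%:R : R[i]).
have UP m v : U m v -> forall j, `|v 0 j| <= m%:R.
  by move=> [_ h] j; have := h 0 j; rewrite /ball /= mxE sub0r normrN => /ltW.
have covW : closure W° `<=` \bigcup_(m in [set: nat]) U m.
  move=> v _; pose c j := (Num.trunc (complex.Re `|v 0 j|)).+1.
  have vc j : `|v 0 j| < (c j)%:R.
    have nE : `|v 0 j| = (complex.Re `|v 0 j|)%:C by rewrite RRe_real // normr_real.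
    by rewrite nE -(rmorph_nat (real_complex R)) ltcR truncnS_gt.
  exists (\sum_j c j).+1 => //; split; first by rewrite ltr0n.
  move=> i j; rewrite /ball /= mxE sub0r normrN ord1.
  apply: lt_le_trans (vc j) _; rewrite ler_nat (bigD1 j) //=; lia.
have [m _|D _ cov] := Wco nat setT U _ covW; first exact: ball_open.
exists (\sum_(i <- D) i)%N%:R; split; first exact: ler0n.
move=> v /WW/cov[m mD /UP h] j; apply: le_trans (h j) _.
have {}mD : m \in enum_fset D by [].
by rewrite ler_nat (big_rem m) //= leq_addr.
Qed.
End Window.

Section ZetaFacts.
Local Open Scope classical_set_scope.
Variables (R : realType) (n : nat).
Hypothesis hn : (2 < n)%N.
Local Notation z := (zeta R n).

Lemma zetaE : z = cis (2 * pi / n%:R).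
Proof. by []. Qed.

Lemma zeta_primitive : n.-primitive_root z.
Proof.
have n0 : (0 < n)%N by lia.
have nR : (0 : R) < n%:R by rewrite ltr0n.
rewrite /primitive_root_of_unity n0 /=; apply/forallP => -[i i_n] /=.
rewrite unity_rootE; apply/eqP; have [->|ni] := eqVneq i.+1 n.
  rewrite zetaE -cis_mulrn -[_ *+ n]mulr_natr (_ : 2 * pi / _ * _ = 2 * pi) ?cis2pi ?eqxx //.
  by field; rewrite gt_eqF.
apply/negbTE; have sgt : 0 < sin (pi * i.+1%:R / n%:R : R).
  apply: sin_gt0_pi; rewrite divr_gt0 ?mulr_gt0 ?pi_gt0 ?ltr0n //=.
  by rewrite ltr_pdivrMr // ltr_pM2l ?pi_gt0 // ltr_nat ltn_neqAle ni.
rewrite zetaE -cis_mulrn -[_ *+ i.+1]mulr_natr; apply/eqP => e.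
have e2 := congr1 (@complex.Re R) e; rewrite /= in e2.
have : cos (pi * i.+1%:R / n%:R *+ 2 : R) = 1.
  by rewrite -[RHS]e2; congr cos; rewrite mulr2n; field; rewrite gt_eqF.
have := cos2Dsin2 (pi * i.+1%:R / n%:R : R); rewrite mulr2n cosD; nra.
Qed.

(** The other factors of [X ^ n - 1] do not vanish at a primitive root. *)
Lemma Cyclotomic_zeta : ev 'Phi_n z = 0.
Proof.
have n0 : (0 < n)%N by lia.
have evXn k (y : R[i]) : ev ('X^k - 1) y = y ^+ k - 1.
  by rewrite /ev rmorphB rmorph1 /= map_polyXn !hornerE.
have evE k (y : R[i]) : (0 < k)%N -> \prod_(d <- divisors k) ev 'Phi_d y = y ^+ k - 1.
  by move=> k0; rewrite -evXn -(prod_Cyclotomic k0) /ev rmorph_prod horner_prod.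
have /eqP := evE n z n0; rewrite (prim_expr_order zeta_primitive) subrr prodf_seq_eq0.
case/hasP => k; rewrite -dvdn_divisors // => kn /= kz.
have k0 := dvdn_gt0 n0 kn.
have : z ^+ k == 1.
  rewrite -subr_eq0 -evE // prodf_seq_eq0; apply/hasP; exists k => //.
  by rewrite -dvdn_divisors.
rewrite -(prim_order_dvd zeta_primitive) => nk.
have kn' : k = n by apply/eqP; rewrite eqn_dvd nk kn.
by rewrite -kn' in kz *; apply/eqP.
Qed.

(** The cyclotomic polynomial is irreducible over the rational numbers, being the
    minimal polynomial of a root of unity [y] in [algC]; a common root [zeta] with
    [p] makes their greatest common divisor non-constant. *)
Lemma rat_poly_vanish_zeta (p : {poly rat}) :
  (size p <= totient n)%N -> (map_poly ratr p).[z] = 0 -> p = 0.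
Proof.
move=> sp pz; have n0 : (0 < n)%N by lia.
have [y yprim] := C_prim_root_exists n0.
have [m [mE m_monic] mP] := minCpolyP y.
have mPhi : m = map_poly intr 'Phi_n.
  apply: (map_poly_inj (ratr : {rmorphism rat -> algC})).
  rewrite -mE (minCpoly_cyclotomic yprim) -(Cintr_Cyclotomic yprim) -map_poly_comp.
  by apply: eq_map_poly => k /=; rewrite ratr_int.
have sm : size m = (totient n).+1.
  by rewrite mPhi size_map_inj_poly ?size_Cyclotomic //; exact: intr_inj.
have mz : root (map_poly ratr m) z.
  have E : map_poly (ratr : rat -> R[i]) m = map_poly intr 'Phi_n.
    by rewrite mPhi -map_poly_comp; apply: eq_map_poly => k /=; rewrite ratr_int.
  rewrite E.
  exact/eqP/Cyclotomic_zeta.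
have m0 : m != 0 by rewrite -size_poly_eq0 sm.
pose G := gcdp p m.
have sG : (1 < size G)%N.
  rewrite ltnNge; apply/negP => sG.
  have : coprimep p m by rewrite /coprimep -/G eqn_leq sG /= size_poly_gt0 gcdp_eq0 negb_and m0 orbT.
  case/coprimepP/coprimepP=> //.
  case/Bezout_eq1_coprimepP => -[u v] /= /(congr1 (fun f => (map_poly (ratr : rat -> R[i]) f).[z])).
  rewrite rmorphD !rmorphM rmorph1 !hornerE pz (eqP mz) !mulr0 addr0 => /eqP.
  by rewrite eq_sym oner_eq0.
have [H mGH] := dvdpP _ _ (dvdp_gcdr p m).
have H0 : H != 0 by apply: contraNneq m0 => H0; rewrite mGH H0 mul0r.
have G0 : G != 0 by rewrite -size_poly_gt0 ltnW.
have ym : root (map_poly ratr m) y by rewrite mP.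
have mG : m %| G.
  move: ym; rewrite {1}mGH rmorphM rootM => /orP[|]; rewrite mP // => mH.
  have arith (a b : nat) : (1 < b -> (a + b).-1 <= a -> False)%N by lia.
  have := dvdp_leq H0 mH; rewrite {1}mGH size_mul // => /arith; case.
  exact: sG.
have [p0|p0] := eqVneq p 0; first by [].
have := dvdp_leq p0 (dvdp_trans mG (dvdp_gcdl p m)).
by rewrite sm leqNgt ltnS sp.
Qed.

Lemma ev_zeta_neq0 (p : {poly int}) : (size p <= totient n)%N -> p != 0 -> ev p z != 0.
Proof.
move=> sp; apply: contraNneq => pz.
have sE : size (map_poly (intr : int -> rat) p) = size p.
  by rewrite size_map_inj_poly //; exact: intr_inj.
rewrite -size_poly_eq0 -sE (_ : map_poly _ p = 0) ?size_poly0 //.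
apply: rat_poly_vanish_zeta; first by rewrite sE.
by rewrite -pz /ev -map_poly_comp; congr (_.[_]); apply: eq_map_poly => k /=; rewrite ratr_int.
Qed.

(** A factor of [n] that is a power of an odd prime, or a power of 2 other than 2,
    has an even totient. *)
Lemma totient_even : (totient n = (star_dim n).+1.*2)%N.
Proof.
have n0 : (0 < n)%N by lia.
have t1 : (1 < totient n)%N by rewrite totient_gt1.
suff ev : ~~ odd (totient n).
  by rewrite /star_dim prednK; lia.
have odd_prime_factor p k m : prime p -> odd p -> coprime p m -> (0 < k)%N ->
    ~~ odd (totient (m * p ^ k)).
  move=> pp po co k0; rewrite totient_coprime; last by rewrite coprime_sym coprimeXl.
  rewrite totient_pfactor // !oddM negb_and negb_and; apply/orP; right; apply/orP; left.
  by move: po; rewrite -{1}(prednK (prime_gt0 pp)) /=.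
have [m co nE] := pfactor_coprime (isT : prime 2) n0.
have [m1|m1] := leqP m 1.
  have m_1 : m = 1%N by move: n0; rewrite nE; case: (m) m1 => [|[]].
  have k2 : (1 < logn 2%N n)%N.
    by move: hn; rewrite {1}nE m_1 mul1n; case: (logn _ _) => [|[]].
  rewrite {1}nE m_1 mul1n totient_pfactor //= ?mul1n; last by lia.
  by rewrite oddX; case: (logn _ _) k2 => [|[]].
have m0 : (0 < m)%N by lia.
pose p := pdiv m; have pp : prime p by exact: pdiv_prime.
have po : odd p.
  have [p2|] := even_prime pp; last by [].
  by move: co; rewrite prime_coprime // -p2 pdiv_dvd.
have [m' co' mE] := pfactor_coprime pp m0.
have -> : n = (m' * 2 ^ logn 2 n * p ^ logn p m)%N by rewrite {1}nE {1}mE mulnAC.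
apply: odd_prime_factor => //; last by rewrite logn_gt0 mem_primes pp m0 pdiv_dvd.
by rewrite coprimeMr co' coprimeXr // coprimen2 po.
Qed.
End ZetaFacts.

Section StarChoice.
Local Open Scope classical_set_scope.
Variables (R : realType) (n : nat).
Hypothesis hn : (2 < n)%N.
Variable sigma : 'I_(star_dim n).+1 -> {rmorphism cyc_field R n -> cyc_field R n}.
Hypothesis sigmaP : star_choice sigma.
Local Notation z := (zeta R n).
Implicit Types (p : {poly int}) (x : cyc_field R n).

Fact zeta_in_field : z \in @cyc_field_pred R n.
Proof.
apply/asboolP; exists 'X, 1.
by rewrite rmorph1 map_polyX hornerX hornerC oner_neq0 divr1.
Qed.

Definition zetaF : cyc_field R n := CycField zeta_in_field.

Definition conjugate_root i : R[i] := val (sigma i zetaF).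
Local Notation w := conjugate_root.

Lemma val_ratr (s : {rmorphism cyc_field R n -> cyc_field R n}) (q : rat) :
  val (s (ratr q)) = ratr q.
Proof. by rewrite (fmorph_rat s) (fmorph_rat val). Qed.

Lemma val_intr (s : {rmorphism cyc_field R n -> cyc_field R n}) (k : int) :
  val (s k%:~R) = k%:~R.
Proof. by rewrite (rmorph_int s) (rmorph_int val). Qed.

Lemma horner_rat (s : {rmorphism cyc_field R n -> cyc_field R n}) (P : {poly rat}) :
  val (s (map_poly ratr P).[zetaF]) = (map_poly ratr P).[val (s zetaF)].
Proof.
rewrite -horner_map -[LHS]horner_map; congr (_.[_]).
apply/polyP => j; rewrite !coef_map (coef_map_id0 (f := ratr)); first exact: val_ratr.
by rewrite (ratr_nat (cyc_field R n) 0).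
Qed.

Lemma cyc_field_repr x : exists P Q : {poly rat},
  x = (map_poly ratr P).[zetaF] / (map_poly ratr Q).[zetaF].
Proof.
have := valP x => /asboolP[P [Q [Q0 xE]]]; exists P, Q; apply: val_inj.
have E (T : {poly rat}) : val (map_poly ratr T).[zetaF] = (map_poly ratr T).[z].
  exact: (@horner_rat idfun T).
by rewrite [RHS]fmorph_div /= !E.
Qed.

Lemma val_automorphism (s : {rmorphism cyc_field R n -> cyc_field R n}) x (P Q : {poly rat}) :
  x = (map_poly ratr P).[zetaF] / (map_poly ratr Q).[zetaF] ->
  val (s x) = (map_poly ratr P).[val (s zetaF)] / (map_poly ratr Q).[val (s zetaF)].
Proof.
move=> ->; rewrite (fmorph_div s) (fmorph_div val).
by congr (_ / _); exact: horner_rat.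
Qed.

Lemma val_star p i : val (sigma i (map_poly intr p).[zetaF]) = ev p (w i).
Proof.
rewrite /ev -horner_map -[LHS]horner_map; congr (_.[_]).
by apply/polyP => j; rewrite !coef_map; exact: val_intr.
Qed.

Lemma conjugate_root_primitive i : n.-primitive_root (w i).
Proof.
rewrite /w !fmorph_primitive_root.
have := zeta_primitive R hn; rewrite -[z]/(val zetaF) fmorph_primitive_root.
exact.
Qed.

Lemma conjugate_root0 : w ord0 = z.
Proof. by case: sigmaP => _ s0 _; rewrite /w s0. Qed.

Lemma prim_conj (y : R[i]) : n.-primitive_root y -> conjc y * y = 1.
Proof.
move=> yn; have [k ->] := prim_rootP (zeta_primitive R hn) (prim_expr_order yn).
rewrite rmorphXn -exprMn (_ : conjc z * z = 1) ?expr1n //.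
rewrite zetaE /cis -[RHS]/(1%:C); apply: complex_ext; rewrite ?ReM ?ImM /=; last by ring.
by rewrite -[RHS](cos2Dsin2 (2 * pi / n%:R)); ring.
Qed.

(** A root of unity [y] of order [n] has the conjugate [y ^+ n.-1]. *)
Definition conj_poly p : {poly int} := p \Po 'X^(n.-1).

Lemma ev_conj_poly p (y : R[i]) : n.-primitive_root y ->
  ev (conj_poly p) y = conjc (ev p y).
Proof.
move=> yn; rewrite /conj_poly /ev map_comp_poly /= map_polyXn horner_comp hornerXn.
rewrite -/(ev p _) -ev_conj; congr (ev p _); have yJ := prim_conj yn.
have y0 : y != 0 by apply: contra_eq_neq yJ => ->; rewrite mulr0 eq_sym oner_eq0.
by apply: (mulIf y0); rewrite yJ -exprSr prednK ?(prim_expr_order yn) //; lia.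
Qed.

Lemma conjugate_root_norm i : `|w i| = 1.
Proof.
apply/eqP; rewrite -sqrp_eq1 ?normr_ge0 // sqr_normc mulrC.
by rewrite prim_conj //; exact: conjugate_root_primitive.
Qed.

(** An automorphism is determined by the image of [zeta]; this and the next lemma
    reduce properties of the [sigma i] to properties of the numbers [w i]. *)
Lemma same_root_eq i j : w i = w j -> sigma i =1 sigma j.
Proof.
move=> wij x; have [P [Q xE]] := cyc_field_repr x; apply: val_inj.
by rewrite (val_automorphism _ xE) (val_automorphism _ xE) -/(w i) wij.
Qed.

Lemma conj_root_conj i j : w i = conjc (w j) ->
  forall x, cyc_val (sigma i x) = conjc (cyc_val (sigma j x)).
Proof.
move=> wij x; have [P [Q xE]] := cyc_field_repr x.
rewrite -[LHS]/(val _) -[cyc_val _]/(val _) !(val_automorphism _ xE) -/(w i) -/(w j) wij.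
have E (T : {poly rat}) : conjc (map_poly ratr T).[w j] = (map_poly ratr T).[conjc (w j)].
  rewrite -[LHS]horner_map /= -map_poly_comp; congr (_.[_]).
  by apply: eq_map_poly => q /=; rewrite fmorph_rat.
by rewrite fmorph_div /= !E.
Qed.

Lemma star_unique i j : sigma i =1 sigma j \/
  (forall x, cyc_val (sigma i x) = conjc (cyc_val (sigma j x))) -> i = j.
Proof.
move=> h; have [sg _ /(_ (sigma j) (sg j))[k [_ ku]]] := sigmaP.
by rewrite -(ku i h); apply: ku; left.
Qed.

Lemma conjugate_root_inj : injective w.
Proof. by move=> i j /same_root_eq h; apply: star_unique; left. Qed.

(** For [i = j] this says that [w i], of order larger than 2, is not real. *)
Lemma conjugate_root_nonconj i j : w i != conjc (w j).
Proof.
apply/eqP => wij; have e : i = j by apply: star_unique; right; exact: conj_root_conj.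
have := prim_conj (conjugate_root_primitive j); rewrite -wij e -expr2 => /eqP.
rewrite -(prim_order_dvd (conjugate_root_primitive j)) => /dvdn_leq; lia.
Qed.

Lemma ev_conjugate_neq0 p i : (size p <= totient n)%N -> p != 0 -> ev p (w i) != 0.
Proof.
move=> sp p0; have := @ev_zeta_neq0 R n hn p sp p0.
rewrite -conjugate_root0 -!val_star !fmorph_eq0; exact.
Qed.

(** The polynomial ['Phi_n] is monic, so division by it keeps integer coefficients. *)
Lemma reduce_mod_cyclotomic p : exists2 q : {poly int}, (size q <= totient n)%N &
  ev q z = ev p z.
Proof.
have Phi_monic := Cyclotomic_monic n.
exists (Pdiv.Ring.rmodp p 'Phi_n).
  rewrite -ltnS -size_Cyclotomic Pdiv.Ring.ltn_rmodpN0 //; exact: monic_neq0.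
by rewrite {2}(Pdiv.RingMonic.rdivp_eq Phi_monic p) evD evM Cyclotomic_zeta // mulr0 add0r.
Qed.
End StarChoice.

Section ModelSet.
Local Open Scope classical_set_scope.
Variables (R : realType) (n : nat).
Hypothesis hn : (2 < n)%N.
Variable sigma : 'I_(star_dim n).+1 -> {rmorphism cyc_field R n -> cyc_field R n}.
Hypothesis sigmaP : star_choice sigma.
Variable W : set (star_space R n).
Hypothesis W_window : window W.
Local Notation z := (zeta R n).
Local Notation w := (conjugate_root sigma).
Local Notation s := (star_dim n).
Implicit Types (p q b : {poly int}).

Lemma nonneg_real (x : R[i]) : 0 <= x -> x = (complex.Re x)%:C.
Proof. by move=> x0; rewrite RRe_real // ger0_real. Qed.

(** The squared modulus of an element of [Z[zeta]] with small conjugates is a real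
    number [a] with small conjugates: multiplication by it is a homothety of the
    plane and a contraction of the internal space. *)
Lemma small_real_multiplier (e : R) : 0 < e -> exists q (a : R),
  [/\ 0 < a, ev q z = a%:C, forall i, ev q (w i) != 0 &
      forall j : 'I_s, `|ev q (w (lift ord0 j))| <= e%:C].
Proof.
move=> e0; have wprim := conjugate_root_primitive hn sigma.
have wnorm := conjugate_root_norm hn sigma.
pose e1 := Num.min 1 e; have e10 : 0 < e1 by rewrite lt_min ltr01.
have [|p [p0 sp pe]] := @small_norms R s (fun j => w (lift ord0 j)) e1 _ e10.
  by move=> j; rewrite wnorm.
pose q := p * conj_poly n p.
have qE i : ev q (w i) = `|ev p (w i)| ^+ 2.
  by rewrite /q evM sqr_normc ev_conj_poly.
have sp' : (size p <= totient n)%N by rewrite totient_even // doubleS; lia.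
have pn0 i : ev p (w i) != 0 by exact: ev_conjugate_neq0.
exists q, (complex.Re (`|ev p z| ^+ 2)).
have zE := conjugate_root0 sigmaP.
have n20 : 0 < `|ev p z| ^+ 2 by rewrite exprn_gt0 // normr_gt0 -zE.
have n2E := nonneg_real (ltW n20).
split.
- by rewrite -ltcR -n2E.
- by rewrite -n2E -zE qE.
- by move=> i; rewrite qE expf_neq0 // normr_eq0.
- move=> j; rewrite qE normrX normr_id expr2.
  have h := pe j; apply: le_trans (ler_pM _ _ h h) _ => //.
  rewrite -rmorphM lecR /e1; have := e10; rewrite /e1.
  by case: (lerP 1 e) => h1 h2; nra.
Qed.

(** [values_dense] applied to a multiplier with very small conjugates gives a point
    whose star is close to the centre of a ball in [W]. *)
Lemma dense_in_window : exists b (e : R), 0 < e /\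
  forall p, (forall j : 'I_s, `|ev p (w (lift ord0 j))| <= e%:C) ->
  W (star sigma (map_poly intr (b + p)).[zetaF R n]).
Proof.
have [y [e [e0 yW]]] := window_ball W_window.
have d0 : (0 : R) < (s.+1.*2)%:R by rewrite ltr0n.
pose e1 := e / 3 / (s.+1.*2)%:R.
have e10 : 0 < e1 by rewrite !divr_gt0.
have [q [a [a0 qa q0 qe]]] := small_real_multiplier e10.
(* [star] leaves out the embedding [ord0], where any value may be prescribed *)
pose yy (i : 'I_s.+1) : R[i] := if unlift ord0 i is Some j then y j else 0.
have [|b bP] := values_dense (conjugate_root_inj sigmaP) (conjugate_root_nonconj hn sigmaP) _ yy q0.
  by move=> i; rewrite (conjugate_root_norm hn).
exists b, (e / 3); split; first by rewrite divr_gt0.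
move=> p pe; apply: yW => j; rewrite mxE -[cyc_val _]/(val _) val_star evD.
have := bP (lift ord0 j); rewrite /yy liftK => bj.
rewrite addrAC; apply: le_lt_trans (ler_normD _ _) _.
apply: le_lt_trans (lerD bj (pe j)) _.
have e1m : `|ev q (w (lift ord0 j))| *+ s.+1.*2 <= (e / 3)%:C.
  apply: le_trans (ler_wMn2r _ (qe j)) _.
  rewrite -rmorphMn lecR /e1 -[_ *+ _]mulr_natr divfK ?gt_eqF //; exact: lexx.
apply: le_lt_trans (lerD e1m (lexx _)) _.
by rewrite -rmorphD ltcR; lra.
Qed.

(** Translate by [b], deep inside the window, and multiply the configuration by a
    real number whose conjugates contract it enough to stay in the window. *)
Lemma homothetic_copy (t : R[i]) (E : seq {poly int}) : exists (x0 : R[i]) (a : R),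
  0 < a /\ forall p, p \in E -> model_set sigma t W (x0 + a%:C * ev p z).
Proof.
have [b [e [e0 bW]]] := dense_in_window.
pose B : R[i] := \sum_(p <- E) \sum_i `|ev p (w i)|.
have B0 : 0 <= B by rewrite sumr_ge0 // => p _; rewrite sumr_ge0.
have BE := nonneg_real B0; set B' := complex.Re B in BE.
have B'0 : 0 <= B' by rewrite -lecR -BE.
have pB p i : p \in E -> `|ev p (w i)| <= B.
  move=> pE; rewrite /B (big_rem p) //= (bigD1 i) //= -addrA lerDl addr_ge0 ?sumr_ge0 //.
  by move=> p' _; rewrite sumr_ge0.
have [|q [a [a0 qa q0 qe]]] := @small_real_multiplier (e / (B' + 1)).
  by rewrite divr_gt0 //; lra.
exists (t + ev b z), a; split => // p pE.
have zE := conjugate_root0 sigmaP.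
pose Z := (map_poly intr (b + q * p)).[zetaF R n].
have [_ s0 _] := sigmaP.
have ZE : cyc_val Z = ev (b + q * p) z by rewrite -(s0 Z) -[LHS]/(val _) val_star zE.
exists Z; last by rewrite ZE evD evM qa addrA.
split; first by apply/asboolP; exists (b + q * p).
apply: bW => j; rewrite evM normrM.
apply: le_trans (ler_pM _ _ (qe j) (pB p (lift ord0 j) pE)) _ => //.
rewrite BE -rmorphM lecR mulrAC -mulrA ler_piMr ?ltW //.
by rewrite ltr_pdivrMr ?mul1r; lra.
Qed.

(** The elements of [Z[zeta]] in question have all their conjugates bounded. *)
Lemma model_set_locally_finite (t B : R[i]) : 0 <= B -> exists l : seq R[i],
  forall x, model_set sigma t W x -> `|x| <= B -> x \in l.
Proof.
move=> B0; have [B' [B'0 WB]] := window_bounded W_window.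
pose BB := B + `|t| + B'.
have BB0 : 0 <= BB by rewrite !addr_ge0.
have wn i : `|w i| <= 1 by rewrite (conjugate_root_norm hn).
have [l lP] := finitely_many_bounded (conjugate_root_inj sigmaP)
  (conjugate_root_nonconj hn sigmaP) BB0.
exists (map (fun q => t + ev q z) l) => x [zz [/asboolP[p zp] Wz] <-] xB.
have zE := conjugate_root0 sigmaP; have [_ s0 _] := sigmaP.
have [q sq qp] := @reduce_mod_cyclotomic R n hn p.
have zzE : zz = (map_poly intr q).[zetaF R n].
  apply: val_inj; rewrite -(s0 (map_poly intr q).[zetaF R n]) val_star zE qp.
  by rewrite [LHS]zp.
have -> : t + cyc_val zz = t + ev q z by rewrite qp zp.
apply: map_f; apply: lP => [|i]; first by rewrite -totient_even.
have [j ij|i0] := unliftP ord0 i.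
  rewrite ij; have := WB _ Wz j; rewrite mxE zzE -[cyc_val _]/(val _) val_star.
  by move/le_trans; apply; rewrite /BB lerDr addr_ge0.
rewrite i0 zE qp.
have -> : ev p z = (t + cyc_val zz) - t by rewrite zp addrC addKr.
apply: le_trans (ler_normB _ _) _.
by rewrite /BB -addrA lerD // lerDl.
Qed.
End ModelSet.

(** * Switching the vertices of a polygon *)

Section Switching.
Local Open Scope classical_set_scope.
Variables (R : realType) (n : nat).
Hypothesis hn : (2 < n)%N.
Local Notation z := (zeta R n).
Implicit Types (u v x y : R[i]).

Lemma half_plane_convex v (c : R) : convex_pred [set x | cross v x < c].
Proof.
move=> x y t /andP[t0 t1] /= xc yc; rewrite !crossE.
have [->|t1'] := eqVneq t 1; first by lra.
have {}t1 : t < 1 by rewrite lt_neqAle t1' t1.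
nra.
Qed.

(** This set contains a polygon whose vertex [x0] is its only point of largest
    height. *)
Lemma exposed_convex v x0 : convex_pred [set x | cross v x < cross v x0 \/ x = x0].
Proof.
move=> x y t /andP[t0 t1] /= xc yc.
have [->|t0'] := eqVneq t 0; first by rewrite mul0r add0r subr0 mul1r.
have [->|t1'] := eqVneq t 1; first by rewrite mul1r subrr mul0r addr0.
have {}t0 : 0 < t by rewrite lt_neqAle eq_sym t0' t0.
have {}t1 : t < 1 by rewrite lt_neqAle t1' t1.
case: xc => [xc|->]; case: yc => [yc|->].
- by left; rewrite !crossE; nra.
- by left; rewrite !crossE; nra.
- by left; rewrite !crossE; nra.
- by right; apply: complex_ext; rewrite !complex_lin; ring.
Qed.

Lemma ball_convex (B : R[i]) : convex_pred [set x : R[i] | `|x| <= B].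
Proof.
move=> x y t /andP[t0 t1] /= xB yB.
apply: le_trans (ler_normD _ _) _; rewrite !normrM.
have nC (k : R) : 0 <= k -> `|k%:C| = k%:C :> R[i] by move=> k0; rewrite ger0_norm ?ler0c.
rewrite !nC ?subr_ge0 //.
have -> : B = t%:C * B + (1 - t)%:C * B.
  by rewrite -mulrDl -rmorphD /= addrC subrK mul1r.
by rewrite lerD // ler_wpM2l ?ler0c ?subr_ge0.
Qed.

(** Two interlaced halves [E] and [O] of the vertices of a convex polygon, with
    the same heights over each direction of [U]: put a homothetic copy of the
    polygon in the model set, and remove from its points in the polygon one half
    of the vertices or the other. *)
Theorem polygon_not_determined (E O : seq {poly int}) (U : {fset R[i]}) (L : set R[i]) :
  cyclotomic_model_sets n L ->
  E <> [::] ->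
  uniq [seq ev p z | p <- E ++ O] ->
  (forall p, p \in E ++ O -> exists v, forall p', p' \in E ++ O -> p' != p ->
     cross v (ev p' z) < cross v (ev p z)) ->
  (forall u, u \in U -> u != 0 /\
     perm_eq [seq cross u (ev p z) | p <- E] [seq cross u (ev p z) | p <- O]) ->
  ~ determined (convex_subsets L) U.
Proof.
move=> [sigma [t [W [sigmaP Wwin ->]]]] Ene uEO expo UP det.
have [x0 [a [a0 copy]]] := homothetic_copy hn sigmaP Wwin t (E ++ O).
set L' := model_set sigma t W in copy det *.
pose P p := x0 + a%:C * ev p z.
have aC0 : a%:C != 0 :> R[i] by rewrite eq_complex /= eqxx andbT gt_eqF.
have Pinj p q : P p = P q -> ev p z = ev q z by move/addrI/(mulfI aC0).
have uP : uniq [seq P p | p <- E ++ O].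
  have -> : [seq P p | p <- E ++ O] = [seq x0 + a%:C * x | x <- [seq ev p z | p <- E ++ O]].
    by rewrite -map_comp.
  by rewrite map_inj_uniq // => x y /addrI/(mulfI aC0).
pose V : set R[i] := [set x | x \in [seq P p | p <- E ++ O]].
pose H := convex_hull V.
pose B : R[i] := \sum_(x <- [seq P p | p <- E ++ O]) `|x|.
have HB x : H x -> `|x| <= B.
  apply: (convex_hull_sub (@ball_convex B)) => {}x /= xV.
  by rewrite /B (big_rem x) //= lerDl sumr_ge0.
have B0 : 0 <= B by rewrite sumr_ge0.
have [l lP] := model_set_locally_finite hn sigmaP Wwin t B0.
pose C := [fset x in l | `[< H x /\ L' x >] && (x \notin [seq P p | p <- E ++ O])]%fset.
have CP x : x \in C <-> [/\ H x, L' x & x \notin [seq P p | p <- E ++ O]].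
  split; first by rewrite !inE => /and3P[_ /asboolP[]].
  move=> [Hx Lx xV]; rewrite !inE xV andbT; apply/andP; split; last exact/asboolP.
  by apply: lP => //; exact: HB.
pose F (Q : seq {poly int}) := (C `|` [fset x in [seq P p | p <- Q]])%fset.
have FP Q x : x \in F Q = (x \in C) || (x \in [seq P p | p <- Q]) by rewrite !inE.
have VH x : x \in [seq P p | p <- E ++ O] -> H x by move=> xV; exact: sub_convex_hull.
have side p : p \in E ++ O -> exists v, forall x, H x -> x <> P p -> cross v x < cross v (P p).
  move=> pEO; have [v vP] := expo p pEO; exists v => x.
  have HX : H `<=` [set x | cross v x < cross v (P p) \/ x = P p].
    apply: convex_hull_sub; first exact: exposed_convex.
    move=> _ /= /mapP[p' p'EO ->]; have [->|p'p] := eqVneq p' p; first by right.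
    by left; rewrite !crossE ltrD2l ltr_pM2l // vP.
  by move=> /HX[].
have FQ_convex (Q Q' : seq {poly int}) : (forall p, (p \in E ++ O) = (p \in Q) || (p \in Q')) ->
    (forall p, p \in Q' -> P p \notin [seq P q | q <- Q]) -> convex_subsets L' (F Q).
  move=> QQ' disj; rewrite /convex_subsets /=.
  have FH x : x \in F Q -> H x.
    rewrite FP => /orP[/CP[]//|/mapP[p pQ ->]]; apply: VH; apply: map_f.
    by rewrite QQ' pQ.
  apply/seteqP; split=> x /=.
    move=> xF; split; first exact: sub_convex_hull.
    move: xF; rewrite FP => /orP[/CP[]//|/mapP[p pQ ->]].
    by apply: copy; rewrite QQ' pQ.
  move=> [hx Lx].
  have Hx : H x by apply: (convex_hull_sub (@convex_hull_convex _ V) _ hx) => y; exact: FH.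
  rewrite FP; have [/mapP[p pEO xp]|xV] := boolP (x \in [seq P p | p <- E ++ O]); last first.
    by apply/orP; left; apply/CP.
  rewrite orbC; apply/orP; left; rewrite xp.
  have [pQ|pQ] := boolP (p \in Q); first exact: map_f.
  have pQ' : p \in Q' by move: pEO; rewrite QQ' (negPf pQ).
  have [v vP] := side p pEO.
  have : cross v x < cross v (P p); last by rewrite xp ltxx.
  apply: (convex_hull_sub (@half_plane_convex v (cross v (P p))) _ hx) => y /= yF.
  apply: vP; first exact: FH.
  move=> yp; move: yF; rewrite yp FP => /orP[/CP[_ _ /negP]|]; last exact/negP/disj.
  by apply; exact: map_f.
have disj p q : p \in E -> q \in O -> P p != P q.
  move=> pE qO; move: uP; rewrite map_cat cat_uniq => /and3P[_ /hasPn h _].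
  by apply/eqP => e; have := h _ (map_f P qO); rewrite -e /= map_f.
have SE : convex_subsets L' (F E).
  refine (FQ_convex E O _ _) => [p|p pO]; first by rewrite mem_cat.
  by apply/mapP => -[q qE e]; have := disj q p qE pO; rewrite e eqxx.
have SO : convex_subsets L' (F O).
  refine (FQ_convex O E _ _) => [p|p pE]; first by rewrite mem_cat orbC.
  by apply/mapP => -[q qO e]; have := disj p q pE qO; rewrite e eqxx.
have permF Q : (forall p, p \in Q -> p \in E ++ O) -> uniq [seq P p | p <- Q] ->
    perm_eq (F Q) (enum_fset C ++ [seq P p | p <- Q]).
  move=> QEO uQ; apply: uniq_perm; rewrite ?fset_uniq //.
    rewrite cat_uniq fset_uniq uQ andbT /=; apply/hasPn => _ /mapP[p pQ ->] /=.
    apply/negP => /CP[_ _ /negP]; apply; apply: map_f; exact: QEO.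
  by move=> x; rewrite mem_cat FP.
have [uE uO] : uniq [seq P p | p <- E] /\ uniq [seq P p | p <- O].
  by move: uP; rewrite map_cat cat_uniq => /and3P[].
have EO : F E = F O.
  apply: det => // u /UP[u0 hu]; apply/Xray_eqP => //.
  rewrite (permPl (perm_map _ (permF E _ uE))); last by move=> p pE; rewrite mem_cat pE.
  rewrite perm_sym (permPl (perm_map _ (permF O _ uO))); last first.
    by move=> p pO; rewrite mem_cat pO orbT.
  rewrite !map_cat perm_cat2l perm_sym -!map_comp.
  have e Q : [seq (cross u \o P) p | p <- Q] =
      [seq cross u x0 + a * h | h <- [seq cross u (ev p z) | p <- Q]].
    by rewrite -map_comp; apply: eq_map => p /=; rewrite !crossE.
  by rewrite !e; apply: perm_map.
have [p pE] : exists p, p \in E by case: (E) Ene => // p E' _; exists p; rewrite mem_head.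
have : P p \in F O by rewrite -EO FP map_f ?orbT.
rewrite FP => /orP[/CP[_ _ /negP]|/mapP[q qO e]]; last first.
  by have := disj p q pE qO; rewrite e eqxx.
by apply; apply: map_f; rewrite mem_cat pE.
Qed.
End Switching.

Section Constructions.
Variables (R : realType) (n : nat).
Hypothesis hn : (2 < n)%N.
Local Notation z := (zeta R n).
Implicit Types (u x y : R[i]) (p q : {poly int}) (d v : int * int).

Lemma Im_zeta_gt0 : 0 < complex.Im z.
Proof.
have n0 : (0 : R) < n%:R by rewrite ltr0n; lia.
apply: sin_gt0_pi; rewrite divr_gt0 ?mulr_gt0 ?pi_gt0 //= ltr_pdivrMr // mulrC.
by rewrite ltr_pM2l ?pi_gt0 // ltr_nat.
Qed.

(** With bars for conjugation, a determinant of two complex numbers is the imaginary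
    part of [bar p * q], which need not be in [Z[zeta]]; the factor [zeta - bar zeta]
    turns twice this imaginary part into a real element of [Z[zeta]]. *)
Definition det_poly p q : {poly int} :=
  ('X - conj_poly n 'X) * (conj_poly n p * q - p * conj_poly n q).

Lemma ev_det_poly p q :
  ev (det_poly p q) z = (- 4 * complex.Im z * cross (ev p z) (ev q z))%:C.
Proof.
rewrite /det_poly evM !evB !evM !(ev_conj_poly hn _ (zeta_primitive R hn)).
have -> : ev 'X z = z by rewrite /ev map_polyX hornerX.
move: z (ev p z) (ev q z) => [a b] [c d] [e f].
by apply: complex_ext; rewrite ?ReM ?ImM /cross /=; ring.
Qed.

(** Polygons with integer coordinates in a basis [ev q1 z], [ev q2 z] of the plane are
    described by pairs of integers, and their properties checked by computation. *)
Definition idet (d v : int * int) : int := d.1 * v.2 - d.2 * v.1.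

Section LatticePolygon.
Variables (q1 q2 : {poly int}).
Hypothesis q12 : cross (ev q1 z) (ev q2 z) != 0.

Definition ipoint (v : int * int) : {poly int} := v.1 *: q1 + v.2 *: q2.

Lemma ev_ipoint v : ev (ipoint v) z = (v.1%:~R)%:C * ev q1 z + (v.2%:~R)%:C * ev q2 z.
Proof.
rewrite /ipoint evD; congr (_ + _);
by rewrite /ev map_polyZ hornerZ rmorph_int.
Qed.

Lemma cross_ipoint d v : cross (ev (ipoint d) z) (ev (ipoint v) z) =
  (idet d v)%:~R * cross (ev q1 z) (ev q2 z).
Proof. by rewrite !ev_ipoint cross_det /idet intrB !intrM; ring. Qed.

Lemma ipoint_inj v v' : ev (ipoint v) z = ev (ipoint v') z -> v = v'.
Proof.
move=> e; have H d : idet d v = idet d v'.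
  apply: (intr_inj (R := R)); apply: (mulIf q12).
  by rewrite -!cross_ipoint e.
have := H (1, 0); have := H (0, -1); rewrite /idet /= !(mul1r, mul0r, mulN1r, subr0, sub0r, opprK).
by case: (v) (v') => [a b] [a' b'] /= -> ->.
Qed.

(** [phi v] is the direction of a supporting line of the polygon at [v]. *)
Definition strictly_exposed (phi : int * int -> int * int) (s : seq (int * int)) :=
  all (fun v => all (fun v' => (v' == v) || (idet (phi v) v' < idet (phi v) v)) s) s.

(** Equal X-rays in the direction of the vector [d]. *)
Definition balanced (E O : seq (int * int)) d :=
  perm_eq (map (idet d) E) (map (idet d) O).

Theorem lattice_polygon_not_determined phi (E O : seq (int * int)) (U : {fset R[i]}) (L : set R[i]) :
  cyclotomic_model_sets n L ->
  E <> [::] -> uniq (E ++ O) -> strictly_exposed phi (E ++ O) ->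
  (forall u, u \in U -> u != 0 /\ exists d (k : R), u = k%:C * ev (ipoint d) z /\ balanced E O d) ->
  ~ determined (convex_subsets L) U.
Proof.
move=> LM Ene uEO expo UP.
apply: (@polygon_not_determined R n hn (map ipoint E) (map ipoint O) U L LM).
- by case: (E) Ene.
- rewrite -map_cat -map_comp map_inj_uniq //; exact: ipoint_inj.
- rewrite -map_cat => _ /mapP[v vs ->].
  pose D := cross (ev q1 z) (ev q2 z).
  exists (D%:C * ev (ipoint (phi v)) z) => _ /mapP[v' vs' ->] ne.
  have /orP[/eqP e|lt] := allP (allP expo v vs) v' vs'; first by rewrite e eqxx in ne.
  rewrite !crossZl !cross_ipoint -/D mulrCA [ltRHS]mulrCA -expr2.
  by rewrite ltr_pM2r ?ltr_int // exprn_even_gt0.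
- move=> u /UP[u0 [d [k [uE bal]]]]; split => //; rewrite uE -!map_comp.
  have E' s : [seq ((fun p => cross (k%:C * ev (ipoint d) z) (ev p z)) \o ipoint) v | v <- s] =
     [seq k * (h%:~R * cross (ev q1 z) (ev q2 z)) | h <- map (idet d) s].
    by rewrite -map_comp; apply: eq_map => v /=; rewrite crossZl cross_ipoint.
  by rewrite !E'; apply: perm_map.
Qed.
End LatticePolygon.

(** Three vectors of the plane satisfy a linear relation whose coefficients are
    determinants, hence, up to a common real factor, elements of [Z[zeta]]
    ([ev_det_poly]).  So three directions are those of vectors of sum zero in
    [Z[zeta]], and these are parallel to the edges of an affinely regular
    hexagon. *)
Theorem three_directions_undetermined (U : {fset R[i]}) (L : set R[i]) p1 p2 p3 :
  cyclotomic_model_sets n L ->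
  cross (ev p1 z) (ev p2 z) != 0 -> cross (ev p2 z) (ev p3 z) != 0 ->
  cross (ev p3 z) (ev p1 z) != 0 ->
  (forall u, u \in U -> u != 0 /\
     [\/ cross u (ev p1 z) = 0, cross u (ev p2 z) = 0 | cross u (ev p3 z) = 0]) ->
  ~ determined (convex_subsets L) U.
Proof.
move=> LM c12 c23 c31 UP.
pose k := - 4 * complex.Im z; have k0 : k != 0.
  by rewrite mulf_neq0 ?(gt_eqF Im_zeta_gt0) // oppr_eq0 pnatr_eq0.
pose e1 := det_poly p2 p3 * p1; pose e2 := det_poly p3 p1 * p2.
pose x1 := ev e1 z; pose x2 := ev e2 z.
pose x3 := (k * cross (ev p1 z) (ev p2 z))%:C * ev p3 z.
have E1 : x1 = (k * cross (ev p2 z) (ev p3 z))%:C * ev p1 z by rewrite /x1 evM ev_det_poly.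
have E2 : x2 = (k * cross (ev p3 z) (ev p1 z))%:C * ev p2 z by rewrite /x2 evM ev_det_poly.
have x_sum : x3 = - x1 - x2.
  apply/eqP; rewrite -opprD -subr_eq0 opprK; apply/eqP.
  rewrite E1 E2 /x3 -[RHS](mulr0 k%:C) -(cross_id (ev p1 z) (ev p2 z) (ev p3 z)).
  by rewrite !rmorphM; ring.
have D0 : cross x1 x2 != 0.
  rewrite E1 E2 crossZl crossZr; apply: mulf_neq0; first exact: mulf_neq0.
  by apply: mulf_neq0 => //; exact: mulf_neq0.
pose E : seq (int * int) := [:: (1, 0); (0, 1); (-1, -1)].
pose O : seq (int * int) := [:: (-1, 0); (0, -1); (1, 1)].
(* a supporting line at [v] is the tangent of the ellipse [x ^ 2 - x y + y ^ 2 = 1],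
   on which the vertices lie *)
apply: (@lattice_polygon_not_determined e1 e2 D0 (fun v => (2 * v.2 - v.1, v.2 - 2 * v.1)) E O U L LM) => //.
have x10 : x1 != 0 by apply: contraNneq D0 => ->; rewrite cross0l.
have x20 : x2 != 0 by apply: contraNneq D0 => ->; rewrite cross0r.
have x30 : x3 != 0.
  apply: contraNneq D0 => x30; have -> : x1 = - x2 by apply/eqP; rewrite -subr_eq0 opprK -oppr_eq0 opprD -x_sum x30.
  by rewrite crossNl crossxx oppr0.
have par (y x u : R[i]) : x != 0 -> (exists k' : R, x = k'%:C * y) -> cross u y = 0 -> exists k : R, u = k%:C * x.
  move=> x0 [k' xy] uy; apply: cross_eq0 => //.
  by rewrite crossC xy crossZr uy mulr0 oppr0.
move=> u /UP[u0 [] uc]; split => //.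
- have [l ul] := par _ _ _ x10 (ex_intro _ _ E1) uc.
  by exists (1, 0), l; rewrite ev_ipoint /= mul1r mul0r addr0.
- have [l ul] := par _ _ _ x20 (ex_intro _ _ E2) uc.
  by exists (0, 1), l; rewrite ev_ipoint /= mul1r mul0r add0r.
- have [l ul] := par _ _ _ x30 (ex_intro _ _ erefl) uc.
  exists (-1, -1), l; split => //; rewrite ev_ipoint /= ul x_sum.
  by rewrite rmorphN rmorph1 !mulN1r.
Qed.

Definition zpoint d : R[i] := ev (ipoint 1 'X d) z.
(** The norm is made a real number to be used as a real scalar. *)
Definition zdir d : R[i] := (complex.Re `|zpoint d|)^-1%:C * zpoint d.

Lemma cross_zpoint d v : cross (zpoint d) (zpoint v) = (idet d v)%:~R * complex.Im z.
Proof.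
rewrite /zpoint cross_ipoint; congr (_ * _).
by rewrite /ev map_polyX hornerX rmorph1 hornerC /cross /= mul1r mul0r subr0.
Qed.

Lemma zpoint_neq0 d : d != 0 -> zpoint d != 0.
Proof.
have Iz := lt0r_neq0 Im_zeta_gt0.
move=> d0; apply: contra_neq d0 => e.
have H v : idet v d = 0.
  apply/eqP; rewrite -(intr_eq0 R) -(mulIr_eq0 _ (mulIf Iz)) -cross_zpoint e.
  by rewrite cross0r.
have := H (1, 0); have := H (0, -1); rewrite /idet /= !(mul1r, mul0r, mulN1r, subr0, sub0r, opprK).
by case: (d) => [a b] /= -> ->.
Qed.

Lemma zdir_scale d : d != 0 -> exists2 k : R, k != 0 & zdir d = k%:C * zpoint d.
Proof.
move=> d0; exists (complex.Re `|zpoint d|)^-1 => //.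
have h : 0 < complex.Re `|zpoint d|.
  by rewrite -ltcR -nonneg_real ?normr_ge0 // normr_gt0 zpoint_neq0.
by rewrite invr_eq0 gt_eqF.
Qed.

Lemma zdir_direction d : d != 0 -> cyc_direction n (zdir d).
Proof.
move=> d0; have [k k0 kE] := zdir_scale d0; split.
  have n0 : `|zpoint d| != 0 by rewrite normr_eq0 zpoint_neq0.
  rewrite /direction /zdir normrM.
  have -> : `|(complex.Re `|zpoint d|)^-1%:C| = `|zpoint d|^-1.
    have e : (complex.Re `|zpoint d|)^-1%:C = `|zpoint d|^-1.
      by rewrite {2}(nonneg_real (normr_ge0 _)) -fmorphV.
    by rewrite e normfV normr_id.
  by rewrite mulVf.
exists (zpoint d); split; [|exact: zpoint_neq0|by exists k].
by apply/asboolP; exists (ipoint 1 'X d).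
Qed.

Definition zdirs (s : seq (int * int)) : {fset R[i]} := [fset x in map zdir s]%fset.

Definition spread (s : seq (int * int)) :=
  uniq s && all (fun d => (d != 0) && all (fun v => (v == d) || (idet d v != 0)) s) s.

Section Spread.
Variable s : seq (int * int).
Hypothesis s_spread : spread s.

Lemma spread_neq0 d : d \in s -> d != 0.
Proof. by case/andP: s_spread => _ /allP h /h/andP[]. Qed.

Lemma spread_cross d v : d \in s -> v \in s -> v != d -> cross (zdir d) (zdir v) != 0.
Proof.
move=> ds vs vd; have [k k0 ->] := zdir_scale (spread_neq0 ds).
have [l l0 ->] := zdir_scale (spread_neq0 vs).
rewrite crossZl crossZr cross_zpoint !mulf_neq0 ?(gt_eqF Im_zeta_gt0) // intr_eq0.
by case/andP: s_spread => _ /allP/(_ _ ds)/andP[_ /allP/(_ _ vs)]; rewrite (negPf vd).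
Qed.

Lemma zdir_inj : {in s &, injective zdir}.
Proof.
move=> d v ds vs e; apply/eqP; apply: contraT => dv.
by have := spread_cross vs ds dv; rewrite e crossxx eqxx.
Qed.

Lemma card_zdirs : #|` zdirs s| = size s.
Proof.
rewrite /zdirs card_fseq undup_id ?size_map // map_inj_in_uniq; last exact: zdir_inj.
by case/andP: s_spread.
Qed.

Lemma mem_zdirs u : u \in zdirs s -> exists2 d, d \in s & u = zdir d.
Proof. by rewrite !inE => /mapP. Qed.

Lemma det_ratio_zdir d1 d2 d3 d4 : d1 \in s -> d2 \in s -> d3 \in s -> d4 \in s ->
  d2 != d3 -> d1 != d4 ->
  det_ratio (zdir d1) (zdir d2) (zdir d3) (zdir d4) =
  (idet d1 d3 * idet d2 d4)%:~R / (idet d2 d3 * idet d1 d4)%:~R.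
Proof.
move=> s1 s2 s3 s4 n23 n14; rewrite eq_sym in n23; rewrite eq_sym in n14.
have := spread_cross s2 s3 n23; have := spread_cross s1 s4 n14.
have [k1 k10 ->] := zdir_scale (spread_neq0 s1); have [k2 k20 ->] := zdir_scale (spread_neq0 s2).
have [k3 k30 ->] := zdir_scale (spread_neq0 s3); have [k4 k40 ->] := zdir_scale (spread_neq0 s4).
rewrite /det_ratio !crossZl !crossZr !cross_zpoint !intrM !mulf_eq0 !negb_or.
move=> /and3P[_ _ /andP[i14 iz]] /and3P[_ _ /andP[i23 _]].
by field; rewrite k10 k20 k30 k40 i14 i23 iz.
Qed.

Lemma zdirs_U4Q : (4 <= size s)%N -> U4Q n (zdirs s).
Proof.
move=> s4; split; first by rewrite card_zdirs.
- by move=> u /mem_zdirs[d ds ->]; apply: zdir_direction; exact: spread_neq0.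
- move=> u v /mem_zdirs[d ds ->] /mem_zdirs[d' ds' ->] uv.
  have n0 (w : int * int) : w \in s -> zdir w != 0.
    by move=> /spread_neq0/zdir_direction[/direction_neq0].
  move/(parallelP (n0 _ ds) (n0 _ ds'))/eqP; apply/negP; apply: spread_cross => //.
  by apply: contraNneq uv => ->.
- move=> u1 u2 u3 u4 /mem_zdirs[d1 s1 ->] /mem_zdirs[d2 s2 ->] /mem_zdirs[d3 s3 ->] /mem_zdirs[d4 s4' ->].
  have ne (d d' : int * int) : zdir d != zdir d' -> d != d' by apply: contraNneq => ->.
  rewrite /= !inE !negb_or !andbT => /and3P[/and3P[/ne n12 /ne n13 /ne n14] /andP[/ne n23 /ne n24] /ne n34].
  exists ((idet d1 d3 * idet d2 d4)%:~R / (idet d2 d3 * idet d1 d4)%:~R).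
  rewrite cross_ratioE ?spread_cross // 1?eq_sym //.
  by rewrite det_ratio_zdir // fmorph_div /= !ratr_int.
Qed.
End Spread.

(** Slopes 0, infinity, 1 and 6: in the various orders the cross ratios are 6, 1/6, -5,
    -1/5, 6/5 and 5/6, none of which is exceptional. *)
Definition four_vectors : seq (int * int) := [:: (1, 0); (0, 1); (1, 1); (1, 6)].

Lemma four_vectors_notin_N1 : ordered_cross_ratio_notin_N1 (zdirs four_vectors).
Proof.
move=> u1 u2 u3 u4 UE h12 h23 h34.
have sp : spread four_vectors by [].
have mem u : u \in [:: u1; u2; u3; u4] -> exists2 d, d \in four_vectors & u = zdir d.
  by move=> h; apply: mem_zdirs; rewrite UE !inE in h *; rewrite -!orbA; move: h; do 4!case: (u == _).
have [d1 s1 e1] : exists2 d, d \in four_vectors & u1 = zdir d by apply: mem; rewrite !inE eqxx.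
have [d2 s2 e2] : exists2 d, d \in four_vectors & u2 = zdir d by apply: mem; rewrite !inE eqxx orbT.
have [d3 s3 e3] : exists2 d, d \in four_vectors & u3 = zdir d by apply: mem; rewrite !inE eqxx !orbT.
have [d4 s4 e4] : exists2 d, d \in four_vectors & u4 = zdir d by apply: mem; rewrite !inE eqxx !orbT.
have ne d d' : angle (zdir d) < angle (zdir d') -> d' != d by apply: contraTneq => ->; rewrite ltxx.
rewrite {}e1 {}e2 {}e3 {}e4 in h12 h23 h34 *.
have n12 := ne _ _ h12; have n23 := ne _ _ h23; have n34 := ne _ _ h34.
have n13 := ne _ _ (lt_trans h12 h23); have n24 := ne _ _ (lt_trans h23 h34).
have n14 := ne _ _ (lt_trans (lt_trans h12 h23) h34).
rewrite cross_ratioE ?(spread_cross sp) // (det_ratio_zdir sp) // 1?eq_sym //.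
have : all (fun d1 => all (fun d2 => all (fun d3 => all (fun d4 =>
    (uniq [:: d1; d2; d3; d4]) ==>
    let p := idet d1 d3 * idet d2 d4 in let q := idet d2 d3 * idet d1 d4 in
    [&& q != 0, 3 * p != 4 * q, 2 * p != 3 * q, p != 2 * q, p != 3 * q & p != 4 * q])
    four_vectors) four_vectors) four_vectors) four_vectors by vm_compute.
move=> /allP/(_ _ s1)/allP/(_ _ s2)/allP/(_ _ s3)/allP/(_ _ s4).
have -> : uniq [:: d1; d2; d3; d4].
  by rewrite /= !inE !negb_or !andbT; do !(apply/andP; split); rewrite // eq_sym.
move: (idet d1 d3 * idet d2 d4) (idet d2 d3 * idet d1 d4) => p q /=.
move=> /and5P[q0 h1 h2 h3 /andP[h4 h5]].
have qR : q%:~R != 0 :> R by rewrite intr_eq0.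
have key (a b : int) : b != 0 -> b * p != a * q -> p%:~R / q%:~R != a%:~R / b%:~R :> R.
  move=> b0; apply: contra_neq => e; apply: (intr_inj (R := R)).
  have bR : b%:~R != 0 :> R by rewrite intr_eq0.
  rewrite !intrM; move/eqP: e; rewrite eqr_div // => /eqP; rewrite mulrC => ->; ring.
have key1 (a : int) : p != a * q -> p%:~R / q%:~R != a%:~R :> R.
  by move=> h; have := key a 1 isT; rewrite mul1r divr1; apply.
rewrite /N1 !inE !negb_or.
by rewrite (key 4 3 isT h1) (key 3 2 isT h2) (key1 2 h3) (key1 3 h4) (key1 4 h5).
Qed.

Theorem four_determining_directions : exists U : {fset R[i]},
  [/\ U4Q n U, #|` U| = 4%N & ordered_cross_ratio_notin_N1 U].
Proof.
exists (zdirs four_vectors); split; last exact: four_vectors_notin_N1.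
  exact: zdirs_U4Q.
by rewrite card_zdirs.
Qed.

(** The roots of the system G2, up to sign, in coordinates where the squared length is
    [x ^ 2 + x y + y ^ 2]. *)
Definition six_vectors : seq (int * int) :=
  [:: (1, 0); (0, 1); (1, -1); (1, 1); (2, -1); (1, -2)].

(** The orbit of (2, 1) under the symmetries of the quadratic form
    [x ^ 2 + x y + y ^ 2] is a convex 12-gon.  The rotations give one half of its
    vertices, and each of the six reflections exchanges the two halves. *)
Theorem six_undetermined_directions : exists U : {fset R[i]},
  [/\ U4Q n U, #|` U| = 6%N & forall L : set R[i], cyclotomic_model_sets n L ->
      ~ determined (convex_subsets L) U].
Proof.
have sp : spread six_vectors by [].
exists (zdirs six_vectors); split; [exact: zdirs_U4Q|by rewrite card_zdirs|].
move=> L LM.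
pose E : seq (int * int) := [:: (2, 1); (-1, 3); (-3, 2); (-2, -1); (1, -3); (3, -2)].
pose O : seq (int * int) := [:: (1, 2); (3, -1); (2, -3); (-1, -2); (-3, 1); (-2, 3)].
have q12 : cross (ev 1 z) (ev 'X z) != 0.
  rewrite /ev map_polyX hornerX rmorph1 hornerC /cross /= mul1r mul0r subr0.
  by rewrite (gt_eqF Im_zeta_gt0).
(* a supporting line at [v] is the tangent of the ellipse [x ^ 2 + x y + y ^ 2 = 7],
   on which the vertices lie *)
apply: (@lattice_polygon_not_determined 1 'X q12
  (fun v => (2 * v.2 + v.1, - (2 * v.1 + v.2))) E O) => //.
move=> u /mem_zdirs[d ds ->].
have d0 := spread_neq0 sp ds; have [k k0 kE] := zdir_scale d0.
split; first by have [/direction_neq0] := zdir_direction d0.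
exists d, k; split => //.
have : all (balanced E O) six_vectors by [].
by move/allP; apply.
Qed.

End Constructions.

(** * At most three directions *)

Section FewDirections.
Variables (R : realType) (n : nat).
Hypothesis hn : (2 < n)%N.
Local Notation z := (zeta R n).
Implicit Types (p q : {poly int}).

Lemma cyc_direction_poly (u : R[i]) : cyc_direction n u ->
  u != 0 /\ exists2 p, ev p z != 0 & cross u (ev p z) = 0.
Proof.
move=> [/direction_neq0 u0 [x [/asboolP[p ->] x0 [k _ uE]]]]; split => //.
by exists p => //; rewrite uE crossZl crossxx mulr0.
Qed.

Lemma independent_poly p : ev p z != 0 -> exists q, cross (ev p z) (ev q z) != 0.
Proof.
move=> p0; have Iz := lt0r_neq0 (Im_zeta_gt0 R hn).
have E1 : ev 1 z = 1 by rewrite /ev rmorph1 hornerC.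
have EX : ev 'X z = z by rewrite /ev map_polyX hornerX.
have [c1|c1] := eqVneq (cross (ev p z) 1) 0; last by exists 1; rewrite E1.
have [cX|cX] := eqVneq (cross (ev p z) z) 0; last by exists 'X; rewrite EX.
case/eqP: p0; apply: (@cross2_eq0 R 1 z).
- by rewrite /cross /= mul1r mul0r subr0.
- by rewrite crossC c1 oppr0.
- by rewrite crossC cX oppr0.
Qed.

(** Fewer than three directions are completed to three. *)
Theorem at_most_three_undetermined (U : {fset R[i]}) (L : set R[i]) : (#|` U| <= 3)%N ->
  (forall u, u \in U -> cyc_direction n u) -> pairwise_nonparallel U ->
  cyclotomic_model_sets n L -> ~ determined (convex_subsets L) U.
Proof.
move=> U3 Udir np LM.
have U0 u : u \in U -> u != 0 by move=> /Udir/cyc_direction_poly[].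
have two p1 p2 : cross (ev p1 z) (ev p2 z) != 0 ->
    (forall u, u \in U -> cross u (ev p1 z) = 0 \/ cross u (ev p2 z) = 0) ->
    ~ determined (convex_subsets L) U.
  move=> c12 UP; apply: (@three_directions_undetermined R n hn U L p1 p2 (p1 + p2)) => //.
  - by rewrite evD crossDr crossxx addr0 crossC oppr_eq0.
  - by rewrite evD crossDl crossxx add0r crossC oppr_eq0.
  - by move=> u Uu; split; [exact: U0|case: (UP u Uu); [constructor 1|constructor 2]].
have one p1 : ev p1 z != 0 -> (forall u, u \in U -> cross u (ev p1 z) = 0) ->
    ~ determined (convex_subsets L) U.
  move=> /independent_poly[p2 c12] UP; apply: (two p1 p2) => // u Uu.
  by left; exact: UP.
have indep u v p q : u \in U -> v \in U -> u != v -> ev p z != 0 -> ev q z != 0 ->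
    cross u (ev p z) = 0 -> cross v (ev q z) = 0 -> cross (ev p z) (ev q z) != 0.
  move=> Uu Uv uv p0 q0 up vq; have [k pk] := cross_eq0 (U0 u Uu) up.
  have [l ql] := cross_eq0 (U0 v Uv) vq; rewrite pk ql crossZl crossZr.
  have k0 : k != 0 by apply: contraNneq p0 => k0; rewrite pk k0 mul0r.
  have l0 : l != 0 by apply: contraNneq q0 => l0; rewrite ql l0 mul0r.
  by rewrite !mulf_neq0 //; apply: (nonparallel_cross U0 np).
have memU u : (u \in U) = (u \in enum_fset U) by [].
have uU : uniq (enum_fset U) := fset_uniq U.
move: U3 uU memU; move: (enum_fset U) => [|u1 [|u2 [|u3 [|]]]] //= _ uU memU.
- apply: (one 1); first by rewrite /ev rmorph1 hornerC oner_eq0.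
  by move=> u; rewrite memU.
- have U1 : u1 \in U by rewrite memU mem_head.
  have [_ [p1 p10 c1]] := cyc_direction_poly (Udir _ U1).
  by apply: (one p1) => // u; rewrite memU inE => /eqP ->.
- have U1 : u1 \in U by rewrite memU mem_head.
  have U2 : u2 \in U by rewrite memU !inE eqxx orbT.
  have [_ [p1 p10 c1]] := cyc_direction_poly (Udir _ U1).
  have [_ [p2 p20 c2]] := cyc_direction_poly (Udir _ U2).
  rewrite inE andbT in uU.
  apply: (two p1 p2); first exact: (indep u1 u2).
  by move=> u; rewrite memU !inE => /orP[/eqP->|/eqP->]; [left|right].
- have U1 : u1 \in U by rewrite memU mem_head.
  have U2 : u2 \in U by rewrite memU !inE eqxx orbT.
  have U3 : u3 \in U by rewrite memU !inE eqxx !orbT.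
  have [_ [p1 p10 c1]] := cyc_direction_poly (Udir _ U1).
  have [_ [p2 p20 c2]] := cyc_direction_poly (Udir _ U2).
  have [_ [p3 p30 c3]] := cyc_direction_poly (Udir _ U3).
  move: uU; rewrite !inE !negb_or !andbT => /andP[/andP[u12 u13] u23].
  apply: (@three_directions_undetermined R n hn U L p1 p2 p3) => //.
  + exact: (indep u1 u2).
  + exact: (indep u2 u3).
  + by apply: (indep u3 u1) => //; rewrite eq_sym.
  + move=> u Uu; split; first exact: U0.
    by move: Uu; rewrite memU !inE => /or3P[/eqP->|/eqP->|/eqP->];
      [constructor 1|constructor 2|constructor 3].
Qed.
End FewDirections.

Theorem theorem15 (R : realType) (n : nat) (hn : (2 < n)%N) :
  (* (a) *)
  ((exists U : {fset R[i]},
      [/\ U4Q n U, #|` U| = 4%N &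
          forall L : set R[i], cyclotomic_model_sets n L ->
            determined (convex_subsets L) U])
   /\
   (forall U : {fset R[i]}, U4Q n U -> #|` U| = 4%N ->
      ordered_cross_ratio_notin_N1 U ->
      forall L : set R[i], cyclotomic_model_sets n L ->
        determined (convex_subsets L) U))
  /\
  (* (b) *)
  (forall U : {fset R[i]}, (#|` U| <= 3)%N ->
     (forall u, u \in U -> cyc_direction n u) -> pairwise_nonparallel U ->
     forall L : set R[i], cyclotomic_model_sets n L ->
       ~ determined (convex_subsets L) U)
  /\
  (* (c) *)
  (forall U : {fset R[i]}, U4Q n U -> #|` U| = 7%N ->
     forall L : set R[i], cyclotomic_model_sets n L ->
       determined (convex_subsets L) U)
  /\
  (* (d) *)
  (exists U : {fset R[i]},
     [/\ U4Q n U, #|` U| = 6%N &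
         forall L : set R[i], cyclotomic_model_sets n L ->
           ~ determined (convex_subsets L) U]).
Proof.
have four (U : {fset R[i]}) : U4Q n U -> #|` U| = 4%N -> ordered_cross_ratio_notin_N1 U ->
    forall L : set R[i], cyclotomic_model_sets n L -> determined (convex_subsets L) U.
  by move=> UQ U4 UN L _; apply: four_directions_determine UQ U4 UN.
split; first split => //.
  have [U [UQ U4 UN]] := four_determining_directions R hn.
  by exists U; split => // L; apply: four.
split; first by move=> U U3 Udir np L LM; apply: (at_most_three_undetermined hn).
split; last exact: six_undetermined_directions.
by move=> U UQ U7 L _; apply: seven_directions_determine UQ U7.
Qed.
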